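(* Let $F: U \subset \mathbb{R}^2 \to \mathbb{R}^2$ be an analytic map in a neighborhood $U$ of $(0,0)$ in reduced form (see context). Assume, according to the case to which $F$ belongs: in case 1, $a_k>0$; in case 2, $a_k>0$ and $b_l\neq 0$; in case 3, $b_l<0$. Let $\rho>0$ and let $\hat K:(-\rho,\rho)\to\mathbb{R}^2$ and $\hat R:(-\rho,\rho)\to\mathbb{R}$ be analytic maps satisfying, as $t\to0$, $$\hat K(t)=\begin{cases}(t^2,\;\hat K^y_{k+1}t^{k+1})+(O(t^3),\,O(t^{k+2})) & \text{in case 1},\\ (t,\;\hat K^y_l t^l)+(O(t^2),\,O(t^{l+1})) & \text{in cases 2, 3},\end{cases}$$ and $\hat R(t)=t+\hat R_Nt^N+O(t^{N+1})$ with $\hat R_N<0$, such that $$F(\hat K(t))-\hat K(\hat R(t))=(O(t^{n+N}),\,O(t^{n+2N-1}))$$ for some integer $n\ge2$ in case 1, or $n\ge1$ in cases 2, 3. Then there exist $\rho'\in(0,\rho]$, a $C^1$ map $K:[0,\rho')\to\mathbb{R}^2$, analytic in $(0,\rho')$, and an analytic map $R:(-\rho',\rho')\to\mathbb{R}$ such that $$F(K(t))=K(R(t)),\qquad t\in[0,\rho'),$$ and $$K(t)-\hat K(t)=(O(t^{n+1}),\,O(t^{n+N})),$$ $$R(t)-\hat R(t)=\begin{cases}O(t^{2k-1})&\text{if } n\le k,\\ 0&\text{if } n>k,\end{cases}\quad\text{in case 1},\qquad R(t)-\hat R(t)=\begin{cases}O(t^{2l-1})&\text{if } n\le l-1,\\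 0&\text{if } n>l-1,\end{cases}\quad\text{in cases 2, 3}.$$
   Context: $\mathbb{R}^2$ carries the norm $\|(x,y)\|=\max\{|x|,|y|\}$. An analytic map $F$ is in reduced form if $$F(x,y)=\begin{pmatrix} x+cy\\ y+p(x)+y\,q(x)+u(x,y)+g(x,y)\end{pmatrix},$$ where $c>0$ and, for some integers $2\le k,l\le r$, $p(x)=x^k(a_k+\cdots+a_rx^{r-k})$, $q(x)=x^{l-1}(b_l+\cdots+b_rx^{r-l})$, $u(x,y)$ is a polynomial all of whose terms have the factor $y^2$, $p(x)+yq(x)+u(x,y)$ is the Taylor polynomial of degree $r$ at the origin of a function $f(x,y)=O(\|(x,y)\|^2)$ (the second component of $F$ being $y+f(x,y)$), and $g$ is analytic with $g(x,y)=o(\|(x,y)\|^r)$. Cases: Case 1: $k<2l-1$ and $a_k\neq0$. Case 2: $k=2l-1$ and $a_k,b_l\neq0$. Case 3: $k>2l-1$ and $b_l\neq0$. Set $N=k$ in case 1 and $N=l$ in cases 2 and 3. All $O(\cdot)$ are as $t\to0$. *)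

(* Defs.v *)
From Stdlib Require Import Reals.
From Coquelicot Require Import Coquelicot.
Open Scope R_scope.

(** ** Asymptotics *)

(* Coquelicot has [is_domin] for little-o, but no big-O. *)
Definition bigO {T : Type} (F : (T -> Prop) -> Prop) (f g : T -> R) : Prop :=
  exists C : R, F (fun t => Rabs (f t) <= C * Rabs (g t)).

(* Coquelicot's norm on [R * R] is the Euclidean one. *)
Definition max_norm (z : R * R) : R := Rmax (Rabs (fst z)) (Rabs (snd z)).

(** ** Regularity *)

Definition analytic_at (f : R -> R) (t0 : R) : Prop :=
  exists a : nat -> R, locally t0 (fun t => is_pseries a (t - t0) (f t)).

Definition analytic_on (D : R -> Prop) (f : R -> R) : Prop :=
  forall t, D t -> analytic_at f t.

(* The first two conjuncts say that the double series is absolutely summable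
   over [nat * nat], so the order of summation in the third is immaterial. *)
Definition is_pseries2 (a : nat -> nat -> R) (x y s : R) : Prop :=
  (forall i, ex_series (fun j => Rabs (a i j * x ^ i * y ^ j))) /\
  ex_series (fun i => Series (fun j => Rabs (a i j * x ^ i * y ^ j))) /\
  is_series (fun i => Series (fun j => a i j * x ^ i * y ^ j)) s.

Definition analytic2_at (f : R * R -> R) (z0 : R * R) : Prop :=
  exists a : nat -> nat -> R,
    locally z0 (fun z => is_pseries2 a (fst z - fst z0) (snd z - snd z0) (f z)).

Definition analytic2_on (U : R * R -> Prop) (f : R * R -> R) : Prop :=
  forall z, U z -> analytic2_at f z.

(* Restricting the filters to [D] makes the derivative and its continuity
   one-sided at an endpoint of [D]. *)
Definition C1_on (D : R -> Prop) (f : R -> R) : Prop :=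
  exists f' : R -> R, forall t, D t ->
    filterdiff f (within D (locally t)) (fun h => scal h (f' t)) /\
    filterlim f' (within D (locally t)) (locally (f' t)).

(** ** Reduced form *)

Definition p_poly (k r : nat) (a : nat -> R) (x : R) : R :=
  x ^ k * sum_f_R0 (fun i => a (k + i)%nat * x ^ i) (r - k).

Definition q_poly (l r : nat) (b : nat -> R) (x : R) : R :=
  x ^ (l - 1) * sum_f_R0 (fun i => b (l + i)%nat * x ^ i) (r - l).

Definition poly_with_factor_y2 (u : R -> R -> R) : Prop :=
  exists (d : nat) (w : nat -> nat -> R), forall x y,
    u x y =
    sum_f_R0 (fun i => sum_f_R0 (fun j => w i j * x ^ i * y ^ (j + 2)) d) d.

(* [DL_pol r f 0 0] is Coquelicot's Taylor polynomial of total degree [r] of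
   [f] at the origin; it depends only on the germ of [f] there, hence only on
   the values of [F] in the open set [U]. *)
Definition reduced_form (U : R * R -> Prop) (F : R * R -> R * R)
    (c : R) (k l r : nat) (a b : nat -> R) : Prop :=
  0 < c /\ (2 <= k <= r)%nat /\ (2 <= l <= r)%nat /\
  exists (u g : R -> R -> R),
    let f := fun x y => snd (F (x, y)) - y in
    poly_with_factor_y2 u /\
    (forall x y, U (x, y) ->
       F (x, y) =
       (x + c * y, y + p_poly k r a x + y * q_poly l r b x + u x y + g x y)) /\
    bigO (locally (0, 0)) (fun z => f (fst z) (snd z))
      (fun z => max_norm z ^ 2) /\
    (forall x y,
       DL_pol r f 0 0 x y = p_poly k r a x + y * q_poly l r b x + u x y) /\
    analytic2_on U (fun z => g (fst z) (snd z)) /\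
    is_domin (locally (0, 0)) (fun z => max_norm z ^ r)
      (fun z => g (fst z) (snd z)).

(** ** The three cases *)

Inductive reduced_case : Set := Case1 | Case2 | Case3.

Definition in_case (s : reduced_case) (k l : nat) (a b : nat -> R) : Prop :=
  match s with
  | Case1 => (k < 2 * l - 1)%nat /\ a k <> 0
  | Case2 => k = (2 * l - 1)%nat /\ a k <> 0 /\ b l <> 0
  | Case3 => (k > 2 * l - 1)%nat /\ b l <> 0
  end.

Definition sign_condition (s : reduced_case) (k l : nat) (a b : nat -> R) :
    Prop :=
  match s with
  | Case1 => a k > 0
  | Case2 => a k > 0 /\ b l <> 0
  | Case3 => b l < 0
  end.

Definition case_N (s : reduced_case) (k l : nat) : nat :=
  match s with Case1 => k | Case2 | Case3 => l end.

Definition case_n_min (s : reduced_case) : nat :=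
  match s with Case1 => 2 | Case2 | Case3 => 1 end.

(* [kappa] is the coefficient of [t ^ (k + 1)] in case 1 and of [t ^ l]
   in cases 2 and 3. *)
Definition K_expansion (s : reduced_case) (k l : nat) (kappa : R)
    (K : R -> R * R) : Prop :=
  match s with
  | Case1 =>
      bigO (locally 0) (fun t => fst (K t) - t ^ 2) (fun t => t ^ 3) /\
      bigO (locally 0) (fun t => snd (K t) - kappa * t ^ (k + 1))
        (fun t => t ^ (k + 2))
  | Case2 | Case3 =>
      bigO (locally 0) (fun t => fst (K t) - t) (fun t => t ^ 2) /\
      bigO (locally 0) (fun t => snd (K t) - kappa * t ^ l)
        (fun t => t ^ (l + 1))
  end.

Definition R_estimate (s : reduced_case) (k l n : nat) (rho : R)
    (Rf Rhat : R -> R) : Prop :=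
  match s with
  | Case1 =>
      ((n <= k)%nat ->
         bigO (locally 0) (fun t => Rf t - Rhat t) (fun t => t ^ (2 * k - 1))) /\
      ((n > k)%nat -> forall t, - rho < t < rho -> Rf t - Rhat t = 0)
  | Case2 | Case3 =>
      ((n <= l - 1)%nat ->
         bigO (locally 0) (fun t => Rf t - Rhat t) (fun t => t ^ (2 * l - 1))) /\
      ((n > l - 1)%nat -> forall t, - rho < t < rho -> Rf t - Rhat t = 0)
  end.

(* Main.v *)
Require Import Defs.
From Stdlib Require Import Reals Lra Lia ClassicalEpsilon Wf_nat Compare_dec.
From Coquelicot Require Import Coquelicot.
Open Scope R_scope.

(* With [N = q + 1], all three cases look for [K(t) ~ (t^m, kappa t^(m+q))]
   with [m = 2] or [m = 1].

   Formal part.  If the invariance error is [(O(t^(nu+q)), O(t^(nu+2q)))],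
   adding [(alpha t^nu, beta t^(nu+q))] to [K] removes its leading terms after
   solving a 2x2 linear system, which is singular only for [nu = m + q]; there
   a term [delta t^(2q+1)] is added to [R] instead.  Hence [nu] may be taken
   as large as we like.

   Analytic part.  The iteration [K |-> (K1 o R - c K2, K2 o R - f o K)] fixes
   exactly the solutions of [F o K = K o R] ([R] is called [Q] below).  Its
   increments are measured at each [t > 0] by the absolutely summed Taylor
   series on the disc of radius [s t] around [t].  Since [R] contracts like
   [t + R_N t^N], it maps the disc at [t] into the disc at [R t]; so analyticity
   survives without complex analysis, and for large [nu] the increments sum to
   [O(t^nu)]. *)

(** The origin is a parabolic fixed point of [Q], with orbits tending to 0 only like [n^(-1/q)], so
    no geometric factor makes the increments summable. A supersolution controls their sum instead:
    [t^nu - Q(t)^nu] is at least [nu |R_N|/2 t^(nu+q)], so along one step of [Q] the function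
    [A t^nu] drops by more than the new terms of size [t^(nu+q)] once [nu |R_N|/2] is at least
    [1 + c + 2 L], with [L] the Lipschitz constant of [f]. This balance needs weights: [x] has
    weight [m], [y] weight [m + q] and [f] weighted order [m + 2q], so that varying the two
    components costs just the factors [t^(2q)] and [t^q]. It also needs [L] before [nu]: the bounds
    on the curve that enter [L] may depend on [m], [q] and [kappa], but not on the corrected curve,
    which changes with [nu]. Summed coefficients can replace the supremum over a complex disc
    because they give a submultiplicative norm that is stable under substitution; the price is that
    the inclusion of discs must be proved for this norm of [Q(t+h) - Q(t)], not merely for its
    values. *)

(** * Real series: bounds by partial sums and dominated convergence *)

Lemma is_series_lim_sum (a : nat -> R) (l : R) :
  is_series a l <-> is_lim_seq (sum_f_R0 a) l.
Proof.
  split; intros H.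
  - apply is_lim_seq_ext with (sum_n a).
    + intros n; apply sum_n_Reals.
    + exact H.
  - apply (is_lim_seq_ext (sum_f_R0 a) (sum_n a)) in H.
    + exact H.
    + intros n; symmetry; apply sum_n_Reals.
Qed.

Lemma ex_series_nonneg_bounded (a : nat -> R) (M : R) :
  (forall n, 0 <= a n) -> (forall n, sum_f_R0 a n <= M) -> ex_series a.
Proof.
  intros Ha HM.
  destruct (ex_finite_lim_seq_incr (sum_f_R0 a) M) as [l Hl]; auto.
  - intros n; simpl; specialize (Ha (S n)); lra.
  - exists l; apply is_series_lim_sum; exact Hl.
Qed.

Lemma Series_le_bound (a : nat -> R) (M : R) :
  ex_series a -> (forall n, sum_f_R0 a n <= M) -> Series a <= M.
Proof.
  intros Ha HM. apply Series_correct, is_series_lim_sum in Ha.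
  apply (is_lim_seq_le _ (fun _ => M) _ M HM Ha (is_lim_seq_const M)).
Qed.

Lemma sum_le_Series (a : nat -> R) (n : nat) :
  (forall n, 0 <= a n) -> ex_series a -> sum_f_R0 a n <= Series a.
Proof.
  intros Hp Ha. apply Series_correct, is_series_lim_sum in Ha.
  apply (is_lim_seq_incr_compare _ _ Ha).
  intros k; simpl; specialize (Hp (S k)); lra.
Qed.

Lemma term_le_Series (a : nat -> R) (n : nat) :
  (forall n, 0 <= a n) -> ex_series a -> a n <= Series a.
Proof.
  intros Hp Ha. apply Rle_trans with (sum_f_R0 a n).
  - destruct n; simpl; [lra|].
    pose proof (cond_pos_sum a n Hp); lra.
  - now apply sum_le_Series.
Qed.

Lemma ex_series_Rabs_le (a b : nat -> R) :
  (forall n, Rabs (a n) <= b n) -> ex_series b -> ex_series (fun n => Rabs (a n)).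
Proof.
  intros H Hb. apply (ex_series_le (fun n => Rabs (a n)) b); auto.
  intros n. change (Rabs (Rabs (a n)) <= b n). rewrite Rabs_Rabsolu; auto.
Qed.

Lemma Rabs_Series_le (a b : nat -> R) :
  (forall n, Rabs (a n) <= b n) -> ex_series b -> Rabs (Series a) <= Series b.
Proof.
  intros H Hb. eapply Rle_trans.
  - apply Series_Rabs. now apply ex_series_Rabs_le with b.
  - apply Series_le; auto. intros n; split; auto using Rabs_pos.
Qed.

Lemma is_series_sum_finite (a : nat -> nat -> R) (l : nat -> R) (J : nat) :
  (forall j, is_series (a j) (l j)) ->
  is_series (fun i => sum_f_R0 (fun j => a j i) J) (sum_f_R0 l J).
Proof.
  intros H; induction J as [|J IH]; simpl; auto.
  apply (is_series_plus (V := R_NormedModule)); auto.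
Qed.

Lemma is_series_unit (n0 : nat) (c : R) :
  is_series (fun n => if Nat.eqb n n0 then c else 0) c.
Proof.
  apply is_series_lim_sum.
  apply is_lim_seq_ext_loc with (fun _ => c); [|apply is_lim_seq_const].
  exists n0. intros n Hn.
  assert (H : forall n, sum_f_R0 (fun n => if Nat.eqb n n0 then c else 0) n
                = if Nat.leb n0 n then c else 0).
  { induction n1 as [|n1 IH].
    - simpl. destruct n0; auto.
    - rewrite tech5, IH.
      destruct (Nat.leb_spec n0 n1), (Nat.eqb_spec (S n1) n0),
        (Nat.leb_spec n0 (S n1)); try lia; lra. }
  rewrite H. destruct (Nat.leb_spec n0 n); [auto|lia].
Qed.

(* Tannery's theorem: dominated convergence for series. *)
Lemma Series_dominated_lim0 (x : nat -> nat -> R) (m : nat -> R) :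
  (forall i, is_lim_seq (fun J => x J i) 0) ->
  (forall J i, Rabs (x J i) <= m i) -> ex_series m ->
  is_lim_seq (fun J => Series (x J)) 0.
Proof.
  intros Hlim Hdom Hm.
  assert (Hm0 : forall i, 0 <= m i).
  { intros i; eapply Rle_trans; [apply Rabs_pos|apply (Hdom 0%nat i)]. }
  apply is_lim_seq_spec. intros eps.
  assert (He : 0 < eps / 2) by (pose proof (cond_pos eps); lra).
  pose proof (Series_correct _ Hm) as HS. apply is_series_lim_sum in HS.
  apply is_lim_seq_spec in HS. destruct (HS (mkposreal _ He)) as [I HI].
  specialize (HI I (le_n I)). simpl in HI.
  (* Split at [I]: beyond it the tail of [m] is below [eps / 2], and up to it there is a finite sum
     of null sequences. *)
  assert (Hfin : is_lim_seq (fun J => sum_f_R0 (fun i => Rabs (x J i)) I) 0).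
  { clear HI. induction I as [|I IH]; simpl.
    - apply (is_lim_seq_abs_0 (fun J => x J 0%nat)); auto.
    - replace (Finite 0) with (Finite (0 + 0)) by (f_equal; ring).
      apply is_lim_seq_plus'; auto. now apply (is_lim_seq_abs_0 (fun J => x J (S I))). }
  apply is_lim_seq_spec in Hfin. destruct (Hfin (mkposreal _ He)) as [J0 HJ].
  exists J0. intros J HJJ. specialize (HJ J HJJ). simpl in HJ.
  rewrite Rminus_0_r in *.
  assert (Hx : ex_series (fun i => Rabs (x J i))).
  { now apply ex_series_Rabs_le with m. }
  eapply Rle_lt_trans; [apply Series_Rabs, Hx|].
  rewrite (Series_incr_n (fun i => Rabs (x J i)) (S I)); [|lia|exact Hx].
  rewrite (Series_incr_n m (S I)) in HI; [|lia|exact Hm]. simpl pred in *.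
  assert (Ht : Series (fun k => Rabs (x J (S I + k)%nat)) <= Series (fun k => m (S I + k)%nat)).
  { apply Series_le.
    - intros k; split; auto using Rabs_pos.
    - now apply (ex_series_incr_n m (S I)). }
  assert (Hp : 0 <= sum_f_R0 (fun i => Rabs (x J i)) I).
  { apply cond_pos_sum; intros; apply Rabs_pos. }
  rewrite Rabs_pos_eq in HJ by exact Hp.
  apply Rabs_def2 in HI. lra.
Qed.

Lemma pow_le_1 (x : R) (n : nat) : 0 <= x <= 1 -> x ^ n <= 1.
Proof.
  intros H. rewrite <- (pow1 n). apply pow_incr; lra.
Qed.

Lemma pow_decr_exp (x : R) (m n : nat) : 0 <= x <= 1 -> (m <= n)%nat -> x ^ n <= x ^ m.
Proof.
  intros H Hmn. replace n with (m + (n - m))%nat by lia. rewrite pow_add.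
  rewrite <- (Rmult_1_r (x ^ m)) at 2.
  apply Rmult_le_compat_l; [apply pow_le; lra|now apply pow_le_1].
Qed.

(** * Functions with absolutely summable Taylor coefficients *)

(** The weighted l^1 norm of the Taylor coefficients at 0, a real substitute for the supremum over a
    complex disc of radius [r]. Bounding the partial sums by [M] includes the convergence. *)
Definition wiener (phi : R -> R) (r M : R) : Prop :=
  exists a : nat -> R,
    (forall n, sum_f_R0 (fun j => Rabs (a j) * r ^ j) n <= M) /\
    forall h, Rabs h <= r -> is_series (fun j => a j * h ^ j) (phi h).

Lemma wiener_ext (phi psi : R -> R) (r M : R) :
  (forall h, Rabs h <= r -> phi h = psi h) -> wiener phi r M -> wiener psi r M.
Proof.
  intros H (a & Ha & Hs). exists a; split; auto.
  intros h Hh. rewrite <- H; auto.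
Qed.

Lemma wiener_le (phi : R -> R) (r M M' : R) :
  M <= M' -> wiener phi r M -> wiener phi r M'.
Proof.
  intros H (a & Ha & Hs). exists a; split; auto.
  intros n; eapply Rle_trans; eauto.
Qed.

Lemma wiener_ge0 (phi : R -> R) (r M : R) : wiener phi r M -> 0 <= M.
Proof.
  intros (a & Ha & _). specialize (Ha 0%nat). simpl in Ha.
  pose proof (Rabs_pos (a 0%nat)); lra.
Qed.

Lemma wiener_const (c r : R) : 0 <= r -> wiener (fun _ => c) r (Rabs c).
Proof.
  intros Hr. exists (fun n => if Nat.eqb n 0 then c else 0). split.
  - intros n. apply Req_le. induction n as [|n IH]; simpl; [ring|].
    simpl in IH. rewrite IH, Rabs_R0; ring.
  - intros h _. eapply is_series_ext; [|apply (is_series_unit 0 c)].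
    intros [|n]; simpl; ring.
Qed.

Lemma wiener_id (r : R) : 0 <= r -> wiener (fun h => h) r r.
Proof.
  intros Hr. exists (fun n => if Nat.eqb n 1 then 1 else 0). split.
  - intros n. destruct n as [|n]; simpl.
    + rewrite Rabs_R0; lra.
    + apply Req_le. induction n as [|n IH]; simpl.
      * rewrite Rabs_R0, Rabs_R1; ring.
      * simpl in IH; rewrite IH, Rabs_R0; ring.
  - intros h _. eapply is_series_ext; [|apply (is_series_unit 1 h)].
    intros [|[|n]]; simpl; ring.
Qed.

Lemma wiener_scal (c : R) (phi : R -> R) (r M : R) :
  wiener phi r M -> wiener (fun h => c * phi h) r (Rabs c * M).
Proof.
  intros (a & Ha & Hs). exists (fun n => c * a n). split.
  - intros n. rewrite (sum_eq _ (fun j => Rabs (a j) * r ^ j * Rabs c)).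
    + rewrite <- scal_sum. apply Rmult_le_compat_l; auto using Rabs_pos.
    + intros i _. rewrite Rabs_mult; ring.
  - intros h Hh. rewrite (Rmult_comm c).
    eapply is_series_ext; [|apply (is_series_scal_r c), (Hs h Hh)].
    intros n; simpl; ring.
Qed.

Lemma wiener_plus (phi psi : R -> R) (r M M' : R) : 0 <= r ->
  wiener phi r M -> wiener psi r M' -> wiener (fun h => phi h + psi h) r (M + M').
Proof.
  intros Hr (a & Ha & Hs) (b & Hb & Ht). exists (fun n => a n + b n). split.
  - intros n. eapply Rle_trans; [|apply Rplus_le_compat; [apply (Ha n)|apply (Hb n)]].
    rewrite <- plus_sum. apply sum_Rle. intros j _.
    rewrite <- Rmult_plus_distr_r. apply Rmult_le_compat_r; [now apply pow_le|].
    apply Rabs_triang.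
  - intros h Hh. eapply is_series_ext;
      [|apply (is_series_plus (V := R_NormedModule) _ _ _ _ (Hs h Hh) (Ht h Hh))].
    intros n; simpl. unfold plus; simpl; ring.
Qed.

Lemma wiener_opp (phi : R -> R) (r M : R) :
  wiener phi r M -> wiener (fun h => - phi h) r M.
Proof.
  intros H. apply (wiener_scal (-1)) in H.
  replace (Rabs (-1) * M) with M in H by (rewrite Rabs_left by lra; ring).
  eapply wiener_ext; [|exact H]. intros; simpl; ring.
Qed.

Lemma wiener_minus (phi psi : R -> R) (r M M' : R) : 0 <= r ->
  wiener phi r M -> wiener psi r M' -> wiener (fun h => phi h - psi h) r (M + M').
Proof.
  intros Hr H1 H2. apply wiener_plus; auto. now apply wiener_opp.
Qed.

Lemma wiener_coef_bound (a : nat -> R) (r M h : R) :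
  (forall n, sum_f_R0 (fun j => Rabs (a j) * r ^ j) n <= M) -> Rabs h <= r ->
  ex_series (fun j => Rabs (a j * h ^ j)) /\
  Series (fun j => Rabs (a j * h ^ j)) <= M.
Proof.
  intros H Hh.
  assert (Hb : forall n, sum_f_R0 (fun j => Rabs (a j * h ^ j)) n <= M).
  { intros n; eapply Rle_trans; [|apply (H n)]. apply sum_Rle. intros j _.
    rewrite Rabs_mult, <- RPow_abs. apply Rmult_le_compat_l; [apply Rabs_pos|].
    apply pow_incr; split; auto using Rabs_pos. }
  assert (He : ex_series (fun j => Rabs (a j * h ^ j))).
  { apply ex_series_nonneg_bounded with M; auto. intros; apply Rabs_pos. }
  split; auto. now apply Series_le_bound.
Qed.

Lemma wiener_value (phi : R -> R) (r M h : R) :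
  wiener phi r M -> Rabs h <= r -> Rabs (phi h) <= M.
Proof.
  intros (a & Ha & Hs) Hh.
  rewrite <- (is_series_unique _ _ (Hs h Hh)).
  destruct (wiener_coef_bound a r M h Ha Hh) as [H1 H2].
  eapply Rle_trans; [apply Series_Rabs, H1|exact H2].
Qed.

Lemma wiener_shrink (phi : R -> R) (r s M : R) :
  0 <= s <= r -> wiener phi r M -> wiener phi s M.
Proof.
  intros Hs (a & Ha & H). exists a; split.
  - intros n; eapply Rle_trans; [|apply (Ha n)]. apply sum_Rle. intros j _.
    apply Rmult_le_compat_l; [apply Rabs_pos|]. apply pow_incr; lra.
  - intros h Hh; apply H; lra.
Qed.

(** The coefficients are Cauchy products. Their absolute values are dominated by the Cauchy product
    of the two absolute series, whose sum is the product of the sums. *)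
Lemma wiener_mult (phi psi : R -> R) (r M M' : R) : 0 <= r ->
  wiener phi r M -> wiener psi r M' -> wiener (fun h => phi h * psi h) r (M * M').
Proof.
  intros Hr (a & Ha & Hs) (b & Hb & Ht).
  exists (fun n => sum_f_R0 (fun k => a k * b (n - k)%nat) n). split.
  - assert (Ea : ex_series (fun j => Rabs (a j) * r ^ j)).
    { apply ex_series_nonneg_bounded with M; auto.
      intros; apply Rmult_le_pos; [apply Rabs_pos|now apply pow_le]. }
    assert (Eb : ex_series (fun j => Rabs (b j) * r ^ j)).
    { apply ex_series_nonneg_bounded with M'; auto.
      intros; apply Rmult_le_pos; [apply Rabs_pos|now apply pow_le]. }
    pose proof (is_series_mult_pos _ _ _ _ (Series_correct _ Ea) (Series_correct _ Eb)) as Hm.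
    assert (Hp : forall (c : nat -> R) n, 0 <= Rabs (c n) * r ^ n).
    { intros; apply Rmult_le_pos; [apply Rabs_pos|now apply pow_le]. }
    specialize (Hm (Hp a) (Hp b)).
    intros n. apply Rle_trans with
      (sum_f_R0 (fun n => sum_f_R0 (fun k => Rabs (a k) * r ^ k * (Rabs (b (n - k)%nat) * r ^ (n - k))) n) n).
    + apply sum_Rle. intros i _.
      eapply Rle_trans;
        [apply Rmult_le_compat_r; [now apply pow_le|apply Rsum_abs]|].
      rewrite Rmult_comm, scal_sum. apply sum_Rle. intros k Hk.
      rewrite Rabs_mult.
      apply Req_le. replace (r ^ i) with (r ^ (k + (i - k))) by (f_equal; lia).
      rewrite pow_add; ring.
    + eapply Rle_trans; [apply sum_le_Series|].
      * intros i. apply cond_pos_sum. intros k. apply Rmult_le_pos; apply (Hp a) || apply (Hp b).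
      * eexists; exact Hm.
      * rewrite (is_series_unique _ _ Hm).
        apply Rmult_le_compat.
        -- apply Rle_trans with (Rabs (a 0%nat) * r ^ 0); [apply Hp|].
           now apply (term_le_Series (fun j => Rabs (a j) * r ^ j)).
        -- apply Rle_trans with (Rabs (b 0%nat) * r ^ 0); [apply Hp|].
           now apply (term_le_Series (fun j => Rabs (b j) * r ^ j)).
        -- now apply Series_le_bound.
        -- now apply Series_le_bound.
  - intros h Hh.
    pose proof (is_series_mult _ _ _ _ (Hs h Hh) (Ht h Hh)
      (proj1 (wiener_coef_bound a r M h Ha Hh))
      (proj1 (wiener_coef_bound b r M' h Hb Hh))) as Hm.
    eapply is_series_ext; [|exact Hm].
    intros n; simpl. rewrite Rmult_comm, scal_sum. apply sum_eq. intros k Hk.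
    replace (h ^ n) with (h ^ (k + (n - k))) by (f_equal; lia).
    rewrite pow_add; ring.
Qed.

Lemma wiener_pow (phi : R -> R) (r M : R) (n : nat) : 0 <= r ->
  wiener phi r M -> wiener (fun h => phi h ^ n) r (M ^ n).
Proof.
  intros Hr H. induction n as [|n IH]; simpl.
  - eapply wiener_le; [|apply wiener_const; auto]. rewrite Rabs_R1; lra.
  - now apply wiener_mult.
Qed.

(** A Fubini argument: the new coefficients are the column sums of the double array [a i j], and the
    two orders of summation agree by dominated convergence. *)
Lemma wiener_Series (phi : nat -> R -> R) (r : R) (M : nat -> R) (B : R) : 0 < r ->
  (forall i, wiener (phi i) r (M i)) -> (forall n, sum_f_R0 M n <= B) ->
  wiener (fun h => Series (fun i => phi i h)) r B.
Proof.
  intros Hr H HB.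
  assert (HM0 : forall i, 0 <= M i) by (intros i; now apply (wiener_ge0 (phi i) r)).
  assert (HM : ex_series M) by (now apply ex_series_nonneg_bounded with B).
  (* One coefficient sequence is chosen for each [i] at once. *)
  set (a := fun i => proj1_sig (constructive_indefinite_description _ (H i))).
  assert (Ha : forall i, (forall n, sum_f_R0 (fun j => Rabs (a i j) * r ^ j) n <= M i) /\
    forall h, Rabs h <= r -> is_series (fun j => a i j * h ^ j) (phi i h)).
  { intros i. exact (proj2_sig (constructive_indefinite_description _ (H i))). }
  clearbody a.
  assert (Hrj : forall j, 0 < r ^ j) by (intros; now apply pow_lt).
  assert (Hterm : forall i j, Rabs (a i j) * r ^ j <= M i).
  { intros i j. eapply Rle_trans; [|apply (proj1 (Ha i) j)].
    destruct j; simpl; [lra|].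
    assert (0 <= sum_f_R0 (fun j => Rabs (a i j) * r ^ j) j); [|simpl in *; lra].
    apply cond_pos_sum; intros; apply Rmult_le_pos; [apply Rabs_pos|now apply Rlt_le]. }
  assert (Hcol : forall j, ex_series (fun i => Rabs (a i j))).
  { intros j. apply ex_series_Rabs_le with (fun i => M i * / r ^ j).
    - intros i. apply Rmult_le_reg_r with (r ^ j); auto.
      rewrite Rmult_assoc, Rinv_l, Rmult_1_r; auto. specialize (Hrj j); lra.
    - now apply ex_series_scal_r. }
  assert (Hcol' : forall j, ex_series (fun i => a i j)) by (intros; now apply ex_series_Rabs).
  exists (fun j => Series (fun i => a i j)). split.
  - intros n.
    apply Rle_trans with (sum_f_R0 (fun j => Series (fun i => Rabs (a i j) * r ^ j)) n).
    + apply sum_Rle; intros j _. rewrite Series_scal_r.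
      apply Rmult_le_compat_r; [now apply Rlt_le|]. now apply Series_Rabs.
    + assert (Hx : is_series (fun i => sum_f_R0 (fun j => Rabs (a i j) * r ^ j) n)
        (sum_f_R0 (fun j => Series (fun i => Rabs (a i j) * r ^ j)) n)).
      { apply (is_series_sum_finite (fun j i => Rabs (a i j) * r ^ j)).
        intros j. apply Series_correct, ex_series_scal_r, Hcol. }
      rewrite <- (is_series_unique _ _ Hx).
      apply Rle_trans with (Series M); [|now apply Series_le_bound].
      apply Series_le; auto. intros i; split; [|apply Ha].
      apply cond_pos_sum; intros; apply Rmult_le_pos; [apply Rabs_pos|now apply Rlt_le].
  - intros h Hh.
    assert (Hphi : forall i, Rabs (phi i h) <= M i).
    { intros i; apply (wiener_value _ r); auto. }
    assert (Hpe : ex_series (fun i => phi i h)).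
    { apply ex_series_Rabs, (ex_series_Rabs_le _ M); auto. }
    apply is_series_lim_sum.
    (* For fixed [i] the truncations at [J] converge to [phi i h], and they differ from it by at
       most [2 M i], which is summable. *)
    assert (Hlim : is_lim_seq (fun J => Series (fun i =>
        sum_f_R0 (fun j => a i j * h ^ j) J - phi i h)) 0).
    { apply Series_dominated_lim0 with (fun i => M i + M i).
      - intros i. replace (Finite 0) with (Finite (phi i h - phi i h)) by (f_equal; ring).
        apply is_lim_seq_minus'; [|apply is_lim_seq_const].
        apply is_series_lim_sum, Ha, Hh.
      - intros J i. unfold Rminus. eapply Rle_trans; [apply Rabs_triang|].
        rewrite Rabs_Ropp. apply Rplus_le_compat; auto.
        eapply Rle_trans; [apply Rsum_abs|].
        eapply Rle_trans; [|apply (proj1 (Ha i) J)].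
        apply sum_Rle; intros j _. rewrite Rabs_mult, <- RPow_abs.
        apply Rmult_le_compat_l; [apply Rabs_pos|].
        apply pow_incr; split; auto using Rabs_pos.
      - now apply (ex_series_plus (V := R_NormedModule)). }
    rewrite <- (Rplus_0_l (Series (fun i => phi i h))).
    eapply is_lim_seq_ext; [|apply (is_lim_seq_plus' _ _ _ _ Hlim
      (is_lim_seq_const (Series (fun i => phi i h))))].
    intros J. simpl.
    assert (Hx : is_series (fun i => sum_f_R0 (fun j => a i j * h ^ j) J)
      (sum_f_R0 (fun j => Series (fun i => a i j) * h ^ j) J)).
    { apply (is_series_sum_finite (fun j i => a i j * h ^ j)).
      intros j. rewrite <- Series_scal_r. apply Series_correct, ex_series_scal_r, Hcol'. }
    rewrite Series_minus; [|eexists; exact Hx|auto].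
    rewrite (is_series_unique _ _ Hx); ring.
Qed.

Lemma wiener_is_series (phi : nat -> R -> R) (psi : R -> R) (r : R) (M : nat -> R) (B : R) :
  0 < r -> (forall i, wiener (phi i) r (M i)) -> (forall n, sum_f_R0 M n <= B) ->
  (forall h, Rabs h <= r -> is_series (fun i => phi i h) (psi h)) ->
  wiener psi r B.
Proof.
  intros Hr H HB Hs. eapply wiener_ext; [|apply (wiener_Series phi r M B); auto].
  intros h Hh. simpl. now apply is_series_unique, Hs.
Qed.

(** Expand in powers of [theta]: by submultiplicativity the i-th power has norm at most [r^i], so
    the bounds add up to the norm of [phi] at radius [r]. *)
Lemma wiener_comp (phi theta : R -> R) (r s M : R) : 0 < s ->
  wiener phi r M -> wiener theta s r -> wiener (fun h => phi (theta h)) s M.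
Proof.
  intros Hs (a & Ha & Hser) Hth.
  apply (wiener_is_series (fun i h => a i * theta h ^ i) _ s (fun i => Rabs (a i) * r ^ i)); auto.
  - intros i. apply wiener_scal, wiener_pow; auto. lra.
  - intros h Hh. apply Hser. now apply (wiener_value theta s).
Qed.

(** Dividing by [h] after removing the constant term shifts the coefficients, which costs one factor
    [1 / r]. *)
Lemma wiener_shift (phi : R -> R) (r M : R) : 0 < r -> wiener phi r M ->
  exists psi, wiener psi r (M / r) /\
    forall h, Rabs h <= r -> phi h = phi 0 + h * psi h.
Proof.
  intros Hr (a & Ha & Hs).
  assert (H0 : phi 0 = a 0%nat).
  { assert (Hz : Rabs 0 <= r) by (rewrite Rabs_R0; lra).
    apply Hs in Hz. apply is_series_unique in Hz. rewrite <- Hz.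
    apply is_series_unique.
    eapply is_series_ext; [|apply (is_series_unit 0 (a 0%nat))].
    intros [|n]; simpl; ring. }
  assert (Hb : forall n, sum_f_R0 (fun j => Rabs (a (S j)) * r ^ j) n <= M / r).
  { intros n. apply Rmult_le_reg_r with r; auto.
    unfold Rdiv; rewrite (Rmult_assoc M), Rinv_l, Rmult_1_r by lra.
    eapply Rle_trans; [|apply (Ha (S n))]. rewrite (decomp_sum _ (S n)) by lia. simpl pred.
    rewrite Rmult_comm, scal_sum.
    rewrite (sum_eq _ (fun i => Rabs (a (S i)) * r ^ S i)); [|intros; simpl; ring].
    pose proof (Rabs_pos (a 0%nat)). change (r ^ 0) with 1. lra. }
  exists (fun h => Series (fun j => a (S j) * h ^ j)). split.
  - exists (fun j => a (S j)). split; auto.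
    intros h Hh. apply Series_correct, ex_series_Rabs.
    now apply (wiener_coef_bound (fun j => a (S j)) r (M / r) h).
  - intros h Hh. rewrite H0, <- (is_series_unique _ _ (Hs h Hh)).
    rewrite Series_incr_1 by (eexists; now apply Hs).
    rewrite <- Series_scal_l. simpl. f_equal; [ring|].
    apply Series_ext; intros n; ring.
Qed.

Lemma wiener_diff (phi : R -> R) (r M h : R) : 0 < r ->
  wiener phi r M -> Rabs h <= r -> Rabs (phi h - phi 0) <= M / r * Rabs h.
Proof.
  intros Hr H Hh. destruct (wiener_shift phi r M Hr H) as (psi & Hpsi & E).
  rewrite (E h Hh). replace (phi 0 + h * psi h - phi 0) with (psi h * h) by ring.
  rewrite Rabs_mult. apply Rmult_le_compat_r; [apply Rabs_pos|].
  now apply (wiener_value psi r).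
Qed.

(** A Schwarz lemma: without its constant term, the function gains the ratio [s / r] of the
    radii. *)
Lemma wiener_increment (phi : R -> R) (r s M : R) : 0 < r -> 0 <= s <= r ->
  wiener phi r M -> wiener (fun h => phi h - phi 0) s (s * (M / r)).
Proof.
  intros Hr Hs H. destruct (wiener_shift phi r M Hr H) as (psi & Hpsi & E).
  eapply wiener_ext; [|apply wiener_mult; [lra|now apply wiener_id|
    apply (wiener_shrink psi r s (M / r)); auto]].
  intros h Hh; simpl. rewrite (E h) by lra; ring.
Qed.

(** Re-expansion at [t] is substitution of the translation [h -> t + h], whose norm at radius [s] is
    at most [|t| + s]. *)
Lemma wiener_recenter (phi : R -> R) (r s M t : R) : 0 < s -> Rabs t + s <= r ->
  wiener phi r M -> wiener (fun h => phi (t + h)) s M.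
Proof.
  intros Hs Ht H. apply (wiener_comp phi (fun h => t + h) r s M); auto.
  eapply wiener_le; [exact Ht|].
  apply wiener_plus; [lra|apply wiener_const; lra|apply wiener_id; lra].
Qed.

Lemma wiener_analytic (phi : R -> R) (t r M : R) : 0 < r ->
  wiener (fun h => phi (t + h)) r M -> analytic_at phi t.
Proof.
  intros Hr (a & Ha & Hs). exists a. exists (mkposreal r Hr).
  intros y Hy. change (Rabs (y - t) < r) in Hy. apply is_pseries_R.
  replace (phi y) with (phi (t + (y - t))) by (f_equal; ring).
  apply Hs; lra.
Qed.

(** * Analytic germs at the origin *)

(** Abel's lemma: the terms at [y] tend to 0, so those at [x] are eventually dominated by a
    geometric series of ratio [x / y]. *)
Lemma ex_series_Rabs_pow_lt (a : nat -> R) (x y : R) :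
  ex_series (fun j => a j * y ^ j) -> 0 <= x < y -> ex_series (fun j => Rabs (a j * x ^ j)).
Proof.
  intros H Hx. apply ex_series_lim_0 in H.
  apply (is_lim_seq_abs _ 0) in H. simpl in H. rewrite Rabs_R0 in H.
  apply is_lim_seq_spec in H. destruct (H (mkposreal 1 Rlt_0_1)) as [J HJ]. simpl in HJ.
  assert (Hq : Rabs (x / y) < 1).
  { rewrite Rabs_pos_eq.
    - apply Rmult_lt_reg_r with y; [lra|]. unfold Rdiv; rewrite Rmult_assoc, Rinv_l; lra.
    - apply Rmult_le_pos; [lra|left; apply Rinv_0_lt_compat; lra]. }
  apply (ex_series_incr_n (fun j => Rabs (a j * x ^ j)) J).
  apply (ex_series_Rabs_le (fun k => a (J + k)%nat * x ^ (J + k)) (fun k => (x / y) ^ (J + k))).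
  - intros n. specialize (HJ (J + n)%nat ltac:(lia)).
    rewrite Rminus_0_r, Rabs_Rabsolu in HJ.
    replace (x ^ (J + n)) with (y ^ (J + n) * (x / y) ^ (J + n)).
    + rewrite <- Rmult_assoc, Rabs_mult. rewrite <- (Rmult_1_l ((x / y) ^ (J + n))) at 2.
      rewrite (Rabs_pos_eq ((x / y) ^ (J + n))).
      * apply Rmult_le_compat_r; [|lra]. apply pow_le.
        apply Rmult_le_pos; [lra|left; apply Rinv_0_lt_compat; lra].
      * apply pow_le. apply Rmult_le_pos; [lra|left; apply Rinv_0_lt_compat; lra].
    + rewrite <- Rpow_mult_distr. f_equal. field; lra.
  - apply (ex_series_incr_n (fun k => (x / y) ^ k) J). now apply ex_series_geom.
Qed.

Definition analytic_germ (phi : R -> R) : Prop :=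
  exists r M, 0 < r /\ wiener phi r M.

Lemma analytic_at_germ (phi : R -> R) : analytic_at phi 0 -> analytic_germ phi.
Proof.
  intros (a & [eps H]). pose proof (cond_pos eps) as He.
  (* Convergence at [eps / 2] gives absolute convergence at the smaller [eps / 3]. *)
  exists (eps / 3).
  assert (Hy : ex_series (fun j => a j * (eps / 2) ^ j)).
  { exists (phi (eps / 2)). apply is_pseries_R.
    replace (eps / 2) with (eps / 2 - 0) at 1 by ring. apply H.
    change (Rabs (eps / 2 - 0) < eps). rewrite Rminus_0_r, Rabs_pos_eq; lra. }
  assert (Hx : ex_series (fun j => Rabs (a j * (eps / 3) ^ j))).
  { apply ex_series_Rabs_pow_lt with (eps / 2); [exact Hy|lra]. }
  exists (Series (fun j => Rabs (a j * (eps / 3) ^ j))). split; [lra|].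
  exists a. split.
  - intros n. rewrite (sum_eq _ (fun j => Rabs (a j * (eps / 3) ^ j))).
    + apply sum_le_Series; auto using Rabs_pos.
    + intros i _. rewrite Rabs_mult, (Rabs_pos_eq (_ ^ _)); auto. apply pow_le; lra.
  - intros h Hh. apply is_pseries_R. replace h with (h - 0) at 1 by ring.
    apply H. change (Rabs (h - 0) < eps). rewrite Rminus_0_r; lra.
Qed.

Lemma analytic_germ_plus (phi psi : R -> R) :
  analytic_germ phi -> analytic_germ psi -> analytic_germ (fun t => phi t + psi t).
Proof.
  intros (r & M & Hr & H) (s & M' & Hs & H').
  exists (Rmin r s), (M + M'). pose proof (Rmin_l r s); pose proof (Rmin_r r s).
  assert (0 < Rmin r s) by now apply Rmin_glb_lt. split; auto.
  apply wiener_plus; [lra| |].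
  - apply wiener_shrink with r; auto; lra.
  - apply wiener_shrink with s; auto; lra.
Qed.

Lemma analytic_germ_scal (c : R) (phi : R -> R) :
  analytic_germ phi -> analytic_germ (fun t => c * phi t).
Proof.
  intros (r & M & Hr & H). exists r, (Rabs c * M). split; auto. now apply wiener_scal.
Qed.

Lemma analytic_germ_minus (phi psi : R -> R) :
  analytic_germ phi -> analytic_germ psi -> analytic_germ (fun t => phi t - psi t).
Proof.
  intros H1 (r & M & Hr & H2). apply analytic_germ_plus; auto.
  exists r, M. split; auto. now apply wiener_opp.
Qed.

Lemma analytic_germ_pow (n : nat) : analytic_germ (fun t => t ^ n).
Proof.
  exists 1, (1 ^ n). split; [lra|].
  apply (wiener_pow (fun h => h)); [lra|apply wiener_id; lra].
Qed.

Lemma analytic_germ_comp (phi theta : R -> R) :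
  analytic_germ phi -> analytic_germ theta -> theta 0 = 0 ->
  analytic_germ (fun t => phi (theta t)).
Proof.
  intros (r & M & Hr & H) (s & M' & Hs & H') H0.
  pose proof (wiener_ge0 _ _ _ H') as HM'.
  (* On radius [s'] the norm of [theta] is at most [s' M' / s <= r]; the [+ 1] covers [M' = 0]. *)
  set (s' := Rmin s (r * s / (M' + 1))).
  assert (Hs' : 0 < s').
  { apply Rmin_glb_lt; auto. apply Rmult_lt_0_compat; [nra|apply Rinv_0_lt_compat; lra]. }
  pose proof (Rmin_l s (r * s / (M' + 1))) as L1. pose proof (Rmin_r s (r * s / (M' + 1))) as L2.
  fold s' in L1, L2.
  exists s', M. split; auto. apply wiener_comp with r; auto.
  apply wiener_le with (s' * (M' / s)).
  - apply Rle_trans with (r * s / (M' + 1) * (M' / s)).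
    + apply Rmult_le_compat_r; auto. apply Rmult_le_pos; auto.
      left; now apply Rinv_0_lt_compat.
    + replace (r * s / (M' + 1) * (M' / s)) with (r * (M' / (M' + 1))) by (field; lra).
      rewrite <- (Rmult_1_r r) at 2. apply Rmult_le_compat_l; [lra|].
      apply Rmult_le_reg_r with (M' + 1); [lra|].
      unfold Rdiv; rewrite Rmult_assoc, Rinv_l; lra.
  - eapply wiener_ext; [|apply wiener_increment with (r := s) (M := M'); eauto; lra].
    intros h _; simpl. rewrite H0; ring.
Qed.

(** * Asymptotics at [0+] *)

(** Germs at 0 from the right: the invariant curve lives on [t >= 0], and there powers of [t] need
    no absolute value. *)
Definition near0 (P : R -> Prop) : Prop :=
  exists eps, 0 < eps /\ forall t, 0 < t < eps -> P t.

Lemma near0_and (P Q : R -> Prop) : near0 P -> near0 Q -> near0 (fun t => P t /\ Q t).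
Proof.
  intros (e & He & H) (e' & He' & H'). exists (Rmin e e').
  pose proof (Rmin_l e e'); pose proof (Rmin_r e e').
  split; [now apply Rmin_glb_lt|]. intros t Ht; split; [apply H|apply H']; lra.
Qed.

Lemma near0_imp (P Q : R -> Prop) : (forall t, 0 < t -> P t -> Q t) -> near0 P -> near0 Q.
Proof.
  intros H (e & He & HP). exists e; split; auto. intros t Ht; apply H; [lra|auto].
Qed.

Lemma near0_lt (e : R) : 0 < e -> near0 (fun t => t < e).
Proof. intros He; exists e; split; auto; intros; lra. Qed.

Lemma near0_forall (P : R -> Prop) : (forall t, 0 < t -> P t) -> near0 P.
Proof. intros H; exists 1; split; [lra|]. intros t Ht; apply H; lra. Qed.

Definition ordO (p : nat) (phi : R -> R) : Prop :=
  exists C, 0 <= C /\ near0 (fun t => Rabs (phi t) <= C * t ^ p).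

(** The coefficient [e] may be 0. Then only a higher order is asserted, which is how the
    cancellation of an error term is expressed. *)
Definition leading (p : nat) (e : R) (phi : R -> R) : Prop :=
  ordO (S p) (fun t => phi t - e * t ^ p).

Lemma ordO_of_bound (p : nat) (phi : R -> R) (C : R) :
  near0 (fun t => Rabs (phi t) <= C * t ^ p) -> ordO p phi.
Proof.
  intros H. exists (Rabs C). split; [apply Rabs_pos|].
  revert H; apply near0_imp. intros t Ht H. eapply Rle_trans; [exact H|].
  apply Rmult_le_compat_r; [apply pow_le; lra|apply Rle_abs].
Qed.

Lemma ordO_ext_near (p : nat) (phi psi : R -> R) :
  near0 (fun t => phi t = psi t) -> ordO p phi -> ordO p psi.
Proof.
  intros E (C & HC & H). exists C; split; auto.
  generalize (near0_and _ _ E H). apply near0_imp.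
  intros t _ [E' H']. now rewrite <- E'.
Qed.

Lemma ordO_ext (p : nat) (phi psi : R -> R) :
  (forall t, phi t = psi t) -> ordO p phi -> ordO p psi.
Proof. intros E. apply ordO_ext_near. now apply near0_forall. Qed.

Lemma ordO_weaken (p q : nat) (phi : R -> R) : (q <= p)%nat -> ordO p phi -> ordO q phi.
Proof.
  intros Hq (C & HC & H). exists C; split; auto.
  generalize (near0_and _ _ (near0_lt 1 Rlt_0_1) H). apply near0_imp.
  intros t Ht [Ht1 H']. eapply Rle_trans; [exact H'|].
  apply Rmult_le_compat_l; auto. apply pow_decr_exp; [lra|auto].
Qed.

Lemma ordO_plus (p : nat) (phi psi : R -> R) :
  ordO p phi -> ordO p psi -> ordO p (fun t => phi t + psi t).
Proof.
  intros (C & HC & H) (D & HD & H'). exists (C + D); split; [lra|].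
  generalize (near0_and _ _ H H'). apply near0_imp. intros t _ [h h'].
  eapply Rle_trans; [apply Rabs_triang|]. lra.
Qed.

Lemma ordO_mult (p q : nat) (phi psi : R -> R) :
  ordO p phi -> ordO q psi -> ordO (p + q) (fun t => phi t * psi t).
Proof.
  intros (C & HC & H) (D & HD & H'). exists (C * D); split; [nra|].
  generalize (near0_and _ _ H H'). apply near0_imp. intros t _ [h h'].
  rewrite Rabs_mult, pow_add.
  replace (C * D * (t ^ p * t ^ q)) with ((C * t ^ p) * (D * t ^ q)) by ring.
  apply Rmult_le_compat; auto using Rabs_pos.
Qed.

Lemma ordO_pow (p : nat) : ordO p (fun t => t ^ p).
Proof.
  apply ordO_of_bound with 1, near0_forall. intros t Ht.
  rewrite Rabs_pos_eq by (apply pow_le; lra). lra.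
Qed.

Lemma ordO_const (c : R) : ordO 0 (fun _ => c).
Proof.
  apply ordO_of_bound with (Rabs c), near0_forall. intros t _. simpl; lra.
Qed.

Lemma ordO_scal (p : nat) (c : R) (phi : R -> R) :
  ordO p phi -> ordO p (fun t => c * phi t).
Proof. intros H. apply (ordO_mult 0 p); [apply ordO_const|exact H]. Qed.

Lemma ordO_minus (p : nat) (phi psi : R -> R) :
  ordO p phi -> ordO p psi -> ordO p (fun t => phi t - psi t).
Proof.
  intros H H'. apply ordO_ext with (fun t => phi t + (-1) * psi t); [intros; ring|].
  apply ordO_plus; auto. now apply ordO_scal.
Qed.

Lemma leading_ext_near (p : nat) (e : R) (phi psi : R -> R) :
  near0 (fun t => phi t = psi t) -> leading p e phi -> leading p e psi.
Proof.
  intros E. apply ordO_ext_near. revert E; apply near0_imp.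
  intros t _ ->; reflexivity.
Qed.

Lemma leading_ext (p : nat) (e : R) (phi psi : R -> R) :
  (forall t, phi t = psi t) -> leading p e phi -> leading p e psi.
Proof. intros E. apply leading_ext_near. now apply near0_forall. Qed.

Lemma leading_coef (p : nat) (e e' : R) (phi : R -> R) :
  e = e' -> leading p e phi -> leading p e' phi.
Proof. now intros ->. Qed.

Lemma leading_ordO (p : nat) (e : R) (phi : R -> R) : leading p e phi -> ordO p phi.
Proof.
  intros H. apply ordO_ext with (fun t => (phi t - e * t ^ p) + e * t ^ p); [intros; ring|].
  apply ordO_plus; [apply ordO_weaken with (S p); [lia|exact H]|].
  apply ordO_scal, ordO_pow.
Qed.

Lemma ordO_leading0 (p : nat) (phi : R -> R) : ordO (S p) phi -> leading p 0 phi.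
Proof. apply ordO_ext. intros; ring. Qed.

Lemma leading_pow (p : nat) : leading p 1 (fun t => t ^ p).
Proof.
  apply ordO_of_bound with 0, near0_forall. intros t _.
  rewrite Rmult_1_l, Rmult_0_l. unfold Rminus. rewrite Rplus_opp_r, Rabs_R0; lra.
Qed.

Lemma leading_plus (p : nat) (e e' : R) (phi psi : R -> R) :
  leading p e phi -> leading p e' psi -> leading p (e + e') (fun t => phi t + psi t).
Proof.
  intros H H'. eapply ordO_ext; [|apply (ordO_plus _ _ _ H H')]. intros; simpl; ring.
Qed.

Lemma leading_minus (p : nat) (e e' : R) (phi psi : R -> R) :
  leading p e phi -> leading p e' psi -> leading p (e - e') (fun t => phi t - psi t).
Proof.
  intros H H'. eapply ordO_ext; [|apply (ordO_minus _ _ _ H H')]. intros; simpl; ring.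
Qed.

Lemma leading_scal (p : nat) (c e : R) (phi : R -> R) :
  leading p e phi -> leading p (c * e) (fun t => c * phi t).
Proof.
  intros H. eapply ordO_ext; [|apply (ordO_scal _ c _ H)]. intros; simpl; ring.
Qed.

Lemma leading_mult (p q : nat) (e e' : R) (phi psi : R -> R) :
  leading p e phi -> leading q e' psi ->
  leading (p + q) (e * e') (fun t => phi t * psi t).
Proof.
  intros H H'. unfold leading.
  apply ordO_ext with (fun t => (phi t - e * t ^ p) * psi t + (e * t ^ p) * (psi t - e' * t ^ q)).
  { intros t; rewrite pow_add; ring. }
  apply ordO_plus.
  - apply (ordO_mult (S p) q); [exact H|now apply leading_ordO with e'].
  - replace (S (p + q)) with (p + S q)%nat by lia.
    apply ordO_mult; [apply ordO_scal, ordO_pow|exact H'].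
Qed.

Lemma leading_power (p i : nat) (e : R) (phi : R -> R) :
  leading p e phi -> leading (i * p) (e ^ i) (fun t => phi t ^ i).
Proof.
  intros H. induction i as [|i IH]; simpl.
  - apply (leading_ext 0 1 (fun t => t ^ 0)); [auto|apply leading_pow].
  - now apply leading_mult.
Qed.

Lemma eq0_of_small (x C : R) : near0 (fun t => Rabs x <= C * t) -> x = 0.
Proof.
  intros (e & He & H). destruct (Req_dec x 0) as [|Hx]; auto. exfalso.
  apply Rabs_pos_lt in Hx.
  assert (HC : 0 < C).
  { specialize (H (e / 2) ltac:(lra)). nra. }
  set (t := Rmin (e / 2) (Rabs x / (2 * C))).
  assert (Ht : 0 < t).
  { apply Rmin_glb_lt; [lra|]. apply Rmult_lt_0_compat; auto. apply Rinv_0_lt_compat; lra. }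
  pose proof (Rmin_l (e / 2) (Rabs x / (2 * C))) as L1.
  pose proof (Rmin_r (e / 2) (Rabs x / (2 * C))) as L2. fold t in L1, L2.
  specialize (H t ltac:(lra)).
  assert (C * t <= C * (Rabs x / (2 * C))) by (apply Rmult_le_compat_l; lra).
  replace (C * (Rabs x / (2 * C))) with (Rabs x / 2) in * by (field; lra). lra.
Qed.

Lemma leading_unique (p : nat) (e : R) (phi : R -> R) :
  leading p e phi -> ordO (S p) phi -> e = 0.
Proof.
  intros H H'. destruct (ordO_minus _ _ _ H' H) as (C & HC & Hn).
  apply eq0_of_small with C. revert Hn. apply near0_imp. intros t Ht Hb.
  replace (phi t - (phi t - e * t ^ p)) with (e * t ^ p) in Hb by ring.
  assert (0 < t ^ p) by now apply pow_lt.
  rewrite Rabs_mult, (Rabs_pos_eq (t ^ p)) in Hb by lra. simpl in Hb.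
  apply Rmult_le_reg_r with (t ^ p); auto. lra.
Qed.

(** The mean value theorem for a power, to leading order: the derivative is taken at the common
    leading term [e t^p]. *)
Lemma leading_pow_diff (p q i : nat) (e d : R) (a b : R -> R) :
  leading p e a -> leading p e b -> leading q d (fun t => b t - a t) ->
  leading (q + i * p) (INR (S i) * e ^ i * d) (fun t => b t ^ S i - a t ^ S i).
Proof.
  intros Ha Hb Hd. induction i as [|i IH].
  - apply leading_coef with d; [simpl; ring|].
    apply leading_ext with (fun t => b t - a t); [intros; simpl; ring|].
    now rewrite Nat.mul_0_l, Nat.add_0_r.
  - apply leading_ext with (fun t => b t * (b t ^ S i - a t ^ S i) + (b t - a t) * a t ^ S i).
    { intros t; simpl; ring. }
    replace (INR (S (S i)) * e ^ S i * d) with (e * (INR (S i) * e ^ i * d) + d * e ^ S i)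
      by (rewrite (S_INR (S i)); simpl; ring).
    apply leading_plus.
    + replace (q + S i * p)%nat with (p + (q + i * p))%nat by lia. now apply leading_mult.
    + apply leading_mult; auto. now apply leading_power.
Qed.

Lemma germ_ordO_zero (phi : R -> R) (p : nat) :
  analytic_germ phi -> ordO (S p) phi -> phi 0 = 0.
Proof.
  intros (r & M & Hr & H) HO.
  apply (ordO_weaken (S p) 1) in HO; [|lia]. destruct HO as (C & HC & HO).
  apply eq0_of_small with (C + M / r).
  generalize (near0_and _ _ (near0_lt r Hr) HO). apply near0_imp.
  intros t Ht [Htr Hb]. rewrite pow_1 in Hb.
  assert (Ha : Rabs t = t) by (apply Rabs_pos_eq; lra).
  pose proof (wiener_diff phi r M t Hr H ltac:(lra)) as Hd. rewrite Ha in Hd.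
  replace (phi 0) with (phi t - (phi t - phi 0)) by ring.
  unfold Rminus at 1. eapply Rle_trans; [apply Rabs_triang|]. rewrite Rabs_Ropp. lra.
Qed.

(** A bound for [t > 0] alone already forces the value at 0 to vanish, so [h] can be divided out [p]
    times, and the resulting identity holds on both sides of 0. *)
Lemma germ_factor (phi : R -> R) (p : nat) :
  analytic_germ phi -> ordO p phi ->
  exists psi r M, 0 < r /\ wiener psi r M /\ forall h, Rabs h <= r -> phi h = h ^ p * psi h.
Proof.
  revert phi. induction p as [|p IH]; intros phi Ha HO.
  - destruct Ha as (r & M & Hr & H). exists phi, r, M. repeat split; auto.
    intros; simpl; ring.
  - assert (H0 := germ_ordO_zero phi p Ha HO).
    destruct Ha as (r & M & Hr & H).
    destruct (wiener_shift phi r M Hr H) as (psi & Hpsi & E).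
    rewrite H0 in E.
    destruct (IH psi) as (chi & s & M' & Hs & Hchi & E').
    + exists r, (M / r); auto.
    + destruct HO as (C & HC & HO). exists C; split; auto.
      generalize (near0_and _ _ (near0_lt r Hr) HO). apply near0_imp.
      intros t Ht [Htr Hb].
      assert (Ht' : Rabs t = t) by (apply Rabs_pos_eq; lra).
      rewrite (E t) in Hb by lra. rewrite Rplus_0_l, Rabs_mult, Ht' in Hb.
      apply Rmult_le_reg_l with t; auto. simpl in Hb. lra.
    + exists chi, (Rmin r s), M'.
      pose proof (Rmin_l r s); pose proof (Rmin_r r s).
      assert (0 < Rmin r s) by now apply Rmin_glb_lt.
      repeat split; auto.
      * apply wiener_shrink with s; auto; lra.
      * intros h Hh. rewrite (E h), (E' h) by lra. simpl; ring.
Qed.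

(** This turns a bound on an analytic error into a definite coefficient, which a correction can then
    cancel. *)
Lemma germ_leading (phi : R -> R) (p : nat) :
  analytic_germ phi -> ordO p phi -> exists e, leading p e phi.
Proof.
  intros Ha HO. destruct (germ_factor phi p Ha HO) as (psi & r & M & Hr & H & E).
  exists (psi 0). apply ordO_of_bound with (M / r).
  generalize (near0_lt r Hr). apply near0_imp. intros t Ht Htr.
  assert (Ht' : Rabs t = t) by (apply Rabs_pos_eq; lra).
  pose proof (wiener_diff psi r M t Hr H ltac:(lra)) as Hd. rewrite Ht' in Hd.
  rewrite (E t) by lra.
  replace (t ^ p * psi t - psi 0 * t ^ p) with (t ^ p * (psi t - psi 0)) by ring.
  assert (0 < t ^ p) by now apply pow_lt.
  rewrite Rabs_mult, (Rabs_pos_eq (t ^ p)) by lra. simpl. nra.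
Qed.

(* The radius of the disc around [t] is proportional to [t]: this is the shape
   that survives composition with a map contracting to [0]. *)
Lemma germ_recenter (phi : R -> R) (p : nat) :
  analytic_germ phi -> ordO p phi ->
  exists C, 0 <= C /\ near0 (fun t => forall s, 0 < s <= 1 ->
    wiener (fun h => phi (t + h)) (s * t) (C * t ^ p)).
Proof.
  intros Ha HO. destruct (germ_factor phi p Ha HO) as (psi & r & M & Hr & H & E).
  pose proof (wiener_ge0 _ _ _ H) as HM.
  (* The radius [s t] is at most [t], so [t + h] has norm at most [2 t]; for [t < r / 2] this stays
     within [r]. *)
  exists (2 ^ p * M). split; [apply Rmult_le_pos; auto; apply pow_le; lra|].
  assert (Hr2 : 0 < r / 2) by lra.
  generalize (near0_lt _ Hr2). apply near0_imp. intros t Ht Htr s Hs.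
  assert (Hst : 0 < s * t <= t) by (split; nra).
  assert (Ht' : Rabs t = t) by (apply Rabs_pos_eq; lra).
  apply wiener_ext with (fun h => (t + h) ^ p * psi (t + h)).
  - intros h Hh. symmetry; apply E. eapply Rle_trans; [apply Rabs_triang|]. lra.
  - apply wiener_le with ((t + s * t) ^ p * M).
    + replace (2 ^ p * M * t ^ p) with ((2 * t) ^ p * M) by (rewrite Rpow_mult_distr; ring).
      apply Rmult_le_compat_r; auto. apply pow_incr; lra.
    + apply wiener_mult; [lra| |].
      * apply (wiener_pow (fun h => t + h)); [lra|].
        apply wiener_plus; [lra| |apply wiener_id; lra].
        rewrite <- Ht' at 2. apply wiener_const; lra.
      * apply wiener_recenter with r; auto; lra.
Qed.

(** * Composition with maps tangent to the identity *)

Lemma leading_id : leading 1 1 (fun t => t).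
Proof.
  apply leading_ext with (fun t => t ^ 1); [intros; ring|apply leading_pow].
Qed.

Lemma leading_1_bounds (a : R -> R) :
  leading 1 1 a -> near0 (fun t => t / 2 <= a t <= 2 * t).
Proof.
  intros (C & HC & H).
  assert (He : 0 < / (2 * (C + 1))) by (apply Rinv_0_lt_compat; lra).
  generalize (near0_and _ _ (near0_lt _ He) H). apply near0_imp.
  intros t Ht [Hte Hb].
  assert (Hx : C * t ^ 2 <= t / 2).
  { assert (t * (2 * (C + 1)) < 1).
    { apply Rmult_lt_reg_r with (/ (2 * (C + 1))); auto.
      rewrite Rmult_assoc, Rinv_r, Rmult_1_l by lra. lra. }
    simpl. nra. }
  apply Rabs_le_between in Hb. rewrite Rmult_1_l, pow_1 in Hb. lra.
Qed.

Lemma near0_leading_1 (P : R -> Prop) (a : R -> R) :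
  leading 1 1 a -> near0 P -> near0 (fun t => P (a t)).
Proof.
  intros Ha (e & He & H). assert (He2 : 0 < e / 2) by lra.
  generalize (near0_and _ _ (near0_lt _ He2) (leading_1_bounds a Ha)).
  apply near0_imp. intros t Ht [H1 H2]. apply H; lra.
Qed.

(** On the disc of radius [a t] around [a t] the norm of [K] is [O((a t)^(p+1))], hence its
    difference quotients from the centre are [O((a t)^p)]. The point [b t] lies in that disc,
    because [b t - a t] is at most [t / 2 <= a t]. *)
Lemma ordO_comp_diff (K a b : R -> R) (p q : nat) :
  analytic_germ K -> ordO (S p) K -> leading 1 1 a -> leading 1 1 b ->
  ordO (S (S q)) (fun t => b t - a t) ->
  ordO (p + S (S q)) (fun t => K (b t) - K (a t)).
Proof.
  intros HK HO Ha Hb (D & HD & Hd).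
  destruct (germ_recenter K (S p) HK HO) as (C & HC & H).
  apply (near0_leading_1 _ a Ha) in H.
  assert (He : 0 < / (2 * (D + 1))) by (apply Rinv_0_lt_compat; lra).
  apply ordO_of_bound with (C * 2 ^ p * D).
  generalize (near0_and _ _ (near0_and _ _ (near0_lt _ He) (near0_lt 1 Rlt_0_1))
    (near0_and _ _ (leading_1_bounds a Ha) (near0_and _ _ H Hd))).
  apply near0_imp. intros t Ht [[Hte Ht1] [Hat [HW Hab]]].
  specialize (HW 1 ltac:(lra)). rewrite Rmult_1_l in HW.
  assert (Hsmall : D * t ^ S (S q) <= t / 2).
  { assert (t * (2 * (D + 1)) < 1).
    { apply Rmult_lt_reg_r with (/ (2 * (D + 1))); auto.
      rewrite Rmult_assoc, Rinv_r, Rmult_1_l by lra. lra. }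
    assert (t ^ S (S q) <= t ^ 2) by (apply pow_decr_exp; [lra|lia]).
    assert (0 < t ^ 2) by (apply pow_lt; lra).
    apply Rle_trans with (D * t ^ 2); [apply Rmult_le_compat_l; lra|]. simpl; nra. }
  assert (Ha0 : 0 < a t) by lra.
  pose proof (wiener_diff _ _ _ (b t - a t) Ha0 HW ltac:(lra)) as Hw.
  simpl in Hw. replace (a t + (b t - a t)) with (b t) in Hw by ring.
  rewrite Rplus_0_r in Hw. eapply Rle_trans; [exact Hw|].
  replace (C * (a t * a t ^ p) / a t) with (C * a t ^ p) by (field; lra).
  rewrite pow_add.
  replace (C * 2 ^ p * D * (t ^ p * t ^ S (S q))) with (C * (2 * t) ^ p * (D * t ^ S (S q)))
    by (rewrite Rpow_mult_distr; ring).
  apply Rmult_le_compat; [|apply Rabs_pos| |exact Hab].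
  - apply Rmult_le_pos; [lra|apply pow_le; lra].
  - apply Rmult_le_compat_l; [lra|]. apply pow_incr; lra.
Qed.

(** The leading power of [K] is differenced exactly; the rest has one more order and contributes
    only to the remainder. *)
Lemma leading_comp_diff (K a b : R -> R) (p q : nat) (e d : R) :
  analytic_germ K -> leading (S p) e K -> leading 1 1 a -> leading 1 1 b ->
  leading (S (S q)) d (fun t => b t - a t) ->
  leading (p + S (S q)) (INR (S p) * e * d) (fun t => K (b t) - K (a t)).
Proof.
  intros HK He Ha Hb Hd.
  apply leading_ext with (fun t => e * (b t ^ S p - a t ^ S p) +
    ((K (b t) - e * b t ^ S p) - (K (a t) - e * a t ^ S p))); [intros; ring|].
  apply leading_coef with (e * (INR (S p) * 1 ^ p * d) + 0); [rewrite pow1; ring|].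
  apply leading_plus.
  - apply leading_scal. replace (p + S (S q))%nat with (S (S q) + p * 1)%nat by lia.
    now apply leading_pow_diff.
  - apply ordO_leading0. replace (S (p + S (S q))) with (S p + S (S q))%nat by lia.
    apply (ordO_comp_diff (fun x => K x - e * x ^ S p)); auto.
    + apply analytic_germ_minus; auto. apply analytic_germ_scal, analytic_germ_pow.
    + now apply leading_ordO with d.
Qed.

(** * Weighted Lipschitz estimates for functions of two variables *)

(** With weight [p] for [x] and [q] for [y], a function of weighted order [w] has partial
    derivatives of orders [w - p] and [w - q]. The radius [r] is independent of [t], so the same
    estimate serves constants, germs at 0 and discs around moving points. *)
Definition weighted_lipschitz (p q w : nat) (f : R -> R -> R) : Prop :=
  forall C, 0 <= C -> exists L tau, 0 <= L /\ 0 < tau <= 1 /\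
    forall t r X X' Y Y' d1 d2, 0 < t <= tau -> 0 < r ->
      wiener X r (C * t ^ p) -> wiener X' r (C * t ^ p) ->
      wiener Y r (C * t ^ q) -> wiener Y' r (C * t ^ q) ->
      wiener (fun h => X h - X' h) r d1 -> wiener (fun h => Y h - Y' h) r d2 ->
      wiener (fun h => f (X h) (Y h) - f (X' h) (Y' h)) r
        (L * (t ^ (w - p) * d1 + t ^ (w - q) * d2)).

Lemma wiener_pow_diff (X X' : R -> R) (r B d : R) (i : nat) : 0 < r ->
  wiener X r B -> wiener X' r B -> wiener (fun h => X h - X' h) r d ->
  wiener (fun h => X h ^ i - X' h ^ i) r (INR i * B ^ pred i * d).
Proof.
  intros Hr HX HX' Hd. induction i as [|i IH].
  - apply wiener_ext with (fun _ => 0); [intros; simpl; ring|].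
    apply wiener_le with (Rabs 0); [rewrite Rabs_R0; simpl; lra|].
    apply wiener_const; lra.
  - apply wiener_ext with (fun h => X h * (X h ^ i - X' h ^ i) + (X h - X' h) * X' h ^ i).
    { intros h _; simpl; ring. }
    apply wiener_le with (B * (INR i * B ^ pred i * d) + d * B ^ i).
    { rewrite S_INR. destruct i as [|i]; simpl pred; [simpl; lra|].
      apply Req_le. simpl; ring. }
    apply wiener_plus; [lra| |].
    + apply wiener_mult; auto; lra.
    + apply wiener_mult; [lra|auto|]. apply wiener_pow; auto; lra.
Qed.

(** The factor produced by differentiating a power is absorbed by halving the radius of
    convergence. *)
Lemma INR_le_pow2 (i : nat) : INR (S i) <= 2 ^ i.
Proof.
  induction i as [|i IH]; [simpl; lra|].
  rewrite S_INR. simpl pow. pose proof (pow_R1_Rle 2 i ltac:(lra)). lra.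
Qed.

(** Write [t = tau th]. Each argument is then at most [r0 / 2] times a power of [th]: the halves
    absorb [INR (S i)], and the powers of [th] have total exponent at least [w - p]. Apart from the
    coefficient weight [r0^(S i) r0^j] the bound is uniform in [i] and [j], as summation
    requires. *)
Lemma monomial_weight_bound (p q w i j : nat) (C r0 tau t : R) :
  0 <= C -> 0 < r0 -> 0 < t <= tau -> tau <= 1 ->
  2 * C * tau ^ p <= r0 -> 2 * C * tau ^ q <= r0 -> (w <= S i * p + j * q)%nat ->
  INR (S i) * (C * t ^ p) ^ i * (C * t ^ q) ^ j
    <= r0 ^ S i * r0 ^ j * (t ^ (w - p) / (r0 * tau ^ w)).
Proof.
  intros HC Hr Ht Htau Hp Hq Hw.
  set (th := t / tau).
  assert (Hit : 0 < / tau) by (apply Rinv_0_lt_compat; lra).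
  assert (Hth : 0 <= th <= 1).
  { unfold th, Rdiv; split; [apply Rmult_le_pos; lra|].
    apply Rmult_le_reg_r with tau; [lra|]. rewrite Rmult_assoc, Rinv_l; lra. }
  assert (Et : t = tau * th) by (unfold th; field; lra).
  assert (Hb : forall n, 2 * C * tau ^ n <= r0 -> C * t ^ n <= r0 / 2 * th ^ n).
  { intros n Hn. rewrite Et, Rpow_mult_distr, <- Rmult_assoc.
    apply Rmult_le_compat_r; [apply pow_le; lra|lra]. }
  apply Rle_trans with (2 ^ i * (r0 / 2 * th ^ p) ^ i * (r0 * th ^ q) ^ j).
  { repeat apply Rmult_le_compat; auto using INR_le_pow2, pos_INR.
    - apply Rmult_le_pos; [apply pos_INR|].
      apply pow_le, Rmult_le_pos; [auto|apply pow_le; lra].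
    - apply pow_le, Rmult_le_pos; [auto|apply pow_le; lra].
    - apply pow_le, Rmult_le_pos; [auto|apply pow_le; lra].
    - apply pow_incr. split; [|now apply Hb].
      apply Rmult_le_pos; [auto|apply pow_le; lra].
    - apply pow_incr. split; [apply Rmult_le_pos; [auto|apply pow_le; lra]|].
      eapply Rle_trans; [now apply Hb|]. apply Rmult_le_compat_r; [apply pow_le; lra|lra]. }
  replace (2 ^ i * (r0 / 2 * th ^ p) ^ i * (r0 * th ^ q) ^ j)
    with (r0 ^ i * r0 ^ j * th ^ (p * i + q * j)).
  2:{ rewrite pow_add, !pow_mult, !Rpow_mult_distr. unfold Rdiv.
      rewrite Rpow_mult_distr, pow_inv. field. apply pow_nonzero; lra. }
  replace (r0 ^ S i * r0 ^ j * (t ^ (w - p) / (r0 * tau ^ w)))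
    with (r0 ^ i * r0 ^ j * (t ^ (w - p) / tau ^ w)).
  2:{ simpl. field. split; [apply pow_nonzero; lra|lra]. }
  apply Rmult_le_compat_l; [apply Rmult_le_pos; apply pow_le; lra|].
  apply Rle_trans with (th ^ (w - p)).
  { apply pow_decr_exp; [auto|]. nia. }
  unfold th. unfold Rdiv. rewrite Rpow_mult_distr, pow_inv.
  apply Rmult_le_compat_l; [apply pow_le; lra|].
  apply Rinv_le_contravar; [apply pow_lt; lra|].
  apply pow_decr_exp; [lra|lia].
Qed.

Lemma wiener_monomial_diff (p q w i j : nat) (C r0 tau t r d1 d2 : R) (X X' Y Y' : R -> R) :
  0 <= C -> 0 < r0 -> 0 < t <= tau -> tau <= 1 ->
  2 * C * tau ^ p <= r0 -> 2 * C * tau ^ q <= r0 -> (w <= i * p + j * q)%nat -> 0 < r ->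
  wiener X r (C * t ^ p) -> wiener X' r (C * t ^ p) ->
  wiener Y r (C * t ^ q) -> wiener Y' r (C * t ^ q) ->
  wiener (fun h => X h - X' h) r d1 -> wiener (fun h => Y h - Y' h) r d2 ->
  wiener (fun h => X h ^ i * Y h ^ j - X' h ^ i * Y' h ^ j) r
    (r0 ^ i * r0 ^ j * ((t ^ (w - p) * d1 + t ^ (w - q) * d2) / (r0 * tau ^ w))).
Proof.
  intros HC Hr0 Ht Htau Hp Hq Hw Hr HX HX' HY HY' H1 H2.
  pose proof (wiener_ge0 _ _ _ H1) as P1. pose proof (wiener_ge0 _ _ _ H2) as P2.
  apply wiener_ext with (fun h => (X h ^ i - X' h ^ i) * Y h ^ j + X' h ^ i * (Y h ^ j - Y' h ^ j)).
  { intros; ring. }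
  eapply wiener_le; [|apply wiener_plus; [lra|
    apply wiener_mult; [lra|eapply wiener_pow_diff; eauto|eapply wiener_pow; eauto; lra]|
    apply wiener_mult; [lra|eapply wiener_pow; eauto; lra|eapply wiener_pow_diff; eauto]]].
  assert (Hd : 0 < / (r0 * tau ^ w)).
  { apply Rinv_0_lt_compat, Rmult_lt_0_compat; [lra|apply pow_lt; lra]. }
  assert (Hpos : forall n, 0 <= r0 ^ i * r0 ^ j * (t ^ n / (r0 * tau ^ w))).
  { intros n. repeat apply Rmult_le_pos; try (apply pow_le; lra). lra. }
  apply Rle_trans with (r0 ^ i * r0 ^ j * (t ^ (w - p) / (r0 * tau ^ w)) * d1 +
    r0 ^ i * r0 ^ j * (t ^ (w - q) / (r0 * tau ^ w)) * d2); [|apply Req_le; unfold Rdiv; ring].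
  apply Rplus_le_compat.
  - replace (INR i * (C * t ^ p) ^ pred i * d1 * (C * t ^ q) ^ j)
      with (INR i * (C * t ^ p) ^ pred i * (C * t ^ q) ^ j * d1) by ring.
    apply Rmult_le_compat_r; auto.
    destruct i as [|i]; [replace (INR 0) with 0 by reflexivity; rewrite !Rmult_0_l; auto|].
    now apply (monomial_weight_bound p q w i j C r0 tau t).
  - replace ((C * t ^ p) ^ i * (INR j * (C * t ^ q) ^ pred j * d2))
      with (INR j * (C * t ^ q) ^ pred j * (C * t ^ p) ^ i * d2) by ring.
    apply Rmult_le_compat_r; auto.
    destruct j as [|j]; [replace (INR 0) with 0 by reflexivity; rewrite !Rmult_0_l; auto|].
    rewrite (Rmult_comm (r0 ^ i)).
    apply (monomial_weight_bound q p w j i C r0 tau t); auto. lia.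
Qed.

Lemma weight_radius (p q : nat) (C r0 : R) : (1 <= p)%nat -> (1 <= q)%nat ->
  0 <= C -> 0 < r0 -> exists tau, 0 < tau <= 1 /\ 2 * C * tau ^ p <= r0 /\ 2 * C * tau ^ q <= r0.
Proof.
  intros Hp Hq HC Hr.
  assert (Hi : 0 < r0 / (2 * (C + 1))) by (apply Rdiv_lt_0_compat; lra).
  exists (Rmin 1 (r0 / (2 * (C + 1)))). set (tau := Rmin _ _).
  assert (L1 : tau <= 1) by apply Rmin_l.
  assert (L2 : tau <= r0 / (2 * (C + 1))) by apply Rmin_r.
  assert (L0 : 0 < tau) by (apply Rmin_glb_lt; lra).
  assert (H : forall n, (1 <= n)%nat -> 2 * C * tau ^ n <= r0).
  { intros n Hn. apply Rle_trans with (2 * (C + 1) * tau).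
    - apply Rle_trans with (2 * C * tau ^ 1).
      + apply Rmult_le_compat_l; [lra|]. apply pow_decr_exp; [lra|auto].
      + rewrite pow_1. apply Rmult_le_compat_r; lra.
    - apply Rmult_le_compat_l with (r := 2 * (C + 1)) in L2; [|lra].
      replace (2 * (C + 1) * (r0 / (2 * (C + 1)))) with r0 in L2 by (field; lra). lra. }
  repeat split; auto.
Qed.

Lemma weighted_lipschitz_monomial (p q w i j : nat) : (1 <= p)%nat -> (1 <= q)%nat ->
  (w <= i * p + j * q)%nat -> weighted_lipschitz p q w (fun x y => x ^ i * y ^ j).
Proof.
  intros Hp Hq Hw C HC.
  destruct (weight_radius p q C 1 Hp Hq HC Rlt_0_1) as (tau & Htau & T1 & T2).
  exists (/ tau ^ w), tau. split; [left; apply Rinv_0_lt_compat, pow_lt; lra|].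
  split; auto. intros t r X X' Y Y' d1 d2 Ht Hr HX HX' HY HY' H1 H2.
  eapply wiener_le; [|apply (wiener_monomial_diff p q w i j C 1 tau t r d1 d2); auto; lra].
  rewrite !pow1. apply Req_le. field. apply pow_nonzero; lra.
Qed.

Lemma weighted_lipschitz_ext (p q w : nat) (f g : R -> R -> R) :
  (forall x y, f x y = g x y) -> weighted_lipschitz p q w f -> weighted_lipschitz p q w g.
Proof.
  intros E H C HC. destruct (H C HC) as (L & tau & HL & Htau & Hf).
  exists L, tau. repeat split; auto; try lra. intros t r X X' Y Y' d1 d2 Ht Hr; intros.
  eapply wiener_ext; [|apply (Hf t r X X' Y Y' d1 d2); auto].
  intros h _; simpl. now rewrite !E.
Qed.

Lemma weighted_lipschitz_plus (p q w : nat) (f g : R -> R -> R) :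
  weighted_lipschitz p q w f -> weighted_lipschitz p q w g ->
  weighted_lipschitz p q w (fun x y => f x y + g x y).
Proof.
  intros H H' C HC. destruct (H C HC) as (L & tau & HL & Htau & Hf).
  destruct (H' C HC) as (L' & tau' & HL' & Htau' & Hg).
  exists (L + L'), (Rmin tau tau'). pose proof (Rmin_l tau tau'). pose proof (Rmin_r tau tau').
  assert (0 < Rmin tau tau') by (apply Rmin_glb_lt; lra).
  split; [lra|]. split; [lra|]. intros t r X X' Y Y' d1 d2 Ht Hr; intros.
  rewrite Rmult_plus_distr_r.
  eapply wiener_ext; [|apply wiener_plus; [lra|apply (Hf t r X X' Y Y' d1 d2); auto; lra|
    apply (Hg t r X X' Y Y' d1 d2); auto; lra]].
  intros h _; simpl. ring.
Qed.

Lemma weighted_lipschitz_scal (p q w : nat) (c : R) (f : R -> R -> R) :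
  weighted_lipschitz p q w f -> weighted_lipschitz p q w (fun x y => c * f x y).
Proof.
  intros H C HC. destruct (H C HC) as (L & tau & HL & Htau & Hf).
  exists (Rabs c * L), tau. split; [apply Rmult_le_pos; auto using Rabs_pos|].
  split; auto. intros t r X X' Y Y' d1 d2 Ht Hr; intros.
  rewrite Rmult_assoc.
  eapply wiener_ext; [|apply wiener_scal, (Hf t r X X' Y Y' d1 d2); auto].
  intros h _; simpl. ring.
Qed.

Lemma weighted_lipschitz_sum (p q w n : nat) (f : nat -> R -> R -> R) :
  (forall i, (i <= n)%nat -> weighted_lipschitz p q w (f i)) ->
  weighted_lipschitz p q w (fun x y => sum_f_R0 (fun i => f i x y) n).
Proof.
  induction n as [|n IH]; intros H; simpl.
  - apply weighted_lipschitz_ext with (f 0%nat); auto.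
  - apply weighted_lipschitz_plus; auto.
Qed.

Lemma weighted_lipschitz_weaken (p q w w' : nat) (f : R -> R -> R) : (w' <= w)%nat ->
  weighted_lipschitz p q w f -> weighted_lipschitz p q w' f.
Proof.
  intros Hw H C HC. destruct (H C HC) as (L & tau & HL & Htau & Hf).
  exists L, tau. repeat split; auto; try lra.
  intros t r X X' Y Y' d1 d2 Ht Hr HX HX' HY HY' H1 H2.
  eapply wiener_le; [|apply (Hf t r X X' Y Y' d1 d2); auto].
  apply Rmult_le_compat_l; auto.
  apply Rplus_le_compat; (apply Rmult_le_compat_r; [eapply wiener_ge0; eauto|]);
    (apply pow_decr_exp; [lra|lia]).
Qed.

Definition pseries2_near (a : nat -> nat -> R) (r0 : R) (f : R -> R -> R) : Prop :=
  forall x y, Rabs x <= r0 -> Rabs y <= r0 -> is_pseries2 a x y (f x y).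

(** Monomials of weight below [w] are absent, and each other one obeys the estimate with constant
    [|a i j| r0^i r0^j]; these constants are summable. *)
Lemma weighted_lipschitz_pseries2 (p q w : nat) (a : nat -> nat -> R) (r0 : R) (f : R -> R -> R) :
  (1 <= p)%nat -> (1 <= q)%nat -> 0 < r0 -> pseries2_near a r0 f ->
  (forall i j, (i * p + j * q < w)%nat -> a i j = 0) ->
  weighted_lipschitz p q w f.
Proof.
  intros Hp Hq Hr0 Hf Ha C HC.
  destruct (weight_radius p q C r0 Hp Hq HC Hr0) as (tau & Htau & T1 & T2).
  assert (Habs : Rabs r0 <= r0) by (rewrite Rabs_pos_eq; lra).
  (* At the corner [(r0, r0)] the double series is the sum of all the constants. *)
  destruct (Hf r0 r0 Habs Habs) as (S1 & S2 & _).
  set (M := fun i => Series (fun j => Rabs (a i j * r0 ^ i * r0 ^ j))) in *.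
  assert (HM : forall i, 0 <= M i).
  { intros i. eapply Rle_trans; [|apply (term_le_Series _ 0%nat)];
      [apply Rabs_pos|intros; apply Rabs_pos|auto]. }
  assert (Htw : 0 < r0 * tau ^ w) by (apply Rmult_lt_0_compat; [auto|apply pow_lt; lra]).
  assert (HSM : 0 <= Series M).
  { eapply Rle_trans; [apply (HM 0%nat)|]. now apply term_le_Series. }
  exists (Series M / (r0 * tau ^ w)), tau.
  split; [apply Rmult_le_pos; auto; left; now apply Rinv_0_lt_compat|].
  split; auto. intros t r X X' Y Y' d1 d2 Ht Hr HX HX' HY HY' H1 H2.
  pose proof (wiener_ge0 _ _ _ H1) as P1. pose proof (wiener_ge0 _ _ _ H2) as P2.
  set (G := (t ^ (w - p) * d1 + t ^ (w - q) * d2) / (r0 * tau ^ w)).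
  assert (HG : 0 <= G).
  { apply Rmult_le_pos; [|left; now apply Rinv_0_lt_compat].
    apply Rplus_le_le_0_compat; apply Rmult_le_pos; auto; apply pow_le; lra. }
  replace (Series M / (r0 * tau ^ w) * (t ^ (w - p) * d1 + t ^ (w - q) * d2))
    with (Series M * G) by (unfold G; field; split; [apply pow_nonzero|]; lra).
  assert (Hsmall : forall n Z h, 2 * C * tau ^ n <= r0 -> wiener Z r (C * t ^ n) -> Rabs h <= r ->
    Rabs (Z h) <= r0).
  { intros n Z h Hn HZ Hh. eapply Rle_trans; [apply (wiener_value Z r); eauto|].
    assert (C * t ^ n <= C * tau ^ n).
    { apply Rmult_le_compat_l; auto. apply pow_incr; lra. }
    assert (0 <= C * t ^ n) by (apply Rmult_le_pos; auto; apply pow_le; lra). lra. }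
  apply (wiener_is_series (fun i h => Series (fun j => a i j * (X h ^ i * Y h ^ j - X' h ^ i * Y' h ^ j)))
    _ r (fun i => M i * G)); auto.
  - intros i.
    apply (wiener_Series (fun j h => a i j * (X h ^ i * Y h ^ j - X' h ^ i * Y' h ^ j)) r
      (fun j => Rabs (a i j * r0 ^ i * r0 ^ j) * G)); auto.
    + intros j. destruct (Nat.lt_ge_cases (i * p + j * q) w) as [Hlt|Hge].
      * rewrite (Ha i j Hlt). apply wiener_ext with (fun _ => 0); [intros; ring|].
        eapply wiener_le; [|apply wiener_const; lra].
        rewrite Rabs_R0, !Rmult_0_l, Rabs_R0; lra.
      * eapply wiener_le; [|apply wiener_scal, (wiener_monomial_diff p q w i j C r0 tau t r d1 d2);
          auto; lra].
        fold G. rewrite !Rabs_mult, (Rabs_pos_eq (r0 ^ i)), (Rabs_pos_eq (r0 ^ j))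
          by (apply pow_le; lra). apply Req_le; ring.
    + intros n. rewrite <- scal_sum, Rmult_comm.
      apply Rmult_le_compat_r; auto. apply sum_le_Series; auto using Rabs_pos.
  - intros n. rewrite <- scal_sum, Rmult_comm.
    apply Rmult_le_compat_r; auto. apply sum_le_Series; auto.
  - intros h Hh.
    destruct (Hf (X h) (Y h)) as (E1 & _ & E2);
      [now apply (Hsmall p)|now apply (Hsmall q)|].
    destruct (Hf (X' h) (Y' h)) as (E1' & _ & E2');
      [now apply (Hsmall p)|now apply (Hsmall q)|].
    eapply is_series_ext; [|apply (is_series_minus (V := R_NormedModule) _ _ _ _ E2 E2')].
    intros i. simpl. unfold plus, opp; simpl.
    rewrite <- Rminus_def, <- Series_minus by (apply ex_series_Rabs; auto).
    apply Series_ext. intros j; ring.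
Qed.

(** Comparison with the zero curve at the fixed parameter [t = tau]: the estimate then contains the
    analyticity of [f (X t) (Y t)], once the radius makes both norms small. *)
Lemma weighted_lipschitz_germ (p q w : nat) (f : R -> R -> R) (X Y : R -> R) :
  weighted_lipschitz p q w f -> f 0 0 = 0 ->
  analytic_germ X -> analytic_germ Y -> X 0 = 0 -> Y 0 = 0 ->
  analytic_germ (fun t => f (X t) (Y t)).
Proof.
  intros Hf Hf0 (r & M & Hr & HX) (r' & M' & Hr' & HY) HX0 HY0.
  destruct (Hf 1 Rle_0_1) as (L & tau & HL & Htau & H).
  assert (Hsmall : forall Z s B n, 0 < s -> wiener Z s B -> Z 0 = 0 ->
     exists s', 0 < s' /\ forall s'', 0 < s'' <= s' -> wiener Z s'' (1 * tau ^ n)).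
  { intros Z s B n Hs HZ HZ0. pose proof (wiener_ge0 _ _ _ HZ) as HB.
    assert (Htn : 0 < tau ^ n) by (apply pow_lt; lra).
    set (s' := Rmin s (tau ^ n * s / (B + 1))).
    pose proof (Rmin_l s (tau ^ n * s / (B + 1))) as L1.
    pose proof (Rmin_r s (tau ^ n * s / (B + 1))) as L2. fold s' in L1, L2.
    exists s'. split; [apply Rmin_glb_lt; auto; apply Rdiv_lt_0_compat; nra|].
    intros s'' Hs''. apply wiener_ext with (fun h => Z h - Z 0); [intros; rewrite HZ0; ring|].
    eapply wiener_le; [|apply (wiener_increment Z s s'' B); auto; lra].
    apply Rle_trans with (tau ^ n * s / (B + 1) * (B / s)).
    - apply Rmult_le_compat_r; [apply Rmult_le_pos; auto; left; now apply Rinv_0_lt_compat|lra].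
    - replace (tau ^ n * s / (B + 1) * (B / s)) with (tau ^ n * (B / (B + 1))) by (field; lra).
      rewrite Rmult_1_l. rewrite <- (Rmult_1_r (tau ^ n)) at 2.
      apply Rmult_le_compat_l; [lra|]. apply Rmult_le_reg_r with (B + 1); [lra|].
      unfold Rdiv; rewrite Rmult_assoc, Rinv_l; lra. }
  destruct (Hsmall X r M p Hr HX HX0) as (s1 & Hs1 & W1).
  destruct (Hsmall Y r' M' q Hr' HY HY0) as (s2 & Hs2 & W2).
  set (s := Rmin s1 s2). assert (Hs : 0 < s) by now apply Rmin_glb_lt.
  specialize (W1 s (conj Hs (Rmin_l _ _))). specialize (W2 s (conj Hs (Rmin_r _ _))).
  assert (Z : forall n, wiener (fun _ => 0) s (1 * tau ^ n)).
  { intros n. eapply wiener_le; [|apply wiener_const; lra].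
    rewrite Rabs_R0, Rmult_1_l; apply pow_le; lra. }
  eexists s, _. split; auto.
  eapply wiener_ext; [|apply (H tau s X (fun _ => 0) Y (fun _ => 0) (1 * tau ^ p) (1 * tau ^ q)); auto; try lra].
  - intros h _; simpl. rewrite Hf0; ring.
  - eapply wiener_ext; [|exact W1]. intros; simpl; ring.
  - eapply wiener_ext; [|exact W2]. intros; simpl; ring.
Qed.

(** Constant functions have their absolute value as norm, so the estimate on discs specialises to
    numbers. *)
Lemma weighted_lipschitz_pointwise (p q w : nat) (f : R -> R -> R) (C : R) :
  weighted_lipschitz p q w f -> 0 <= C ->
  exists L tau, 0 <= L /\ 0 < tau <= 1 /\ forall t x x' y y', 0 < t <= tau ->
    Rabs x <= C * t ^ p -> Rabs x' <= C * t ^ p -> Rabs y <= C * t ^ q -> Rabs y' <= C * t ^ q ->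
    Rabs (f x y - f x' y') <= L * (t ^ (w - p) * Rabs (x - x') + t ^ (w - q) * Rabs (y - y')).
Proof.
  intros Hf HC. destruct (Hf C HC) as (L & tau & HL & Htau & H).
  exists L, tau. split; [auto|]. split; [auto|].
  intros t x x' y y' Ht Hx Hx' Hy Hy'.
  apply (wiener_value (fun _ => f x y - f x' y') 1 _ 0); [|rewrite Rabs_R0; lra].
  assert (Hc : forall z B, Rabs z <= B -> wiener (fun _ => z) 1 B).
  { intros z B Hz. apply wiener_le with (Rabs z); [exact Hz|apply wiener_const; lra]. }
  apply (H t 1 (fun _ => x) (fun _ => x') (fun _ => y) (fun _ => y')); auto; try lra.
  - apply (wiener_const (x - x')); lra.
  - apply (wiener_const (y - y')); lra.
Qed.

Lemma weighted_lipschitz_ordO (p q w n : nat) (f : R -> R -> R) (X X' Y Y' : R -> R) :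
  weighted_lipschitz p q w f ->
  ordO p X -> ordO p X' -> ordO q Y -> ordO q Y' ->
  ordO (n - (w - p)) (fun t => X t - X' t) -> ordO (n - (w - q)) (fun t => Y t - Y' t) ->
  ordO n (fun t => f (X t) (Y t) - f (X' t) (Y' t)).
Proof.
  intros Hf (C1 & P1 & O1) (C2 & P2 & O2) (C3 & P3 & O3) (C4 & P4 & O4) (D1 & Q1 & U1) (D2 & Q2 & U2).
  destruct (weighted_lipschitz_pointwise p q w f (C1 + C2 + C3 + C4) Hf ltac:(lra))
    as (L & tau & HL & Htau & H).
  apply ordO_of_bound with (L * (D1 + D2)).
  generalize (near0_and _ _ (near0_lt tau (proj1 Htau)) (near0_and _ _ (near0_and _ _ O1 O2)
    (near0_and _ _ (near0_and _ _ O3 O4) (near0_and _ _ U1 U2)))).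
  apply near0_imp. intros t Ht (Htt & (o1 & o2) & (o3 & o4) & u1 & u2).
  assert (Hpw : forall n, 0 < t ^ n) by (intros; now apply pow_lt).
  assert (Hle : forall c m, c <= C1 + C2 + C3 + C4 -> c * t ^ m <= (C1 + C2 + C3 + C4) * t ^ m).
  { intros c m Hc. apply Rmult_le_compat_r; auto. left; auto. }
  eapply Rle_trans; [apply (H t); try lra|].
  - eapply Rle_trans; [exact o1|apply Hle; lra].
  - eapply Rle_trans; [exact o2|apply Hle; lra].
  - eapply Rle_trans; [exact o3|apply Hle; lra].
  - eapply Rle_trans; [exact o4|apply Hle; lra].
  - rewrite Rmult_assoc. apply Rmult_le_compat_l; auto.
    rewrite Rmult_plus_distr_r.
    assert (Hpow : forall m, t ^ m * t ^ (n - m) <= t ^ n).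
    { intros m. rewrite <- pow_add. apply pow_decr_exp; [lra|lia]. }
    apply Rplus_le_compat.
    + apply Rle_trans with (t ^ (w - p) * (D1 * t ^ (n - (w - p)))).
      * apply Rmult_le_compat_l; auto. left; auto.
      * pose proof (Hpow (w - p)%nat). nra.
    + apply Rle_trans with (t ^ (w - q) * (D2 * t ^ (n - (w - q)))).
      * apply Rmult_le_compat_l; auto. left; auto.
      * pose proof (Hpow (w - q)%nat). nra.
Qed.

(** * Vanishing of low order coefficients *)

Definition drop_coef (a : nat -> nat -> R) (i0 j0 i j : nat) : R :=
  if (Nat.eqb i i0 && Nat.eqb j j0)%bool then 0 else a i j.

Lemma is_pseries2_drop (a : nat -> nat -> R) (i0 j0 : nat) (x y s : R) :
  is_pseries2 a x y s -> is_pseries2 (drop_coef a i0 j0) x y (s - a i0 j0 * (x ^ i0 * y ^ j0)).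
Proof.
  intros (H1 & H2 & H3).
  assert (Hle : forall i j, Rabs (drop_coef a i0 j0 i j * x ^ i * y ^ j) <= Rabs (a i j * x ^ i * y ^ j)).
  { intros i j. unfold drop_coef. destruct (_ && _)%bool; [|lra].
    rewrite !Rmult_0_l, Rabs_R0. apply Rabs_pos. }
  assert (D1 : forall i, ex_series (fun j => Rabs (drop_coef a i0 j0 i j * x ^ i * y ^ j))).
  { intros i. eapply ex_series_Rabs_le; [|apply (H1 i)]. intros j; apply Hle. }
  split; [exact D1|split].
  - apply ex_series_ext with (fun i => Rabs (Series (fun j => Rabs (drop_coef a i0 j0 i j * x ^ i * y ^ j)))).
    { intros i. apply Rabs_pos_eq.
      eapply Rle_trans; [|apply (term_le_Series _ 0%nat)]; [apply Rabs_pos|intros; apply Rabs_pos|auto]. }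
    eapply ex_series_Rabs_le; [|apply H2]. intros i.
    apply Rabs_Series_le; auto. intros j; rewrite Rabs_Rabsolu; apply Hle.
  - eapply is_series_ext; [|apply (is_series_minus (V := R_NormedModule) _ _ _ _ H3
      (is_series_unit i0 (a i0 j0 * (x ^ i0 * y ^ j0))))].
    intros i. unfold plus, opp; simpl.
    rewrite <- (is_series_unique _ _ (is_series_unit j0 (if Nat.eqb i i0 then a i0 j0 * (x ^ i0 * y ^ j0) else 0))).
    rewrite <- Rminus_def, <- Series_minus.
    + apply Series_ext. intros j. unfold drop_coef.
      destruct (Nat.eqb_spec i i0) as [->|], (Nat.eqb_spec j j0) as [->|]; simpl; ring.
    + apply ex_series_Rabs, H1.
    + eexists; apply is_series_unit.
Qed.

Lemma is_pseries2_origin (a : nat -> nat -> R) (s : R) : is_pseries2 a 0 0 s -> s = a 0%nat 0%nat.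
Proof.
  intros (_ & _ & H). rewrite <- (is_series_unique _ _ H). apply is_series_unique.
  eapply is_series_ext; [|apply (is_series_unit 0 (a 0%nat 0%nat))].
  intros i. symmetry. apply is_series_unique.
  eapply is_series_ext; [|apply (is_series_unit 0 (if Nat.eqb i 0 then a 0%nat 0%nat else 0))].
  intros [|j]; destruct i as [|i]; simpl; ring.
Qed.

(* Along the curve [(t ^ (r + 1), t ^ (r + 2))] monomials of degree at most [r]
   have pairwise distinct orders, so they can be eliminated one at a time. *)
Lemma pseries2_littleo_coef (a : nat -> nat -> R) (r0 : R) (g : R -> R -> R) (r : nat) :
  0 < r0 -> pseries2_near a r0 g ->
  (forall eps, 0 < eps -> near0 (fun t =>
     Rabs (g (t ^ (r + 1)) (t ^ (r + 2))) <= eps * t ^ ((r + 1) * r))) ->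
  forall i j, (i * (r + 1) + j * (r + 2) <= (r + 1) * r)%nat -> a i j = 0.
Proof.
  intros Hr0 Hg Hsmall.
  enough (H : forall e i j, (i * (r + 1) + j * (r + 2) = e)%nat -> (e <= (r + 1) * r)%nat -> a i j = 0).
  { intros i j Hij. now apply (H _ i j eq_refl). }
  induction e as [e IH] using lt_wf_ind. intros i0 j0 He Hle.
  assert (Hj : forall i j, (i * (r + 1) + j * (r + 2) <= (r + 1) * r)%nat -> (j <= r)%nat) by nia.
  assert (Hdrop : forall i j, (i * (r + 1) + j * (r + 2) < S e)%nat -> drop_coef a i0 j0 i j = 0).
  { intros i j Hij. unfold drop_coef.
    destruct (Nat.eq_dec (i * (r + 1) + j * (r + 2)) e) as [Heq|Hne].
    (* The exponent equals [(i + j)(r + 1) + j] with [j <= r], so division by [r + 1] recovers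
       [i + j] and [j]. *)
    - assert (i0 + j0 = i + j)%nat.
      { pose proof (Hj i j ltac:(lia)). pose proof (Hj i0 j0 ltac:(lia)).
        destruct (lt_eq_lt_dec (i0 + j0) (i + j)) as [[Hlt|]|Hlt]; auto; nia. }
      assert (j = j0) by nia. assert (i = i0) by lia. subst.
      now rewrite !Nat.eqb_refl.
    - destruct (_ && _)%bool; auto.
      apply (IH (i * (r + 1) + j * (r + 2))%nat); lia. }
  set (g' := fun x y => g x y - a i0 j0 * (x ^ i0 * y ^ j0)).
  assert (Hg' : pseries2_near (drop_coef a i0 j0) r0 g').
  { intros x y Hx Hy. now apply is_pseries2_drop, Hg. }
  assert (H0 : g' 0 0 = 0).
  { rewrite <- (Hdrop 0%nat 0%nat) at 3 by lia. apply is_pseries2_origin, Hg'; rewrite Rabs_R0; lra. }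
  assert (HO : ordO (S e) (fun t => g' (t ^ (r + 1)) (t ^ (r + 2)) - g' 0 0)).
  { apply (weighted_lipschitz_ordO (r + 1) (r + 2) (S e) (S e) g'
      (fun t => t ^ (r + 1)) (fun _ => 0) (fun t => t ^ (r + 2)) (fun _ => 0)).
    - apply (weighted_lipschitz_pseries2 _ _ _ (drop_coef a i0 j0) r0); auto; lia.
    - apply ordO_pow.
    - apply ordO_of_bound with 0, near0_forall. intros; rewrite Rabs_R0; lra.
    - apply ordO_pow.
    - apply ordO_of_bound with 0, near0_forall. intros; rewrite Rabs_R0; lra.
    - apply ordO_ext with (fun t => t ^ (r + 1)); [intros; ring|].
      apply ordO_weaken with (r + 1)%nat; [lia|apply ordO_pow].
    - apply ordO_ext with (fun t => t ^ (r + 2)); [intros; ring|].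
      apply ordO_weaken with (r + 2)%nat; [lia|apply ordO_pow]. }
  (* On the curve, [g] is at most [(eps / 4) t^e] and [g'] is [O(t^(e+1))], so their difference
     [a i0 j0 * t^e] has an arbitrarily small coefficient. *)
  destruct HO as (C & HC & HO). apply cond_eq. intros eps Heps.
  assert (He2 : 0 < eps / 4) by lra.
  assert (Hc : 0 < eps / (4 * (C + 1))) by (apply Rdiv_lt_0_compat; lra).
  destruct (near0_and _ _ (near0_and _ _ (near0_lt 1 Rlt_0_1) (near0_lt _ Hc))
    (near0_and _ _ HO (Hsmall _ He2))) as (d & Hd & H).
  destruct (H (d / 2) ltac:(lra)) as ((h1 & h2) & h3 & h4). set (t := d / 2) in *.
  assert (Ht : 0 < t) by (unfold t; lra).
  assert (Hte : 0 < t ^ e) by now apply pow_lt.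
  unfold g' in h3 at 1. rewrite H0 in h3.
  rewrite <- !pow_mult, <- pow_add in h3.
  replace ((r + 1) * i0 + (r + 2) * j0)%nat with e in h3 by lia.
  assert (h5 : t ^ ((r + 1) * r) <= t ^ e) by (apply pow_decr_exp; [lra|lia]).
  assert (h6 : C * t <= eps / 4).
  { apply Rmult_lt_compat_l with (r := C + 1) in h2; [|lra].
    replace ((C + 1) * (eps / (4 * (C + 1)))) with (eps / 4) in h2 by (field; lra). nra. }
  assert (h7 : Rabs (a i0 j0) * t ^ e <= (eps / 4 + C * t) * t ^ e).
  { replace (Rabs (a i0 j0) * t ^ e) with (Rabs (a i0 j0 * t ^ e))
      by (rewrite Rabs_mult, (Rabs_pos_eq (t ^ e)); lra).
    replace (a i0 j0 * t ^ e) with (g (t ^ (r + 1)) (t ^ (r + 2)) -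
      (g (t ^ (r + 1)) (t ^ (r + 2)) - a i0 j0 * t ^ e - 0)) by ring.
    unfold Rminus at 1. eapply Rle_trans; [apply Rabs_triang|]. rewrite Rabs_Ropp.
    simpl in h3. nra. }
  apply Rmult_le_reg_r in h7; auto. rewrite Rminus_0_r. lra.
Qed.

(** * The reduced form as a weighted perturbation *)

(* Cases 1, 2 and 3 are treated together: the parametrisations have orders [m]
   and [m + q] with [q = N - 1], and [f] has weighted order [m + 2 q]. *)
Definition weighted_form (m q i0 i1 : nat) (A B : R) (f : R -> R -> R) : Prop :=
  0 <= A /\ (m * i0 = m + 2 * q)%nat /\ (B = 0 \/ (m * i1 = q)%nat) /\ f 0 0 = 0 /\
  weighted_lipschitz m (m + q) (m + 2 * q + 1)
    (fun x y => f x y - (A * x ^ i0 + B * (x ^ i1 * y))).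

Lemma weighted_form_lipschitz (m q i0 i1 : nat) (A B : R) (f : R -> R -> R) : (1 <= m)%nat ->
  weighted_form m q i0 i1 A B f -> weighted_lipschitz m (m + q) (m + 2 * q) f.
Proof.
  intros Hm (_ & Hi0 & Hi1 & _ & Hf).
  apply weighted_lipschitz_ext with (fun x y =>
    (f x y - (A * x ^ i0 + B * (x ^ i1 * y))) + (A * (x ^ i0 * y ^ 0) + B * (x ^ i1 * y ^ 1))).
  { intros; simpl; ring. }
  apply weighted_lipschitz_plus; [|apply weighted_lipschitz_plus].
  - revert Hf. apply weighted_lipschitz_weaken. lia.
  - apply weighted_lipschitz_scal, weighted_lipschitz_monomial; lia.
  - destruct Hi1 as [->|Hi1].
    (* Nothing is known of [i1] here, so the zero term is rewritten with a monomial of sufficient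
       weight. *)
    + apply weighted_lipschitz_ext with (fun x y => 0 * (x ^ (m + 2 * q) * y ^ 0)).
      { intros; ring. }
      apply weighted_lipschitz_scal, weighted_lipschitz_monomial; nia.
    + apply weighted_lipschitz_scal, weighted_lipschitz_monomial; nia.
Qed.

Lemma sum_split_first (k k' n : nat) (a : nat -> R) (x : R) :
  x ^ k * sum_f_R0 (fun i => a (k' + i)%nat * x ^ i) n =
  a k' * x ^ k + sum_f_R0 (fun i => (if Nat.eqb i 0 then 0 else a (k' + i)%nat) * x ^ (k + i)) n.
Proof.
  induction n as [|n IH].
  - simpl. rewrite Nat.add_0_r. ring.
  - rewrite !tech5, Rmult_plus_distr_l, IH. simpl Nat.eqb. cbv iota.
    rewrite (pow_add x k (S n)). ring.
Qed.

(** Once the first monomial is removed, every term has at least one more factor [x]. The power [k]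
    and the coefficient index [k'] are separate because [q_poly] pairs [x^(l-1)] with [b l]. *)
Lemma weighted_lipschitz_tail (p q w k k' n j : nat) (a : nat -> R) :
  (1 <= p)%nat -> (1 <= q)%nat -> (w <= (k + 1) * p + j * q)%nat ->
  weighted_lipschitz p q w (fun x y =>
    y ^ j * (x ^ k * sum_f_R0 (fun i => a (k' + i)%nat * x ^ i) n) - a k' * (x ^ k * y ^ j)).
Proof.
  intros Hp Hq Hw.
  (* The removed term stays in the sum with coefficient 0; the power [k + 1] gives it enough
     weight. *)
  apply weighted_lipschitz_ext with (fun x y =>
    sum_f_R0 (fun i => (if Nat.eqb i 0 then 0 else a (k' + i)%nat) *
      (x ^ (if Nat.eqb i 0 then k + 1 else k + i) * y ^ j)) n).
  - intros x y. rewrite sum_split_first, Rmult_plus_distr_l, scal_sum.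
    rewrite (sum_eq _ (fun i => (if Nat.eqb i 0 then 0 else a (k' + i)%nat) * x ^ (k + i) * y ^ j)).
    + ring.
    + intros [|i] _; simpl Nat.eqb; cbv iota; ring.
  - apply weighted_lipschitz_sum. intros i _.
    apply weighted_lipschitz_scal, weighted_lipschitz_monomial; auto.
    destruct i as [|i]; simpl Nat.eqb; cbv iota; nia.
Qed.

Lemma weighted_lipschitz_factor_y2 (p q w : nat) (u : R -> R -> R) :
  (1 <= p)%nat -> (1 <= q)%nat -> (w <= 2 * q)%nat -> poly_with_factor_y2 u ->
  weighted_lipschitz p q w u.
Proof.
  intros Hp Hq Hw (d & c & Hu).
  eapply weighted_lipschitz_ext; [intros x y; symmetry; apply Hu|].
  apply weighted_lipschitz_sum; intros i _. apply weighted_lipschitz_sum; intros j _.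
  apply weighted_lipschitz_ext with (fun x y => c i j * (x ^ i * y ^ (j + 2))); [intros; ring|].
  apply weighted_lipschitz_scal, weighted_lipschitz_monomial; auto. nia.
Qed.

Lemma max_norm_curve (r : nat) (t : R) : 0 < t <= 1 ->
  max_norm (t ^ (r + 1), t ^ (r + 2)) ^ r = t ^ ((r + 1) * r).
Proof.
  intros Ht. unfold max_norm; simpl fst; simpl snd.
  rewrite !Rabs_pos_eq by (apply pow_le; lra).
  rewrite Rmax_left by (apply pow_decr_exp; [lra|lia]).
  now rewrite pow_mult.
Qed.

(** Smallness beyond degree [r] kills the coefficients whose order on the test curve is at most
    [(r + 1) r]; the last hypothesis says that these include all monomials of weight below [w]. *)
Lemma weighted_lipschitz_remainder (p q w r : nat) (g : R -> R -> R) :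
  (1 <= p)%nat -> (1 <= q)%nat ->
  analytic2_at (fun z => g (fst z) (snd z)) (0, 0) ->
  is_domin (locally (0, 0)) (fun z => max_norm z ^ r) (fun z => g (fst z) (snd z)) ->
  (forall i j, (i * p + j * q < w)%nat -> (i * (r + 1) + j * (r + 2) <= (r + 1) * r)%nat) ->
  weighted_lipschitz p q w g.
Proof.
  intros Hp Hq (a & eps & Ha) Hdom Hw.
  pose proof (cond_pos eps) as Heps.
  assert (Hg : pseries2_near a (eps / 2) g).
  { intros x y Hx Hy. specialize (Ha (x, y)). simpl in Ha.
    rewrite !Rminus_0_r in Ha. apply Ha. split; simpl.
    - change (Rabs (x - 0) < eps). rewrite Rminus_0_r; lra.
    - change (Rabs (y - 0) < eps). rewrite Rminus_0_r; lra. }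
  apply weighted_lipschitz_pseries2 with a (eps / 2); auto; [lra|].
  intros i j Hij. apply (pseries2_littleo_coef a (eps / 2) g r); auto; [lra|].
  intros e He. destruct (Hdom (mkposreal e He)) as [d Hd]. simpl in Hd.
  pose proof (cond_pos d) as Hdp.
  generalize (near0_and _ _ (near0_lt 1 Rlt_0_1) (near0_lt d Hdp)). apply near0_imp.
  intros t Ht [Ht1 Htd].
  assert (Hball : forall n, (1 <= n)%nat -> Rabs (t ^ n - 0) < d).
  { intros n Hn. rewrite Rminus_0_r, Rabs_pos_eq by (apply pow_le; lra).
    apply Rle_lt_trans with (t ^ 1); [apply pow_decr_exp; [lra|auto]|]. rewrite pow_1; auto. }
  specialize (Hd (t ^ (r + 1), t ^ (r + 2))). simpl fst in Hd; simpl snd in Hd.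
  assert (Hb : ball (0, 0) d (t ^ (r + 1), t ^ (r + 2))).
  { split; simpl; [apply (Hball (r + 1)%nat)|apply (Hball (r + 2)%nat)]; lia. }
  specialize (Hd Hb). rewrite max_norm_curve in Hd by lra.
  change (Rabs (g (t ^ (r + 1)) (t ^ (r + 2))) <= e * Rabs (t ^ ((r + 1) * r))) in Hd.
  rewrite (Rabs_pos_eq (t ^ _)) in Hd by (apply pow_le; lra). exact Hd.
Qed.

Definition case_m (s : reduced_case) : nat := match s with Case1 => 2 | _ => 1 end.

Lemma reduced_weighted_form (U : R * R -> Prop) (F : R * R -> R * R) (c : R) (k l r : nat)
    (a b : nat -> R) (s : reduced_case) :
  U (0, 0) -> reduced_form U F c k l r a b -> in_case s k l a b -> sign_condition s k l a b ->
  exists f i0 i1 A B,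
    (forall x y, U (x, y) -> F (x, y) = (x + c * y, y + f x y)) /\
    weighted_form (case_m s) (case_N s k l - 1) i0 i1 A B f.
Proof.
  intros HU (Hc & Hk & Hl & u & g & Hu & HF & Hbig & _ & Hg & Hgo) Hs Hsg.
  set (f := fun x y => p_poly k r a x + y * q_poly l r b x + u x y + g x y).
  assert (HFf : forall x y, U (x, y) -> F (x, y) = (x + c * y, y + f x y)).
  { intros x y Hxy. rewrite (HF x y Hxy). unfold f. f_equal. ring. }
  assert (Hf0 : f 0 0 = 0).
  (* The quadratic bound also holds at the origin itself, where it reads [f 0 0 = 0]. *)
  { destruct Hbig as [D HD]. apply locally_singleton in HD. simpl in HD.
    rewrite (HFf 0 0 HU) in HD. simpl in HD.
    unfold max_norm in HD; simpl in HD.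
    rewrite Rabs_R0, Rmax_left, Rmult_0_l, Rabs_R0, Rmult_0_r in HD by lra.
    apply Rabs_eq_0, Rle_antisym; [|apply Rabs_pos].
    replace (f 0 0) with (0 + f 0 0 - 0) by ring. exact HD. }
  exists f.
  (* Each of the two candidate leading monomials is either subtracted with its true coefficient, or
     has weight at least [w] and may stay in the remainder. The last premise concerns [g]. *)
  assert (Hsum : forall (m q w : nat) (al be : R), (1 <= m)%nat -> (1 <= q)%nat ->
    (al = a k \/ (al = 0 /\ (w <= k * m)%nat)) -> (w <= (k + 1) * m)%nat ->
    (be = b l \/ (be = 0 /\ (w <= (l - 1) * m + q)%nat)) -> (w <= l * m + q)%nat ->
    (w <= 2 * q)%nat ->
    (forall i j, (i * m + j * q < w)%nat -> (i * (r + 1) + j * (r + 2) <= (r + 1) * r)%nat) ->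
    weighted_lipschitz m q w (fun x y => f x y - (al * x ^ k + be * (x ^ (l - 1) * y)))).
  { intros m q w al be Hm Hq Hal Hk' Hbe Hl' Hq' Hw.
    apply weighted_lipschitz_ext with (fun x y =>
      ((y ^ 0 * (x ^ k * sum_f_R0 (fun i => a (k + i)%nat * x ^ i) (r - k)) - a k * (x ^ k * y ^ 0))
       + (a k - al) * (x ^ k * y ^ 0)) +
      ((y ^ 1 * (x ^ (l - 1) * sum_f_R0 (fun i => b (l + i)%nat * x ^ i) (r - l))
         - b l * (x ^ (l - 1) * y ^ 1)) + (b l - be) * (x ^ (l - 1) * y ^ 1)) + u x y + g x y).
    { intros x y. unfold f, p_poly, q_poly. simpl (y ^ 0). rewrite pow_1. ring. }
    assert (Hzero : forall z i j, z = 0 -> weighted_lipschitz m q w (fun x y => z * (x ^ i * y ^ j))).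
    { intros z i j ->. apply weighted_lipschitz_ext with (fun x y => 0 * (x ^ w * y ^ 0)); [intros; ring|].
      apply weighted_lipschitz_scal, weighted_lipschitz_monomial; nia. }
    apply weighted_lipschitz_plus;
      [apply weighted_lipschitz_plus; [apply weighted_lipschitz_plus; apply weighted_lipschitz_plus|]|].
    - apply weighted_lipschitz_tail; auto. lia.
    - destruct Hal as [->|[-> Hal]]; [apply Hzero; ring|].
      apply weighted_lipschitz_scal, weighted_lipschitz_monomial; lia.
    - apply weighted_lipschitz_tail; auto. nia.
    - destruct Hbe as [->|[-> Hbe]]; [apply Hzero; ring|].
      apply weighted_lipschitz_scal, weighted_lipschitz_monomial; lia.
    - now apply weighted_lipschitz_factor_y2.
    - now apply weighted_lipschitz_remainder with r; auto. }
  destruct s; simpl in Hs, Hsg |- *.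
  (* Weights 2 and [k + 1]: since [k < 2 l - 1], the monomial [x^(l-1) y] has weight at least
     [2 k + 1]. *)
  - exists k, (l - 1)%nat, (a k), 0. split; auto. repeat split; auto; try lra; try lia.
    apply Hsum; auto; try lia; [right; split; [auto|lia]|].
    intros i j Hij. destruct j as [|[|j]]; [nia| |nia].
    assert (i + 2 <= r)%nat by lia. nia.
  (* Weights 1 and [l]: both [x^k] and [x^(l-1) y] have weight [2 l - 1]. *)
  - exists k, (l - 1)%nat, (a k), (b l). split; auto. repeat split; auto; try lra; try lia.
    apply Hsum; auto; try lia.
    intros i j Hij. destruct j as [|[|j]]; [nia| |nia].
    assert (i + 2 <= r)%nat by lia. nia.
  (* Here [x^k] has weight above [2 l - 1], so [A = 0]; the exponent [2 l - 1] is the one with the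
     weight required of [i0]. *)
  - exists (2 * l - 1)%nat, (l - 1)%nat, 0, (b l). split; auto. repeat split; auto; try lra; try lia.
    eapply weighted_lipschitz_ext; [|apply (Hsum 1%nat (1 + (l - 1))%nat (1 + 2 * (l - 1) + 1)%nat 0 (b l)); auto; try lia].
    + intros x y; simpl; ring.
    + right; split; [auto|lia].
    + intros i j Hij. destruct j as [|[|j]]; [nia| |nia].
      assert (i + 2 <= r)%nat by lia. nia.
Qed.

(** * Improving an approximate parametrisation *)

(** Here [rho] is the coefficient [R_N], not the radius of an interval. Both errors are indexed by
    [nu], the order of the correction to the first component that they call for. *)
Definition approx_invariant (m q nu : nat) (c rho kappa : R) (f : R -> R -> R)
    (K1 K2 Q : R -> R) : Prop :=
  (analytic_germ K1 /\ analytic_germ K2 /\ analytic_germ Q) /\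
  leading m 1 K1 /\ leading (m + q) kappa K2 /\ leading (S q) rho (fun t => Q t - t) /\
  ordO (nu + q) (fun t => K1 t + c * K2 t - K1 (Q t)) /\
  ordO (nu + 2 * q) (fun t => K2 t + f (K1 t) (K2 t) - K2 (Q t)).

Lemma leading_near_id (q : nat) (rho : R) (Q : R -> R) :
  (1 <= q)%nat -> leading (S q) rho (fun t => Q t - t) -> leading 1 1 Q.
Proof.
  intros Hq H. apply ordO_ext with (fun t => Q t - t); [intros; ring|].
  apply ordO_weaken with (S q); [lia|]. now apply leading_ordO with rho.
Qed.

Lemma weighted_lipschitz_ordO0 (p q w : nat) (f : R -> R -> R) (X Y : R -> R) :
  weighted_lipschitz p q w f -> f 0 0 = 0 -> ordO p X -> ordO q Y ->
  ordO w (fun t => f (X t) (Y t)).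
Proof.
  intros Hf H0 HX HY.
  assert (Hz : forall n, ordO n (fun _ => 0)).
  { intros n. apply ordO_of_bound with 0, near0_forall. intros; rewrite Rabs_R0; lra. }
  apply ordO_ext with (fun t => f (X t) (Y t) - f 0 0); [intros; rewrite H0; ring|].
  apply (weighted_lipschitz_ordO p q w w f X (fun _ => 0) Y (fun _ => 0)); auto.
  - apply ordO_ext with X; [intros; ring|]. apply ordO_weaken with p; [lia|auto].
  - apply ordO_ext with Y; [intros; ring|]. apply ordO_weaken with q; [lia|auto].
Qed.

Lemma weighted_form_leading (m q i0 i1 : nat) (A B kappa : R) (f : R -> R -> R) (K1 K2 : R -> R) :
  (1 <= m)%nat -> weighted_form m q i0 i1 A B f -> leading m 1 K1 -> leading (m + q) kappa K2 ->
  leading (m + 2 * q) (A + B * kappa) (fun t => f (K1 t) (K2 t)).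
Proof.
  intros Hm (_ & Hi0 & Hi1 & Hf0 & Hf) H1 H2.
  apply leading_ext with (fun t => (A * K1 t ^ i0 + B * (K1 t ^ i1 * K2 t)) +
    (f (K1 t) (K2 t) - (A * K1 t ^ i0 + B * (K1 t ^ i1 * K2 t)))); [intros; ring|].
  apply leading_coef with (A * 1 ^ i0 + B * kappa + 0); [rewrite pow1; ring|].
  apply leading_plus; [apply leading_plus|].
  - apply leading_scal. replace (m + 2 * q)%nat with (i0 * m)%nat by lia. now apply leading_power.
  - destruct Hi1 as [->|Hi1].
    + apply leading_coef with 0; [ring|]. apply ordO_leading0.
      apply ordO_of_bound with 0, near0_forall. intros; rewrite !Rmult_0_l, Rabs_R0; lra.
    + apply leading_scal. replace (m + 2 * q)%nat with (i1 * m + (m + q))%nat by nia.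
      apply leading_coef with (1 ^ i1 * kappa); [rewrite pow1; ring|].
      apply leading_mult; auto. now apply leading_power.
  - apply ordO_leading0. replace (S (m + 2 * q)) with (m + 2 * q + 1)%nat by lia.
    apply (weighted_lipschitz_ordO0 m (m + q) _
      (fun x y => f x y - (A * x ^ i0 + B * (x ^ i1 * y)))); auto.
    + rewrite Hf0. replace (0 ^ i0) with 0; [ring|].
      symmetry; apply pow_i. destruct i0; lia.
    + now apply leading_ordO with 1.
    + now apply leading_ordO with kappa.
Qed.

(** For [nu > m] the errors do not reach the orders [m + q] and [m + 2q], so the leading terms at
    these orders must cancel. This ties [kappa] and [rho] to the coefficients of the map. *)
Lemma approx_invariant_relations (m q nu i0 i1 : nat) (A B c rho kappa : R) (f : R -> R -> R)
    (K1 K2 Q : R -> R) :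
  (1 <= m)%nat -> (1 <= q)%nat -> (m < nu)%nat -> weighted_form m q i0 i1 A B f ->
  approx_invariant m q nu c rho kappa f K1 K2 Q ->
  c * kappa = INR m * rho /\ A + B * kappa = INR (m + q) * kappa * rho.
Proof.
  intros Hm Hq Hnu Hf ((G1 & G2 & G3) & L1 & L2 & L3 & E1 & E2).
  assert (LQ := leading_near_id q rho Q Hq L3).
  destruct m as [|m]; [lia|]. destruct q as [|q]; [lia|].
  split.
  - apply Rminus_diag_uniq.
    apply (leading_unique (S m + S q) _ (fun t => c * K2 t - (K1 (Q t) - K1 t))).
    + apply leading_minus.
      * apply leading_scal, L2.
      * replace (INR (S m) * rho) with (INR (S m) * 1 * rho) by ring.
        replace (S m + S q)%nat with (m + S (S q))%nat by lia.
        apply (leading_comp_diff K1 (fun t => t) Q); auto. apply leading_id.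
    + eapply ordO_ext; [|eapply ordO_weaken; [|apply E1]].
      * intros; simpl; ring.
      * lia.
  - apply Rminus_diag_uniq.
    apply (leading_unique (S m + 2 * S q) _ (fun t => f (K1 t) (K2 t) - (K2 (Q t) - K2 t))).
    + apply leading_minus.
      * now apply weighted_form_leading with i0 i1.
      * replace (S m + 2 * S q)%nat with ((m + S q) + S (S q))%nat by lia.
        replace (S m + S q)%nat with (S (m + S q)) by lia.
        apply (leading_comp_diff K2 (fun t => t) Q); auto; apply leading_id.
    + eapply ordO_ext; [|eapply ordO_weaken; [|apply E2]].
      * intros; simpl; ring.
      * lia.
Qed.

(* The determinant of the linear system for [(alpha, beta)] is
   [(nu - m - q) rho (B - (nu + m + 2 q) rho)]; at the resonance [nu = m + q]
   the freedom in [delta] replaces the one in [beta]. *)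
Lemma correction_system (m q nu i0 i1 : nat) (A B c rho kappa e1 e2 : R) :
  (1 <= m)%nat -> (1 <= q)%nat -> (1 <= nu)%nat -> 0 < c -> rho < 0 -> 0 <= A ->
  (m * i0 = m + 2 * q)%nat -> (B = 0 \/ (m * i1 = q)%nat) ->
  c * kappa = INR m * rho -> A + B * kappa = INR (m + q) * kappa * rho ->
  exists al be de, (nu <> (m + q)%nat -> de = 0) /\
    e1 + c * be - INR nu * rho * al - INR m * de = 0 /\
    e2 + (INR i0 * A + INR i1 * B * kappa) * al + B * be
      - INR (nu + q) * rho * be - INR (m + q) * kappa * de = 0.
Proof.
  intros Hm Hq Hnu Hc Hrho HA Hi0 Hi1 R1 R2.
  set (P := INR i0 * A + INR i1 * B * kappa).
  assert (I0 : INR m * INR i0 = INR m + 2 * INR q).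
  { rewrite <- mult_INR, Hi0, plus_INR, mult_INR. simpl; ring. }
  assert (I1 : INR m * INR i1 * B = INR q * B).
  { destruct Hi1 as [->|Hi1]; [ring|]. rewrite <- mult_INR, Hi1; ring. }
  assert (Hm1 : 1 <= INR m) by (apply (le_INR 1); auto).
  assert (Hq1 : 1 <= INR q) by (apply (le_INR 1); auto).
  assert (Hn1 : 1 <= INR nu) by (apply (le_INR 1); auto).
  rewrite !plus_INR in *.
  assert (HP : INR m * P = (INR m + 2 * INR q) * A + INR q * B * kappa).
  { unfold P. rewrite <- I0, <- I1. ring. }
  (* The second relation eliminates [A]. *)
  assert (HP' : INR m * P = (INR m + INR q) * kappa * ((INR m + 2 * INR q) * rho - B)).
  { rewrite HP. replace A with ((INR m + INR q) * kappa * rho - B * kappa) by lra. ring. }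
  assert (Hk : kappa < 0) by nra.
  (* Since [A = kappa ((m + q) rho - B)] with [A >= 0] and [kappa < 0], the number [B] cannot be too
     negative. This makes the factors [B - (nu + m + 2q) rho] and [B - (2m + 3q) rho] of the two
     determinants positive. *)
  assert (HB : (INR m + INR q) * rho <= B).
  { assert (kappa * ((INR m + INR q) * rho - B) = A) by lra. nra. }
  destruct (Nat.eq_dec nu (m + q)) as [Heq|Hne].
  (* Resonant order: [be] is set to 0 and Cramer's rule is applied to [(al, de)]. *)
  - assert (En : INR nu = INR m + INR q) by (rewrite Heq, plus_INR; ring).
    set (D := - (INR m + INR q) * kappa * ((2 * INR m + 3 * INR q) * rho - B)).
    assert (HD0 : (2 * INR m + 3 * INR q) * rho - B < 0) by nra.
    assert (HD : D <> 0).
    { unfold D. assert (0 < (INR m + INR q) * - kappa) by nra. nra. }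
    assert (HDe : D = - ((INR m + INR q) * kappa) * (INR nu * rho) - INR m * P).
    { rewrite HP', En. unfold D. ring. }
    exists ((- (INR m + INR q) * kappa * e1 + INR m * e2) / D), 0,
      ((- (INR nu * rho) * e2 - P * e1) / D).
    split; [intros; contradiction|]. split.
    + apply Rmult_eq_reg_r with D; auto. field_simplify; auto. rewrite HDe. ring.
    + apply Rmult_eq_reg_r with D; auto. field_simplify; auto. rewrite HDe. ring.
  - set (D := INR nu * rho * (B - (INR nu + INR q) * rho) + c * P).
    assert (HDe : D = (INR m + INR q - INR nu) * rho * ((INR nu + INR m + 2 * INR q) * rho - B)).
    { apply Rmult_eq_reg_l with (INR m); [|lra]. unfold D.
      rewrite Rmult_plus_distr_l. replace (INR m * (c * P)) with (c * (INR m * P)) by ring.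
      rewrite HP'. replace (c * ((INR m + INR q) * kappa * ((INR m + 2 * INR q) * rho - B)))
        with ((c * kappa) * ((INR m + INR q) * ((INR m + 2 * INR q) * rho - B))) by ring.
      rewrite R1. ring. }
    assert (Hne' : INR m + INR q - INR nu <> 0).
    { intros H. apply Hne, INR_eq. rewrite plus_INR. lra. }
    assert (HD : D <> 0).
    { rewrite HDe. repeat apply Rmult_integral_contrapositive_currified; auto; nra. }
    exists ((e1 * (B - (INR nu + INR q) * rho) - c * e2) / D),
      ((- (INR nu * rho) * e2 - P * e1) / D), 0.
    split; auto. split.
    + apply Rmult_eq_reg_r with D; auto. field_simplify; auto. unfold D. ring.
    + apply Rmult_eq_reg_r with D; auto. field_simplify; auto. unfold D. ring.
Qed.

(** The coefficient is the differential of [A x^i0 + B x^i1 y] at [(1, kappa)], applied to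
    [(al, be)]; the rest of [f] has one more weighted order. *)
Lemma weighted_form_leading_diff (m q nu i0 i1 : nat) (A B kappa al be : R) (f : R -> R -> R)
    (K1 K2 L1 L2 : R -> R) :
  (1 <= m)%nat -> (1 <= q)%nat -> weighted_form m q i0 i1 A B f ->
  leading m 1 K1 -> leading (m + q) kappa K2 -> leading m 1 L1 -> leading (m + q) kappa L2 ->
  leading nu al (fun t => L1 t - K1 t) -> leading (nu + q) be (fun t => L2 t - K2 t) ->
  leading (nu + 2 * q) ((INR i0 * A + INR i1 * B * kappa) * al + B * be)
    (fun t => f (L1 t) (L2 t) - f (K1 t) (K2 t)).
Proof.
  intros Hm Hq (_ & Hi0 & Hi1 & Hf0 & Hf) HK1 HK2 HL1 HL2 Ha Hb.
  set (f' := fun x y => f x y - (A * x ^ i0 + B * (x ^ i1 * y))) in *.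
  apply leading_ext with (fun t => A * (L1 t ^ i0 - K1 t ^ i0) +
    B * (L1 t ^ i1 * (L2 t - K2 t) + (L1 t ^ i1 - K1 t ^ i1) * K2 t) +
    (f' (L1 t) (L2 t) - f' (K1 t) (K2 t))); [intros; unfold f'; ring|].
  apply leading_coef with (A * (INR i0 * al) + B * (be + INR i1 * al * kappa) + 0); [ring|].
  apply leading_plus; [apply leading_plus|].
  - apply leading_scal. destruct i0 as [|i0]; [lia|].
    replace (nu + 2 * q)%nat with (nu + i0 * m)%nat by lia.
    apply leading_coef with (INR (S i0) * 1 ^ i0 * al); [rewrite pow1; ring|].
    now apply leading_pow_diff.
  - destruct Hi1 as [->|Hi1].
    + apply leading_coef with 0; [ring|]. apply ordO_leading0.
      apply ordO_of_bound with 0, near0_forall. intros; rewrite !Rmult_0_l, Rabs_R0; lra.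
    + apply leading_scal. apply leading_plus.
      * replace (nu + 2 * q)%nat with (i1 * m + (nu + q))%nat by nia.
        apply leading_coef with (1 ^ i1 * be); [rewrite pow1; ring|].
        apply leading_mult; auto. now apply leading_power.
      * destruct i1 as [|i1]; [lia|].
        replace (nu + 2 * q)%nat with ((nu + i1 * m) + (m + q))%nat by nia.
        apply leading_mult; auto.
        apply leading_coef with (INR (S i1) * 1 ^ i1 * al); [rewrite pow1; ring|].
        now apply leading_pow_diff.
  - apply ordO_leading0.
    apply (weighted_lipschitz_ordO m (m + q) (m + 2 * q + 1)); auto.
    + now apply leading_ordO with 1.
    + now apply leading_ordO with 1.
    + now apply leading_ordO with kappa.
    + now apply leading_ordO with kappa.
    + apply ordO_weaken with nu; [lia|]. now apply leading_ordO with al.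
    + apply ordO_weaken with (nu + q)%nat; [lia|]. now apply leading_ordO with be.
Qed.

Lemma ordO_mono (p nu : nat) (al : R) : (p <= nu)%nat -> ordO p (fun t => al * t ^ nu).
Proof. intros H. apply ordO_scal, ordO_weaken with nu; [auto|apply ordO_pow]. Qed.

Lemma leading_perturb (p nu : nat) (e al : R) (K : R -> R) : (p < nu)%nat ->
  leading p e K -> leading p e (fun t => K t + al * t ^ nu).
Proof.
  intros H HK. apply leading_coef with (e + 0); [ring|].
  apply leading_plus; auto. apply ordO_leading0, ordO_mono; lia.
Qed.

Lemma approx_invariant_step (m q nu i0 i1 : nat) (A B c rho kappa : R) (f : R -> R -> R)
    (K1 K2 Q : R -> R) :
  (1 <= m)%nat -> (1 <= q)%nat -> (m < nu)%nat -> 0 < c -> rho < 0 ->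
  weighted_form m q i0 i1 A B f -> approx_invariant m q nu c rho kappa f K1 K2 Q ->
  exists al be de, (nu <> (m + q)%nat -> de = 0) /\
    approx_invariant m q (S nu) c rho kappa f (fun t => K1 t + al * t ^ nu)
      (fun t => K2 t + be * t ^ (nu + q)) (fun t => Q t + de * t ^ (2 * q + 1)).
Proof.
  intros Hm Hq Hnu Hc Hrho Hf HI.
  destruct (approx_invariant_relations m q nu i0 i1 A B c rho kappa f K1 K2 Q Hm Hq Hnu Hf HI)
    as [R1 R2].
  destruct HI as ((G1 & G2 & G3) & L1 & L2 & L3 & E1 & E2).
  pose proof (weighted_form_lipschitz _ _ _ _ _ _ _ Hm Hf) as HfL.
  pose proof Hf as (HA & Hi0 & Hi1 & Hf0 & _).
  assert (LQ := leading_near_id q rho Q Hq L3).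
  assert (Z1 : K1 0 = 0).
  { apply (germ_ordO_zero K1 (m - 1)); auto. replace (S (m - 1)) with m by lia.
    now apply leading_ordO with 1. }
  assert (Z2 : K2 0 = 0).
  { apply (germ_ordO_zero K2 (m + q - 1)); auto. replace (S (m + q - 1)) with (m + q)%nat by lia.
    now apply leading_ordO with kappa. }
  assert (Z3 : Q 0 = 0).
  { apply (germ_ordO_zero Q 0); auto. now apply leading_ordO with 1. }
  assert (GE1 : analytic_germ (fun t => K1 t + c * K2 t - K1 (Q t))).
  { apply analytic_germ_minus; [apply analytic_germ_plus|]; auto.
    - now apply analytic_germ_scal.
    - now apply analytic_germ_comp. }
  assert (GE2 : analytic_germ (fun t => K2 t + f (K1 t) (K2 t) - K2 (Q t))).
  { apply analytic_germ_minus; [apply analytic_germ_plus|]; auto.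
    - now apply weighted_lipschitz_germ with m (m + q)%nat (m + 2 * q)%nat.
    - now apply analytic_germ_comp. }
  (* The errors are analytic, hence have leading coefficients [e1] and [e2] to be cancelled. *)
  destruct (germ_leading _ _ GE1 E1) as [e1 He1].
  destruct (germ_leading _ _ GE2 E2) as [e2 He2].
  destruct (correction_system m q nu i0 i1 A B c rho kappa e1 e2)
    as (al & be & de & Hde & S1 & S2); auto; try lia.
  exists al, be, de. split; auto.
  set (M1 := fun t => K1 t + al * t ^ nu). set (M2 := fun t => K2 t + be * t ^ (nu + q)).
  set (Q' := fun t => Q t + de * t ^ (2 * q + 1)).
  assert (LM1 : leading m 1 M1) by (apply leading_perturb; auto).
  assert (LM2 : leading (m + q) kappa M2) by (apply leading_perturb; auto; lia).
  assert (LQ' : leading (S q) rho (fun t => Q' t - t)).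
  { apply leading_ext with (fun t => (Q t - t) + de * t ^ (2 * q + 1)); [intros; unfold Q'; ring|].
    apply leading_perturb; auto; lia. }
  assert (LQ1 := leading_near_id q rho Q' Hq LQ').
  (* Changing [Q] by [de t^(2q+1)] alters [K (Q t)] at order [n + 2q], which equals [s + q] just at
     the resonance; elsewhere [de = 0] and nothing changes. *)
  assert (Hcomp : forall K n e s, analytic_germ K -> (m <= n)%nat -> leading n e K -> (s = nu + (n - m))%nat ->
    leading (s + q) (INR n * e * de) (fun t => K (Q' t) - K (Q t))).
  { intros K n e s HK Hn HL Hs. destruct n as [|n]; [lia|].
    destruct (Nat.eq_dec nu (m + q)) as [Heq|Hne].
    - assert (LL : leading (S (S (2 * q - 1))) de (fun t => Q' t - Q t)).
      { replace (S (S (2 * q - 1))) with (2 * q + 1)%nat by lia.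
        apply leading_ext with (fun t => de * t ^ (2 * q + 1)); [intros; unfold Q'; ring|].
        apply leading_coef with (de * 1); [ring|]. apply leading_scal, leading_pow. }
      replace (s + q)%nat with (n + S (S (2 * q - 1)))%nat by lia.
      now apply leading_comp_diff.
    - rewrite (Hde Hne). apply leading_coef with 0; [ring|].
      apply ordO_leading0, ordO_of_bound with 0, near0_forall.
      intros t _. unfold Q'. rewrite (Hde Hne), Rmult_0_l, Rplus_0_r. unfold Rminus.
      rewrite Rplus_opp_r, Rabs_R0; lra. }
  assert (Hpow : forall n, (1 <= n)%nat -> leading (n + q) (INR n * rho) (fun t => Q' t ^ n - t ^ n)).
  { intros n Hn. destruct n as [|n]; [lia|].
    replace (S n + q)%nat with (S q + n * 1)%nat by lia.
    apply leading_coef with (INR (S n) * 1 ^ n * rho); [rewrite pow1; ring|].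
    apply (leading_pow_diff 1 (S q) n 1 rho (fun t => t) Q'); auto. apply leading_id. }
  split; [split; [|split]|split; [|split; [|split; [|split]]]]; auto.
  - apply analytic_germ_plus; auto. apply analytic_germ_scal, analytic_germ_pow.
  - apply analytic_germ_plus; auto. apply analytic_germ_scal, analytic_germ_pow.
  - apply analytic_germ_plus; auto. apply analytic_germ_scal, analytic_germ_pow.
  (* The new error is the old one plus the effects of [be], [al] and [de], with coefficients
     cancelling by [S1]. Subtracting [0 * t^(nu+q)] brings the goal to the form of [leading]. *)
  - apply ordO_ext with (fun t => ((((K1 t + c * K2 t - K1 (Q t)) + c * be * t ^ (nu + q)) -
      al * (Q' t ^ nu - t ^ nu)) - (K1 (Q' t) - K1 (Q t))) - 0 * t ^ (nu + q)).
    { intros t. unfold M1, M2. ring. }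
    change (leading (nu + q) 0 (fun t => (((K1 t + c * K2 t - K1 (Q t)) + c * be * t ^ (nu + q)) -
      al * (Q' t ^ nu - t ^ nu)) - (K1 (Q' t) - K1 (Q t)))).
    apply leading_coef with (e1 + c * be * 1 - al * (INR nu * rho) - INR m * 1 * de); [lra|].
    apply leading_minus; [apply leading_minus; [apply leading_plus|]|]; auto.
    + apply leading_scal, leading_pow.
    + apply leading_scal, Hpow; lia.
    + apply Hcomp; auto; lia.
  - apply ordO_ext with (fun t => (((((K2 t + f (K1 t) (K2 t) - K2 (Q t)) +
      (f (M1 t) (M2 t) - f (K1 t) (K2 t))) -
      be * (Q' t ^ (nu + q) - t ^ (nu + q))) - (K2 (Q' t) - K2 (Q t)))) - 0 * t ^ (nu + 2 * q)).
    { intros t. unfold M1, M2. ring. }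
    change (leading (nu + 2 * q) 0 (fun t => ((((K2 t + f (K1 t) (K2 t) - K2 (Q t)) +
      (f (M1 t) (M2 t) - f (K1 t) (K2 t))) -
      be * (Q' t ^ (nu + q) - t ^ (nu + q))) - (K2 (Q' t) - K2 (Q t))))).
    apply leading_coef with (e2 + ((INR i0 * A + INR i1 * B * kappa) * al + B * be) -
      be * (INR (nu + q) * rho) - INR (m + q) * kappa * de); [lra|].
    apply leading_minus; [apply leading_minus; [apply leading_plus|]|]; auto.
    + apply (weighted_form_leading_diff m q nu i0 i1 A B kappa al be f K1 K2 M1 M2); auto.
      * apply leading_ext with (fun t => al * t ^ nu); [intros; unfold M1; ring|].
        apply leading_coef with (al * 1); [ring|]. apply leading_scal, leading_pow.
      * apply leading_ext with (fun t => be * t ^ (nu + q)); [intros; unfold M2; ring|].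
        apply leading_coef with (be * 1); [ring|]. apply leading_scal, leading_pow.
    + apply leading_scal. replace (nu + 2 * q)%nat with ((nu + q) + q)%nat by lia. apply Hpow; lia.
    + replace (nu + 2 * q)%nat with ((nu + q) + q)%nat by lia. apply Hcomp; auto; lia.
Qed.

(** Every correction of [Q] has the exponent [2q + 1], so they accumulate in one number [de]. It
    stays 0 when the start lies beyond the resonance. *)
Lemma approx_invariant_extend (m q nu i0 i1 d : nat) (A B c rho kappa : R) (f : R -> R -> R)
    (K1 K2 Q : R -> R) :
  (1 <= m)%nat -> (1 <= q)%nat -> (m < nu)%nat -> 0 < c -> rho < 0 ->
  weighted_form m q i0 i1 A B f -> approx_invariant m q nu c rho kappa f K1 K2 Q ->
  exists L1 L2 de,
    approx_invariant m q (nu + d) c rho kappa f L1 L2 (fun t => Q t + de * t ^ (2 * q + 1)) /\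
    ordO nu (fun t => L1 t - K1 t) /\ ordO (nu + q) (fun t => L2 t - K2 t) /\
    ((m + q < nu)%nat -> de = 0).
Proof.
  intros Hm Hq Hnu Hc Hrho Hf HI. induction d as [|d IH].
  - assert (Hz : forall n (K : R -> R), ordO n (fun t => K t - K t)).
    { intros n K. apply ordO_of_bound with 0, near0_forall. intros t _.
      unfold Rminus; rewrite Rplus_opp_r, Rabs_R0; lra. }
    exists K1, K2, 0. split; auto. rewrite Nat.add_0_r.
    destruct HI as ((G1 & G2 & G3) & L1 & L2 & L3 & E1 & E2).
    assert (EQ : forall t, Q t + 0 * t ^ (2 * q + 1) = Q t) by (intros; ring).
    split; [split; [|split]|split; [|split; [|split; [|split]]]]; auto.
    + apply analytic_germ_plus; auto. apply analytic_germ_scal, analytic_germ_pow.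
    + eapply leading_ext; [|exact L3]. intros t; simpl; now rewrite EQ.
    + eapply ordO_ext; [|exact E1]. intros t; simpl; now rewrite EQ.
    + eapply ordO_ext; [|exact E2]. intros t; simpl; now rewrite EQ.
  - destruct IH as (L1 & L2 & de & HI' & D1 & D2 & Hde).
    destruct (approx_invariant_step m q (nu + d) i0 i1 A B c rho kappa f L1 L2
      (fun t => Q t + de * t ^ (2 * q + 1))) as (al & be & de' & Hde' & HI''); auto; [lia|].
    exists (fun t => L1 t + al * t ^ (nu + d)), (fun t => L2 t + be * t ^ (nu + d + q)), (de + de').
    split; [|split; [|split]].
    + rewrite <- plus_n_Sm.
      destruct HI'' as ((G1 & G2 & G3) & M1 & M2 & M3 & E1 & E2).
      assert (EQ : forall t, Q t + de * t ^ (2 * q + 1) + de' * t ^ (2 * q + 1) =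
        Q t + (de + de') * t ^ (2 * q + 1)) by (intros; ring).
      split; [split; [|split]|split; [|split; [|split; [|split]]]]; auto.
      * apply analytic_germ_plus; [apply HI|]. apply analytic_germ_scal, analytic_germ_pow.
      * eapply leading_ext; [|exact M3]. intros t; simpl; now rewrite EQ.
      * eapply ordO_ext; [|exact E1]. intros t; simpl; now rewrite EQ.
      * eapply ordO_ext; [|exact E2]. intros t; simpl; now rewrite EQ.
    + apply ordO_ext with (fun t => (L1 t - K1 t) + al * t ^ (nu + d)); [intros; ring|].
      apply ordO_plus; auto. apply ordO_mono; lia.
    + apply ordO_ext with (fun t => (L2 t - K2 t) + be * t ^ (nu + d + q)); [intros; ring|].
      apply ordO_plus; auto. apply ordO_mono; lia.
    + intros H. rewrite Hde, Hde' by lia. ring.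
Qed.

(** * Convergence of the iteration *)

(** The point is the factor [s^2]: on the disc of radius [s t] the nonlinear part is smaller by [s]
    than the gap that the linear part leaves. *)
Lemma wiener_pow_second_order (t s : R) (n : nat) : 0 < t -> 0 <= s <= 1 ->
  wiener (fun h => (t + h) ^ S n - t ^ S n - INR (S n) * t ^ n * h) (s * t)
    (INR (S n) * 4 ^ n * s ^ 2 * t ^ S n).
Proof.
  intros Ht Hs.
  assert (Hst : 0 <= s * t) by nra.
  assert (Hid : wiener (fun h => t + h) (s * t) (2 * t)).
  { apply wiener_le with (Rabs t + s * t); [rewrite Rabs_pos_eq; nra|].
    apply wiener_plus; auto; [now apply wiener_const|now apply wiener_id]. }
  induction n as [|n IH].
  - apply wiener_ext with (fun _ => 0); [intros; simpl; ring|].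
    apply wiener_le with (Rabs 0); [|now apply wiener_const].
    rewrite Rabs_R0. simpl. assert (0 <= s * s * t) by nra. lra.
  - apply wiener_ext with (fun h =>
      (t + h) * ((t + h) ^ S n - t ^ S n - INR (S n) * t ^ n * h) + (INR (S n) * t ^ n) * (h * h)).
    { intros h _. rewrite (S_INR (S n)). simpl pow. ring. }
    eapply wiener_le; [|apply wiener_plus; auto; [apply wiener_mult; [auto|exact Hid|exact IH]|
      apply wiener_scal, wiener_mult; auto; now apply wiener_id]].
    assert (Htn : 0 <= t ^ n) by (apply pow_le; lra).
    assert (HN := pos_INR (S n)).
    rewrite Rabs_pos_eq by now apply Rmult_le_pos.
    assert (H4 : 1 <= 4 ^ n) by (apply pow_R1_Rle; lra).
    replace (2 * t * (INR (S n) * 4 ^ n * s ^ 2 * t ^ S n) + INR (S n) * t ^ n * (s * t * (s * t)))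
      with (INR (S n) * (2 * 4 ^ n + 1) * (s ^ 2 * t ^ S (S n))) by (simpl; ring).
    replace (INR (S (S n)) * 4 ^ S n * s ^ 2 * t ^ S (S n))
      with (INR (S (S n)) * (4 * 4 ^ n) * (s ^ 2 * t ^ S (S n))) by (simpl; ring).
    apply Rmult_le_compat_r; [apply Rmult_le_pos; apply pow_le; lra|].
    apply Rmult_le_compat; try lra. rewrite (S_INR (S n)); lra.
Qed.

(* The gap between [Q'(t) t] and [Q t] is [q |rho| t ^ (q + 1)] to leading order,
   which leaves room for the nonlinear part of [Q] on the disc of radius [s t]. *)
Lemma contracting_disc (q : nat) (rho : R) (Q : R -> R) :
  (1 <= q)%nat -> rho < 0 -> analytic_germ Q -> leading (S q) rho (fun t => Q t - t) ->
  exists s, 0 < s <= 1 /\ near0 (fun t => 0 < Q t < t /\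
    wiener (fun h => Q (t + h) - Q t) (s * t) (s * Q t)).
Proof.
  intros Hq Hrho HQ HL.
  set (chi := fun t => Q t - t - rho * t ^ S q).
  assert (Hchi : analytic_germ chi).
  { apply analytic_germ_minus; [apply analytic_germ_minus; auto|].
    - destruct (analytic_germ_pow 1) as (r & M & Hr & H). exists r, M. split; auto.
      eapply wiener_ext; [|exact H]. intros; simpl; ring.
    - apply analytic_germ_scal, analytic_germ_pow. }
  destruct (germ_recenter chi (S (S q)) Hchi HL) as (C & HC & HW).
  pose proof HL as (C' & HC' & HO).
  set (B := INR (S q) * 4 ^ q).
  assert (HB : 0 <= B) by (apply Rmult_le_pos; [apply pos_INR|apply pow_le; lra]).
  (* This makes [B s <= 1/2], where [B] is the constant of the second order term of [t^(q+1)]. *)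
  exists (/ (2 * (B + 1))). set (s := / (2 * (B + 1))).
  assert (Hs0 : 0 < s) by (apply Rinv_0_lt_compat; lra).
  assert (Hs : s * (2 * (B + 1)) = 1) by (apply Rinv_l; lra).
  assert (Hs1 : s <= 1) by nra.
  split; [lra|].
  (* [D1] ensures [(C + C') t <= |rho| / 2], and [D2] that the linear factor [1 + rho (q + 1) t^q]
     is nonnegative. *)
  assert (D1 : 0 < - rho / (2 * (C + C' + 1))) by (apply Rdiv_lt_0_compat; lra).
  assert (HNq := pos_INR (S q)).
  assert (D2 : 0 < / ((1 - rho) * (INR (S q) + 1))) by (apply Rinv_0_lt_compat; nra).
  generalize (near0_and _ _ (near0_and _ _ (near0_lt _ D1) (near0_and _ _ (near0_lt _ D2) (near0_lt 1 Rlt_0_1)))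
    (near0_and _ _ (leading_1_bounds Q (leading_near_id q rho Q Hq HL)) (near0_and _ _ HW HO))).
  apply near0_imp. intros t Ht ((h1 & h2 & h3) & h4 & h5 & h6).
  specialize (h5 1 ltac:(lra)). rewrite Rmult_1_l in h5.
  assert (P0 : 0 < t ^ S q) by now apply pow_lt.
  assert (g1 : (C + C') * t <= - rho / 2).
  { apply Rmult_lt_compat_r with (r := 2 * (C + C' + 1)) in h1; [|lra].
    unfold Rdiv in h1 at 1. rewrite Rmult_assoc, Rinv_l in h1 by lra. nra. }
  assert (g2 : - rho * INR (S q) * t ^ q <= 1).
  { assert (t ^ q <= t ^ 1) by (apply pow_decr_exp; [lra|auto]). rewrite pow_1 in *.
    apply Rmult_lt_compat_r with (r := (1 - rho) * (INR (S q) + 1)) in h2; [|nra].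
    rewrite Rinv_l in h2 by nra.
    assert (- rho * INR (S q) * t ^ q <= - rho * INR (S q) * t) by (apply Rmult_le_compat_l; nra).
    assert (t * ((1 - rho) * (INR (S q) + 1)) = - rho * INR (S q) * t + t * (INR (S q) + 1 - rho)) by ring.
    assert (0 <= t * (INR (S q) + 1 - rho)) by nra. lra. }
  apply Rabs_le_between in h6.
  replace (t ^ S (S q)) with (t * t ^ S q) in h6 by reflexivity.
  assert (g3 : C' * (t * t ^ S q) <= - rho / 2 * t ^ S q).
  { rewrite <- Rmult_assoc. apply Rmult_le_compat_r; [lra|]. nra. }
  assert (g4 : rho * t ^ S q < 0) by nra.
  split; [split; lra|].
  (* Three parts: linear in [h], the nonlinear part of [rho t^(q+1)], and the increment of the
     higher order rest [chi]. *)
  apply wiener_ext with (fun h => ((1 + rho * INR (S q) * t ^ q) * h +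
    rho * ((t + h) ^ S q - t ^ S q - INR (S q) * t ^ q * h)) + (chi (t + h) - chi (t + 0))).
  { intros h _. unfold chi. rewrite Rplus_0_r. ring. }
  assert (Hst : 0 <= s * t) by nra.
  eapply wiener_le; [|apply wiener_plus; [auto|apply wiener_plus; [auto|
    apply wiener_scal, wiener_id; auto|
    apply wiener_scal, wiener_pow_second_order; [lra|lra]]|
    apply (wiener_increment (fun h => chi (t + h)) t (s * t) (C * t ^ S (S q))); [lra|nra|exact h5]]].
  rewrite (Rabs_pos_eq (1 + _)) by lra. rewrite (Rabs_left rho) by lra. fold B.
  replace (s * t * (C * t ^ S (S q) / t)) with (s * (C * t * t ^ S q)) by (simpl; field; lra).
  replace ((1 + rho * INR (S q) * t ^ q) * (s * t) + - rho * (B * s ^ 2 * t ^ S q) + s * (C * t * t ^ S q))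
    with (s * (t + (rho * INR (S q) - rho * (B * s) + C * t) * t ^ S q)) by (simpl; ring).
  apply Rmult_le_compat_l; [lra|].
  (* The lower bound for [Q t]. It suffices because [q + 1 >= 2], and [2 rho] plus two losses of at
     most [|rho| / 2] each is at most [rho]. *)
  apply Rle_trans with (t + (rho - C' * t) * t ^ S q); [|lra].
  apply Rplus_le_compat_l, Rmult_le_compat_r; [lra|].
  assert (INR (S q) >= 2) by (apply Rle_ge, (le_INR 2); lia).
  assert (B * s <= / 2) by nra. nra.
Qed.

(** The constant depends only on [n] and [e]; the rest of [K] affects only how small [t] must be.
    Hence a Lipschitz constant for [f] can be fixed before the curve is given. *)
Lemma germ_recenter_leading (K : R -> R) (n : nat) (e : R) :
  analytic_germ K -> leading n e K ->
  near0 (fun t => forall s, 0 < s <= 1 ->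
    wiener (fun h => K (t + h)) (s * t) ((2 ^ n * Rabs e + 1) * t ^ n)).
Proof.
  intros HK HL.
  destruct (germ_recenter (fun t => K t - e * t ^ n) (S n)) as (C & HC & H).
  - apply analytic_germ_minus; auto. apply analytic_germ_scal, analytic_germ_pow.
  - exact HL.
  - assert (D : 0 < / (C + 1)) by (apply Rinv_0_lt_compat; lra).
    generalize (near0_and _ _ (near0_lt _ D) H). apply near0_imp. intros t Ht [Ht' HW] s Hs.
    assert (Hst : 0 < s * t <= t) by nra.
    apply wiener_ext with (fun h => e * (t + h) ^ n + (K (t + h) - e * (t + h) ^ n));
      [intros; ring|].
    assert (P0 : 0 < t ^ n) by now apply pow_lt.
    eapply wiener_le; [|apply wiener_plus; [lra|apply wiener_scal|apply HW; auto]].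
    2:{ apply (wiener_pow (fun h => t + h) (s * t) (2 * t)); [lra|].
        apply wiener_le with (Rabs t + s * t); [rewrite Rabs_pos_eq; lra|].
        apply wiener_plus; [lra|apply wiener_const; lra|apply wiener_id; lra]. }
    rewrite Rpow_mult_distr. simpl.
    assert (C * t <= 1).
    { apply Rmult_lt_compat_r with (r := C + 1) in Ht'; [|lra].
      rewrite Rinv_l in Ht' by lra. nra. }
    assert (C * (t * t ^ n) <= 1 * t ^ n); [rewrite <- Rmult_assoc; apply Rmult_le_compat_r; lra|].
    lra.
Qed.

(** One step of [Q] lowers [t^n] by an amount proportional to [n]. This factor is what outweighs the
    fixed constants of the iteration. *)
Lemma leading_pow_decrease (q n : nat) (rho : R) (Q : R -> R) :
  (1 <= q)%nat -> (1 <= n)%nat -> rho < 0 -> leading (S q) rho (fun t => Q t - t) ->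
  near0 (fun t => Q t ^ n + INR n * (- rho / 2) * t ^ (n + q) <= t ^ n).
Proof.
  intros Hq Hn Hrho HL. destruct n as [|n]; [lia|].
  assert (H : leading (S q + n * 1) (INR (S n) * 1 ^ n * rho) (fun t => Q t ^ S n - t ^ S n)).
  { apply (leading_pow_diff 1 (S q) n 1 rho (fun t => t) Q); auto; [apply leading_id|].
    now apply leading_near_id with q rho. }
  destruct H as (C & HC & H).
  assert (HN : 1 <= INR (S n)) by (apply (le_INR 1); lia).
  assert (D : 0 < - rho / (2 * (C + 1))) by (apply Rdiv_lt_0_compat; lra).
  generalize (near0_and _ _ (near0_lt _ D) H). apply near0_imp. intros t Ht [Ht' Hb].
  rewrite pow1 in Hb. apply Rabs_le_between in Hb.
  replace (S q + n * 1)%nat with (S n + q)%nat in Hb by lia.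
  replace (t ^ S (S n + q)) with (t * t ^ (S n + q)) in Hb by reflexivity.
  assert (P0 : 0 < t ^ (S n + q)) by now apply pow_lt.
  assert (C * t <= - rho / 2).
  { apply Rmult_lt_compat_r with (r := 2 * (C + 1)) in Ht'; [|lra].
    unfold Rdiv in Ht'. rewrite Rmult_assoc, Rinv_l in Ht' by lra. nra. }
  assert (C * (t * t ^ (S n + q)) <= (INR (S n) * (- rho / 2)) * t ^ (S n + q)).
  { rewrite <- Rmult_assoc. apply Rmult_le_compat_r; [lra|]. nra. }
  lra.
Qed.

(** * The iteration, its majorants and its limit *)

Fixpoint iterate_pair (c : R) (f : R -> R -> R) (Q K1 K2 : R -> R) (n : nat) : (R -> R) * (R -> R) :=
  match n with
  | O => (K1, K2)
  | S n => let X := iterate_pair c f Q K1 K2 n in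
    (fun t => fst X (Q t) - c * snd X t, fun t => snd X (Q t) - f (fst X t) (snd X t))
  end.

Fixpoint increment_bound (c A L : R) (Q : R -> R) (nu q : nat) (n : nat) : (R -> R) * (R -> R) :=
  match n with
  | O => (fun t => A * t ^ (nu + q), fun t => A * t ^ (nu + 2 * q))
  | S n => let b := increment_bound c A L Q nu q n in
    (fun t => fst b (Q t) + c * snd b t,
     fun t => snd b (Q t) + L * (t ^ (2 * q) * fst b t + t ^ q * snd b t))
  end.

(** The hypothesis makes [(A t^nu, A t^(nu+q))] a supersolution: its value at [Q t] plus the source
    terms fits under its value at [t]. Induction on the number of terms, for all [t] at once, then
    needs no estimate on orbits. *)
Lemma increment_bound_sum (c A L T : R) (Q : R -> R) (nu q : nat) :
  0 <= A -> 0 <= c -> 0 <= L ->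
  (forall t, 0 < t < T -> 0 < Q t < t /\
     A * Q t ^ nu + (A + c * A) * t ^ (nu + q) <= A * t ^ nu /\
     A * Q t ^ (nu + q) + (A + 2 * L * A) * t ^ (nu + 2 * q) <= A * t ^ (nu + q)) ->
  forall n t, 0 < t < T ->
    sum_f_R0 (fun i => fst (increment_bound c A L Q nu q i) t) n <= A * t ^ nu /\
    sum_f_R0 (fun i => snd (increment_bound c A L Q nu q i) t) n <= A * t ^ (nu + q).
Proof.
  intros HA Hc HL H. set (b := increment_bound c A L Q nu q).
  induction n as [|n IH]; intros t Ht; destruct (H t Ht) as (HQ & H1 & H2).
  - simpl.
    assert (0 <= A * Q t ^ nu) by (apply Rmult_le_pos; auto; apply pow_le; lra).
    assert (0 <= A * Q t ^ (nu + q)) by (apply Rmult_le_pos; auto; apply pow_le; lra).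
    assert (0 <= c * A * t ^ (nu + q)) by (repeat apply Rmult_le_pos; auto; apply pow_le; lra).
    assert (0 <= 2 * L * A * t ^ (nu + 2 * q))
      by (repeat apply Rmult_le_pos; auto; try lra; apply pow_le; lra).
    simpl in *. lra.
  - rewrite (decomp_sum (fun i => fst (b i) t) (S n)), (decomp_sum (fun i => snd (b i) t) (S n)) by lia.
    simpl pred. unfold b. cbn [increment_bound fst snd].
    fold b. destruct (IH t Ht) as [I1 I2]. destruct (IH (Q t) ltac:(lra)) as [J1 J2].
    rewrite !plus_sum.
    replace (sum_f_R0 (fun i => c * snd (b i) t) n) with (c * sum_f_R0 (fun i => snd (b i) t) n)
      by (rewrite scal_sum; apply sum_eq; intros; ring).
    replace (sum_f_R0 (fun i => L * (t ^ (2 * q) * fst (b i) t + t ^ q * snd (b i) t)) n)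
      with (L * (t ^ (2 * q) * sum_f_R0 (fun i => fst (b i) t) n +
                 t ^ q * sum_f_R0 (fun i => snd (b i) t) n)).
    2:{ clear. induction n as [|n IH]; [reflexivity|]. rewrite !tech5, <- IH. ring. }
    split.
    + apply Rmult_le_compat_l with (r := c) in I2; [|lra]. lra.
    + apply Rmult_le_compat_l with (r := t ^ (2 * q)) in I1; [|apply pow_le; lra].
      apply Rmult_le_compat_l with (r := t ^ q) in I2; [|apply pow_le; lra].
      replace (t ^ (2 * q) * (A * t ^ nu)) with (A * t ^ (nu + 2 * q)) in I1 by (rewrite pow_add; ring).
      replace (t ^ q * (A * t ^ (nu + q))) with (A * t ^ (nu + 2 * q)) in I2
        by (replace (nu + 2 * q)%nat with (q + (nu + q))%nat by lia; rewrite (pow_add t q); ring).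
      assert (I3 := Rplus_le_compat _ _ _ _ I1 I2).
      apply (Rmult_le_compat_l L) in I3; [|exact HL]. lra.
Qed.

Lemma sum_telescope (x : nat -> R) (n : nat) :
  sum_f_R0 (fun i => x (S i) - x i) n = x (S n) - x 0%nat.
Proof. induction n as [|n IH]; simpl; [ring|]. rewrite IH. ring. Qed.

(** Unlike [sum_f_R0], this has exactly [n] terms, as many as the increments that lead to the n-th
    iterate. *)
Definition partial_sum (x : nat -> R) (n : nat) : R :=
  match n with O => 0 | S n => sum_f_R0 x n end.

Lemma partial_sum_S (x : nat -> R) (n : nat) : partial_sum x (S n) = partial_sum x n + x n.
Proof. destruct n; simpl; ring. Qed.

(** The case [w = m + 2q] of the weighted estimate, with its constants already chosen. *)
Definition lipschitz_at (m q : nat) (C L T : R) (f : R -> R -> R) : Prop :=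
  forall t r X X' Y Y' d1 d2, 0 < t < T -> 0 < r ->
    wiener X r (C * t ^ m) -> wiener X' r (C * t ^ m) ->
    wiener Y r (C * t ^ (m + q)) -> wiener Y' r (C * t ^ (m + q)) ->
    wiener (fun h => X h - X' h) r d1 -> wiener (fun h => Y h - Y' h) r d2 ->
    wiener (fun h => f (X h) (Y h) - f (X' h) (Y' h)) r
      (L * (t ^ (2 * q) * d1 + t ^ q * d2)).

Lemma lipschitz_at_pointwise (m q : nat) (C L T : R) (f : R -> R -> R) (t x x' y y' : R) :
  lipschitz_at m q C L T f -> 0 < t < T ->
  Rabs x <= C * t ^ m -> Rabs x' <= C * t ^ m ->
  Rabs y <= C * t ^ (m + q) -> Rabs y' <= C * t ^ (m + q) ->
  Rabs (f x y - f x' y') <= L * (t ^ (2 * q) * Rabs (x - x') + t ^ q * Rabs (y - y')).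
Proof.
  intros H Ht Hx Hx' Hy Hy'.
  assert (Hc : forall z B, Rabs z <= B -> wiener (fun _ => z) 1 B).
  { intros z B Hz. apply wiener_le with (Rabs z); [exact Hz|apply wiener_const; lra]. }
  apply (wiener_value (fun _ => f x y - f x' y') 1 _ 0); [|rewrite Rabs_R0; lra].
  apply (H t 1 (fun _ => x) (fun _ => x') (fun _ => y) (fun _ => y')); auto; try lra.
  - apply (Hc (x - x')); lra.
  - apply (Hc (y - y')); lra.
Qed.

(* Discs of radius [s t] around [t] are mapped into the disc of radius
   [s (Q t)] around [Q t], so the bounds on increments at [t] and at [Q t]
   satisfy the recursion defining [increment_bound]. *)
Lemma iterate_pair_bounds (m nu q : nat) (c s A L T B : R) (f : R -> R -> R) (Q K1 K2 : R -> R) :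
  0 <= A -> 0 <= c -> 0 <= L -> 0 < s ->
  lipschitz_at m q (B + 1) L T f ->
  (forall t, 0 < t < T -> 0 < Q t < t /\
     A * Q t ^ nu + (A + c * A) * t ^ (nu + q) <= A * t ^ nu /\
     A * Q t ^ (nu + q) + (A + 2 * L * A) * t ^ (nu + 2 * q) <= A * t ^ (nu + q)) ->
  (forall t, 0 < t < T -> A * t ^ nu <= t ^ m /\ A * t ^ (nu + q) <= t ^ (m + q)) ->
  (forall t, 0 < t < T -> wiener (fun h => Q (t + h) - Q t) (s * t) (s * Q t) /\
     wiener (fun h => K1 (t + h)) (s * t) (B * t ^ m) /\
     wiener (fun h => K2 (t + h)) (s * t) (B * t ^ (m + q)) /\
     wiener (fun h => K1 (Q (t + h)) - c * K2 (t + h) - K1 (t + h)) (s * t) (A * t ^ (nu + q)) /\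
     wiener (fun h => K2 (Q (t + h)) - f (K1 (t + h)) (K2 (t + h)) - K2 (t + h)) (s * t)
       (A * t ^ (nu + 2 * q))) ->
  let X n := iterate_pair c f Q K1 K2 n in
  let b n := increment_bound c A L Q nu q n in
  forall n t, 0 < t < T ->
    wiener (fun h => fst (X n) (t + h)) (s * t) ((B + 1) * t ^ m) /\
    wiener (fun h => snd (X n) (t + h)) (s * t) ((B + 1) * t ^ (m + q)) /\
    wiener (fun h => fst (X (S n)) (t + h) - fst (X n) (t + h)) (s * t) (fst (b n) t) /\
    wiener (fun h => snd (X (S n)) (t + h) - snd (X n) (t + h)) (s * t) (snd (b n) t).
Proof.
  intros HA Hc HL Hs Hf HQ HAB HW X b.
  pose proof (increment_bound_sum c A L T Q nu q HA Hc HL HQ) as Hsum. fold b in Hsum.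
  assert (Hpart : forall n t, 0 < t < T ->
    partial_sum (fun i => fst (b i) t) n <= t ^ m /\ partial_sum (fun i => snd (b i) t) n <= t ^ (m + q)).
  { intros [|n] t Ht; simpl.
    - split; apply pow_le; lra.
    - destruct (Hsum n t Ht), (HAB t Ht). split; eapply Rle_trans; eauto. }
  (* The induction carries the exact partial sums of the majorants: the bound [B + 1] alone would
     not reproduce itself. *)
  assert (H : forall n t, 0 < t < T ->
    wiener (fun h => fst (X n) (t + h)) (s * t) (B * t ^ m + partial_sum (fun i => fst (b i) t) n) /\
    wiener (fun h => snd (X n) (t + h)) (s * t) (B * t ^ (m + q) + partial_sum (fun i => snd (b i) t) n) /\
    wiener (fun h => fst (X (S n)) (t + h) - fst (X n) (t + h)) (s * t) (fst (b n) t) /\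
    wiener (fun h => snd (X (S n)) (t + h) - snd (X n) (t + h)) (s * t) (snd (b n) t)).
  { induction n as [|n IH]; intros t Ht.
    - destruct (HW t Ht) as (_ & W1 & W2 & W3 & W4). simpl. rewrite !Rplus_0_r. auto.
    - destruct (IH t Ht) as (W1 & W2 & W3 & W4).
      destruct (HQ t Ht) as (HQt & _).
      destruct (IH (Q t) ltac:(lra)) as (_ & _ & V3 & V4).
      destruct (HW t Ht) as (WQ & _).
      assert (Hst : 0 < s * t) by nra.
      rewrite !partial_sum_S, <- !Rplus_assoc.
      assert (W1' : wiener (fun h => fst (X (S n)) (t + h)) (s * t)
        (B * t ^ m + partial_sum (fun i => fst (b i) t) n + fst (b n) t)).
      { eapply wiener_ext; [|apply (wiener_plus _ _ _ _ _ (Rlt_le _ _ Hst) W1 W3)].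
        intros; simpl; ring. }
      assert (W2' : wiener (fun h => snd (X (S n)) (t + h)) (s * t)
        (B * t ^ (m + q) + partial_sum (fun i => snd (b i) t) n + snd (b n) t)).
      { eapply wiener_ext; [|apply (wiener_plus _ _ _ _ _ (Rlt_le _ _ Hst) W2 W4)].
        intros; simpl; ring. }
      destruct (Hpart n t Ht) as [P1 P2]. destruct (Hpart (S n) t Ht) as [P3 P4].
      rewrite partial_sum_S in P3, P4.
      assert (V3' := wiener_comp _ _ _ _ _ Hst V3 WQ).
      assert (V4' := wiener_comp _ _ _ _ _ Hst V4 WQ).
      split; [exact W1'|]. split; [exact W2'|]. split.
      + apply wiener_ext with (fun h => (fst (X (S n)) (Q (t + h)) - fst (X n) (Q (t + h))) -
          c * (snd (X (S n)) (t + h) - snd (X n) (t + h))).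
        { intros h _. change (X (S (S n))) with
            (fun t => fst (X (S n)) (Q t) - c * snd (X (S n)) t,
             fun t => snd (X (S n)) (Q t) - f (fst (X (S n)) t) (snd (X (S n)) t)).
          cbn [fst]. change (fst (X (S n)) (t + h)) with (fst (X n) (Q (t + h)) - c * snd (X n) (t + h)).
          ring. }
        change (fst (b (S n)) t) with (fst (b n) (Q t) + c * snd (b n) t).
        apply wiener_minus; [lra| |].
        * eapply wiener_ext; [|exact V3']. intros h _. cbv beta.
          now replace (Q t + (Q (t + h) - Q t)) with (Q (t + h)) by ring.
        * apply wiener_le with (Rabs c * snd (b n) t); [rewrite Rabs_pos_eq; lra|].
          now apply wiener_scal.
      + apply wiener_ext with (fun h => (snd (X (S n)) (Q (t + h)) - snd (X n) (Q (t + h))) -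
          (f (fst (X (S n)) (t + h)) (snd (X (S n)) (t + h)) - f (fst (X n) (t + h)) (snd (X n) (t + h)))).
        { intros h _. change (X (S (S n))) with
            (fun t => fst (X (S n)) (Q t) - c * snd (X (S n)) t,
             fun t => snd (X (S n)) (Q t) - f (fst (X (S n)) t) (snd (X (S n)) t)).
          cbn [snd].
          set (u := f (fst (X (S n)) (t + h)) (snd (X (S n)) (t + h))).
          change (snd (X (S n)) (t + h)) with
            (snd (X n) (Q (t + h)) - f (fst (X n) (t + h)) (snd (X n) (t + h))).
          ring. }
        change (snd (b (S n)) t) with
          (snd (b n) (Q t) + L * (t ^ (2 * q) * fst (b n) t + t ^ q * snd (b n) t)).
        apply wiener_minus; [lra| |].
        * eapply wiener_ext; [|exact V4']. intros h _. cbv beta.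
          now replace (Q t + (Q (t + h) - Q t)) with (Q (t + h)) by ring.
        * apply (Hf t (s * t)); auto.
          -- eapply wiener_le; [|exact W1']. lra.
          -- eapply wiener_le; [|exact W1]. lra.
          -- eapply wiener_le; [|exact W2']. lra.
          -- eapply wiener_le; [|exact W2]. lra. }
  intros n t Ht. destruct (H n t Ht) as (W1 & W2 & W3 & W4).
  destruct (Hpart n t Ht) as [P1 P2].
  repeat split; auto.
  - eapply wiener_le; [|exact W1]; lra.
  - eapply wiener_le; [|exact W2]; lra.
Qed.

Lemma telescoping_limit (x : nat -> R) :
  ex_series (fun n => x (S n) - x n) ->
  is_lim_seq x (x 0%nat + Series (fun n => x (S n) - x n)).
Proof.
  intros H. apply Series_correct, is_series_lim_sum in H.
  apply (is_lim_seq_incr_1 x).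
  apply is_lim_seq_ext with (fun n => x 0%nat + sum_f_R0 (fun n => x (S n) - x n) n).
  - intros n. rewrite sum_telescope. ring.
  - apply is_lim_seq_plus'; [apply is_lim_seq_const|exact H].
Qed.

(** The corrections are the sums of all increments, and invariance is the limit of the recursion.
    Passing to the limit inside [f] uses the Lipschitz estimate, applicable because iterates and
    limit obey the same bounds. *)
Lemma iterate_pair_limit (m nu q : nat) (c s A L T B : R) (f : R -> R -> R) (Q K1 K2 : R -> R) :
  0 <= A -> 0 <= c -> 0 <= L -> 0 < s ->
  lipschitz_at m q (B + 1) L T f ->
  (forall t, 0 < t < T -> 0 < Q t < t /\
     A * Q t ^ nu + (A + c * A) * t ^ (nu + q) <= A * t ^ nu /\
     A * Q t ^ (nu + q) + (A + 2 * L * A) * t ^ (nu + 2 * q) <= A * t ^ (nu + q)) ->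
  (forall t, 0 < t < T -> A * t ^ nu <= t ^ m /\ A * t ^ (nu + q) <= t ^ (m + q)) ->
  (forall t, 0 < t < T -> wiener (fun h => Q (t + h) - Q t) (s * t) (s * Q t) /\
     wiener (fun h => K1 (t + h)) (s * t) (B * t ^ m) /\
     wiener (fun h => K2 (t + h)) (s * t) (B * t ^ (m + q)) /\
     wiener (fun h => K1 (Q (t + h)) - c * K2 (t + h) - K1 (t + h)) (s * t) (A * t ^ (nu + q)) /\
     wiener (fun h => K2 (Q (t + h)) - f (K1 (t + h)) (K2 (t + h)) - K2 (t + h)) (s * t)
       (A * t ^ (nu + 2 * q))) ->
  K1 0 = 0 -> K2 0 = 0 -> Q 0 = 0 -> f 0 0 = 0 ->
  exists D1 D2 : R -> R, D1 0 = 0 /\ D2 0 = 0 /\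
    forall t, 0 < t < T ->
      wiener (fun h => D1 (t + h)) (s * t) (A * t ^ nu) /\
      wiener (fun h => D2 (t + h)) (s * t) (A * t ^ (nu + q)) /\
      (K1 t + D1 t) + c * (K2 t + D2 t) = K1 (Q t) + D1 (Q t) /\
      (K2 t + D2 t) + f (K1 t + D1 t) (K2 t + D2 t) = K2 (Q t) + D2 (Q t).
Proof.
  intros HA Hc HL Hs Hf HQ HAB HW Z1 Z2 ZQ Zf.
  pose proof (iterate_pair_bounds m nu q c s A L T B f Q K1 K2 HA Hc HL Hs Hf HQ HAB HW) as Hb.
  pose proof (increment_bound_sum c A L T Q nu q HA Hc HL HQ) as Hsum.
  set (X := fun n => iterate_pair c f Q K1 K2 n) in *.
  set (b := fun n => increment_bound c A L Q nu q n) in *.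
  assert (ZX : forall n, fst (X n) 0 = 0 /\ snd (X n) 0 = 0).
  { induction n as [|n [I1 I2]]; [split; auto|]. simpl.
    change (iterate_pair c f Q K1 K2 n) with (X n). rewrite ZQ, I1, I2, Zf. split; ring. }
  set (D1 := fun t => Series (fun n => fst (X (S n)) t - fst (X n) t)).
  set (D2 := fun t => Series (fun n => snd (X (S n)) t - snd (X n) t)).
  assert (W : forall t, 0 < t < T ->
      wiener (fun h => D1 (t + h)) (s * t) (A * t ^ nu) /\
      wiener (fun h => D2 (t + h)) (s * t) (A * t ^ (nu + q))).
  { intros t Ht. split.
    - apply (wiener_Series (fun n h => fst (X (S n)) (t + h) - fst (X n) (t + h)) (s * t)
        (fun n => fst (b n) t)); [nra|intros n; now apply Hb|intros n; now apply Hsum].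
    - apply (wiener_Series (fun n h => snd (X (S n)) (t + h) - snd (X n) (t + h)) (s * t)
        (fun n => snd (b n) t)); [nra|intros n; now apply Hb|intros n; now apply Hsum]. }
  assert (Hval : forall t phi M, 0 < t -> wiener (fun h => phi (t + h)) (s * t) M -> Rabs (phi t) <= M).
  { intros t phi M Ht H. replace (phi t) with (phi (t + 0)) by (f_equal; ring).
    apply (wiener_value (fun h => phi (t + h)) (s * t)); auto. rewrite Rabs_R0; nra. }
  assert (Hlim : forall t, 0 < t < T ->
    is_lim_seq (fun n => fst (X n) t) (K1 t + D1 t) /\ is_lim_seq (fun n => snd (X n) t) (K2 t + D2 t)).
  { intros t Ht. split.
    - apply (telescoping_limit (fun n => fst (X n) t)), ex_series_Rabs.
      apply ex_series_nonneg_bounded with (A * t ^ nu); [intros; apply Rabs_pos|].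
      intros n. eapply Rle_trans; [|apply (Hsum n t Ht)]. apply sum_Rle. intros i _.
      apply (Hval t (fun t => fst (X (S i)) t - fst (X i) t)); [lra|now apply Hb].
    - apply (telescoping_limit (fun n => snd (X n) t)), ex_series_Rabs.
      apply ex_series_nonneg_bounded with (A * t ^ (nu + q)); [intros; apply Rabs_pos|].
      intros n. eapply Rle_trans; [|apply (Hsum n t Ht)]. apply sum_Rle. intros i _.
      apply (Hval t (fun t => snd (X (S i)) t - snd (X i) t)); [lra|now apply Hb]. }
  exists D1, D2. split; [|split].
  (* No disc covers [t = 0]; there all iterates vanish. *)
  - unfold D1. apply is_series_unique. eapply is_series_ext; [|apply (is_series_unit 0 0)].
    intros n. cbv beta. rewrite !(proj1 (ZX _)). destruct (Nat.eqb n 0); symmetry; apply Rminus_diag_eq; reflexivity.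
  - unfold D2. apply is_series_unique. eapply is_series_ext; [|apply (is_series_unit 0 0)].
    intros n. cbv beta. rewrite !(proj2 (ZX _)). destruct (Nat.eqb n 0); symmetry; apply Rminus_diag_eq; reflexivity.
  - intros t Ht. destruct (W t Ht) as [W1 W2]. split; auto. split; auto.
    destruct (HQ t Ht) as (HQt & _).
    destruct (Hlim t Ht) as [l1 l2]. destruct (Hlim (Q t) ltac:(lra)) as [l3 l4].
    split.
    + assert (E : is_lim_seq (fun n => fst (X (S n)) t) (K1 (Q t) + D1 (Q t) - c * (K2 t + D2 t))).
      { apply (is_lim_seq_minus' (fun n => fst (X n) (Q t)) (fun n => c * snd (X n) t)); auto.
        apply (is_lim_seq_scal_l _ c (Finite _)) in l2. exact l2. }
      apply (is_lim_seq_incr_1 (fun n => fst (X n) t)) in l1.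
      apply is_lim_seq_unique in l1. apply is_lim_seq_unique in E. rewrite E in l1.
      injection l1. lra.
    + destruct (HW t Ht) as (_ & V1 & V2 & _). destruct (HAB t Ht) as [a1 a2].
      assert (B1 : Rabs (K1 t + D1 t) <= (B + 1) * t ^ m).
      { eapply Rle_trans; [apply Rabs_triang|].
        pose proof (Hval t K1 _ (proj1 Ht) V1). pose proof (Hval t D1 _ (proj1 Ht) W1). lra. }
      assert (B2 : Rabs (K2 t + D2 t) <= (B + 1) * t ^ (m + q)).
      { eapply Rle_trans; [apply Rabs_triang|].
        pose proof (Hval t K2 _ (proj1 Ht) V2). pose proof (Hval t D2 _ (proj1 Ht) W2). lra. }
      assert (Ef : is_lim_seq (fun n => f (fst (X n) t) (snd (X n) t)) (f (K1 t + D1 t) (K2 t + D2 t))).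
      { assert (E0 : is_lim_seq (fun n => f (fst (X n) t) (snd (X n) t) - f (K1 t + D1 t) (K2 t + D2 t)) 0).
        { apply is_lim_seq_abs_0.
          apply is_lim_seq_le_le with (fun _ => 0) (fun n => L * (t ^ (2 * q) * Rabs (fst (X n) t - (K1 t + D1 t)) +
            t ^ q * Rabs (snd (X n) t - (K2 t + D2 t)))).
          - intros n. split; [apply Rabs_pos|]. destruct (Hb n t Ht) as (b1 & b2 & _).
            apply (lipschitz_at_pointwise m q (B + 1) L T); auto.
            + now apply (Hval t (fst (X n))).
            + now apply (Hval t (snd (X n))).
          - apply is_lim_seq_const.
          - assert (Habs : forall x l, is_lim_seq x (Finite l) -> is_lim_seq (fun n => Rabs (x n - l)) 0).
            { intros x l Hx. apply (is_lim_seq_abs_0 (fun n => x n - l)).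
              replace (Finite 0) with (Finite (l - l)) by (f_equal; ring).
              apply is_lim_seq_minus'; [exact Hx|apply is_lim_seq_const]. }
            apply Habs in l1. apply Habs in l2.
            apply (is_lim_seq_scal_l _ (t ^ (2 * q)) (Finite _)) in l1.
            apply (is_lim_seq_scal_l _ (t ^ q) (Finite _)) in l2.
            assert (l5 := is_lim_seq_plus' _ _ _ _ l1 l2).
            apply (is_lim_seq_scal_l _ L (Finite _)) in l5.
            simpl in l5. replace (L * (t ^ (q + (q + 0)) * 0 + t ^ q * 0)) with 0 in l5 by ring. exact l5. }
        apply is_lim_seq_ext with (fun n => (f (fst (X n) t) (snd (X n) t) - f (K1 t + D1 t) (K2 t + D2 t))
          + f (K1 t + D1 t) (K2 t + D2 t)); [intros; ring|].
        replace (Finite (f (K1 t + D1 t) (K2 t + D2 t)))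
          with (Finite (0 + f (K1 t + D1 t) (K2 t + D2 t))) by (f_equal; ring).
        apply is_lim_seq_plus'; [exact E0|apply is_lim_seq_const]. }
      assert (E := is_lim_seq_minus' _ _ _ _ l4 Ef).
      apply (is_lim_seq_incr_1 (fun n => snd (X n) t)) in l2.
      apply is_lim_seq_unique in l2. apply is_lim_seq_unique in E.
      assert (EE : Finite (K2 t + D2 t) =
        Finite (K2 (Q t) + D2 (Q t) - f (K1 t + D1 t) (K2 t + D2 t))).
      { rewrite <- l2, <- E. reflexivity. }
      injection EE. lra.
Qed.

Lemma invariant_curve_exists (m q i0 i1 : nat) (A B c rho kappa : R) (f : R -> R -> R) :
  (1 <= m)%nat -> (1 <= q)%nat -> 0 < c -> rho < 0 -> weighted_form m q i0 i1 A B f ->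
  exists nu0 : nat, forall nu K1 K2 Q, (nu0 <= nu)%nat -> (m < nu)%nat ->
    approx_invariant m q nu c rho kappa f K1 K2 Q ->
    exists s T C D1 D2, 0 < s <= 1 /\ 0 < T /\ D1 0 = 0 /\ D2 0 = 0 /\
      forall t, 0 < t < T -> 0 < Q t < t /\
        wiener (fun h => K1 (t + h)) (s * t) (C * t ^ m) /\
        wiener (fun h => K2 (t + h)) (s * t) (C * t ^ (m + q)) /\
        wiener (fun h => D1 (t + h)) (s * t) (C * t ^ nu) /\
        wiener (fun h => D2 (t + h)) (s * t) (C * t ^ (nu + q)) /\
        (K1 t + D1 t) + c * (K2 t + D2 t) = K1 (Q t) + D1 (Q t) /\
        (K2 t + D2 t) + f (K1 t + D1 t) (K2 t + D2 t) = K2 (Q t) + D2 (Q t).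
Proof.
  intros Hm Hq Hc Hrho Hf.
  pose proof (weighted_form_lipschitz _ _ _ _ _ _ _ Hm Hf) as HfL.
  destruct Hf as (_ & _ & _ & Zf & _).
  (* Dominates both [2^m + 1] and [2^(m+q) |kappa| + 1], the constants for the two components. *)
  set (B0 := 2 ^ (m + q) * (1 + Rabs kappa) + 1).
  assert (H2 : 1 <= 2 ^ (m + q)) by (apply pow_R1_Rle; lra).
  assert (Hka := Rabs_pos kappa).
  assert (HB0 : 0 <= B0) by (unfold B0; nra).
  destruct (HfL (B0 + 1) ltac:(lra)) as (L & tau & HL & Htau & HLip).
  replace (m + 2 * q - m)%nat with (2 * q)%nat in HLip by lia.
  replace (m + 2 * q - (m + q))%nat with q in HLip by lia.
  (* For [nu >= nu0] the gain [nu |rho| / 2] is at least [1 + c + 2 L], enough for both inequalities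
     of the supersolution. *)
  destruct (INR_unbounded ((1 + c + 2 * L) / (- rho / 2))) as [nu0 Hnu0].
  exists nu0. intros nu K1 K2 Q Hnu Hmnu ((G1 & G2 & G3) & L1 & L2 & L3 & E1 & E2).
  assert (Hbig : forall n, (nu0 <= n)%nat -> 1 + c + 2 * L <= INR n * (- rho / 2)).
  { intros n Hn. apply le_INR in Hn.
    apply Rmult_gt_compat_r with (r := - rho / 2) in Hnu0; [|lra].
    unfold Rdiv in Hnu0 at 2. rewrite Rmult_assoc, Rinv_l, Rmult_1_r in Hnu0 by lra. nra. }
  assert (LQ := leading_near_id q rho Q Hq L3).
  assert (Z1 : K1 0 = 0).
  { apply (germ_ordO_zero K1 (m - 1)); auto. replace (S (m - 1)) with m by lia.
    now apply leading_ordO with 1. }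
  assert (Z2 : K2 0 = 0).
  { apply (germ_ordO_zero K2 (m + q - 1)); auto. replace (S (m + q - 1)) with (m + q)%nat by lia.
    now apply leading_ordO with kappa. }
  assert (Z3 : Q 0 = 0).
  { apply (germ_ordO_zero Q 0); auto. now apply leading_ordO with 1. }
  destruct (contracting_disc q rho Q Hq Hrho G3 L3) as (s & Hs & N1).
  destruct (germ_recenter (fun t => K1 (Q t) - c * K2 t - K1 t) (nu + q)) as (e1 & He1 & N2).
  { apply analytic_germ_minus; [apply analytic_germ_minus|]; auto.
    - now apply analytic_germ_comp.
    - now apply analytic_germ_scal. }
  (* The first increment of the iteration is minus the invariance error. *)
  { apply ordO_scal with (c := -1) in E1. revert E1. apply ordO_ext. intros; ring. }
  destruct (germ_recenter (fun t => K2 (Q t) - f (K1 t) (K2 t) - K2 t) (nu + 2 * q)) as (e2 & He2 & N3).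
  { apply analytic_germ_minus; [apply analytic_germ_minus|]; auto.
    - now apply analytic_germ_comp.
    - now apply weighted_lipschitz_germ with m (m + q)%nat (m + 2 * q)%nat. }
  { apply ordO_scal with (c := -1) in E2. revert E2. apply ordO_ext. intros; ring. }
  pose proof (germ_recenter_leading K1 m 1 G1 L1) as N4.
  pose proof (germ_recenter_leading K2 (m + q) kappa G2 L2) as N5.
  pose proof (leading_pow_decrease q nu rho Q Hq ltac:(lia) Hrho L3) as N6.
  pose proof (leading_pow_decrease q (nu + q) rho Q Hq ltac:(lia) Hrho L3) as N7.
  set (A0 := e1 + e2).
  assert (HA0 : 0 <= A0) by (unfold A0; lra).
  assert (D : 0 < / (A0 + 1)) by (apply Rinv_0_lt_compat; lra).
  destruct (near0_and _ _ (near0_and _ _ (near0_and _ _ N1 N2) (near0_and _ _ N3 N4))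
    (near0_and _ _ (near0_and _ _ N5 (near0_and _ _ N6 N7))
      (near0_and _ _ (near0_lt _ D) (near0_lt tau (proj1 Htau))))) as (T & HT & H).
  assert (HAT : forall t n n', 0 < t < T -> (n < n')%nat -> A0 * t ^ n' <= t ^ n).
  { intros t n n' Ht Hn. destruct (H t Ht) as (_ & _ & ht & ht').
    apply Rle_trans with (A0 * (t * t ^ n)).
    - apply Rmult_le_compat_l; auto. change (t * t ^ n) with (t ^ S n).
      apply pow_decr_exp; [lra|lia].
    - rewrite <- Rmult_assoc. rewrite <- (Rmult_1_l (t ^ n)) at 2.
      apply Rmult_le_compat_r; [apply pow_le; lra|].
      apply Rmult_lt_compat_r with (r := A0 + 1) in ht; [|lra].
      rewrite Rinv_l in ht by lra. nra. }
  assert (HBm : (2 ^ m * Rabs 1 + 1) <= B0).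
  { unfold B0. rewrite Rabs_R1.
    assert (2 ^ m <= 2 ^ (m + q)) by (apply Rle_pow; [lra|lia]). nra. }
  destruct (iterate_pair_limit m nu q c s A0 L T B0 f Q K1 K2)
    as (D1 & D2 & Y1 & Y2 & HD); auto; try lra.
  - intros t r X X' Y Y' d1 d2 Ht Hr.
    apply HLip; auto. destruct (H t Ht) as (_ & _ & _ & h). lra.
  - intros t Ht. destruct (H t Ht) as (((h1 & _) & _) & (_ & h6 & h7) & _).
    split; [apply h1|].
    assert (P1 : 0 < t ^ (nu + q)) by (apply pow_lt; lra).
    assert (P2 : 0 < t ^ (nu + 2 * q)) by (apply pow_lt; lra).
    replace (nu + q + q)%nat with (nu + 2 * q)%nat in h7 by lia.
    pose proof (Hbig nu Hnu) as b1. pose proof (Hbig (nu + q)%nat ltac:(lia)) as b2.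
    split.
    + assert (Q t ^ nu + (1 + c) * t ^ (nu + q) <= t ^ nu) by nra.
      apply Rmult_le_compat_l with (r := A0) in H0; auto. lra.
    + assert (Q t ^ (nu + q) + (1 + 2 * L) * t ^ (nu + 2 * q) <= t ^ (nu + q)) by nra.
      apply Rmult_le_compat_l with (r := A0) in H0; auto. lra.
  - intros t Ht. split; apply HAT; auto; lia.
  - intros t Ht. destruct (H t Ht) as (((h1 & h2) & h3 & h4) & (h5 & _) & _).
    assert (P : forall n, 0 <= t ^ n) by (intros; apply pow_le; lra).
    split; [apply h1|].
    split; [eapply wiener_le; [|apply (h4 s Hs)]; apply Rmult_le_compat_r; auto|].
    split; [eapply wiener_le; [|apply (h5 s Hs)]; apply Rmult_le_compat_r; auto; unfold B0; nra|].
    split; (eapply wiener_le; [|apply (h2 s Hs) || apply (h3 s Hs)]);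
      (apply Rmult_le_compat_r; [auto|unfold A0; lra]).
  - exists s, T, (B0 + A0), D1, D2. split; [exact Hs|]. split; auto. split; auto. split; auto.
    intros t Ht. destruct (H t Ht) as (((h1 & h2) & h3 & h4) & (h5 & _) & _).
    destruct (HD t Ht) as (d1 & d2 & d3 & d4).
    assert (P : forall n, 0 <= t ^ n) by (intros; apply pow_le; lra).
    split; [apply h1|].
    split; [eapply wiener_le; [|apply (h4 s Hs)]; apply Rmult_le_compat_r; auto; lra|].
    split; [eapply wiener_le; [|apply (h5 s Hs)]; apply Rmult_le_compat_r; auto; unfold B0; nra|].
    split; [eapply wiener_le; [|exact d1]; apply Rmult_le_compat_r; auto; lra|].
    split; [eapply wiener_le; [|exact d2]; apply Rmult_le_compat_r; auto; lra|].
    auto.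
Qed.

(** * Regularity *)

(** Cauchy's estimate: the derivative at the centre is the first coefficient, whose product with [r]
    is one term of the norm. *)
Lemma wiener_derivative (phi : R -> R) (t r M : R) : 0 < r ->
  wiener (fun h => phi (t + h)) r M ->
  is_derive phi t (Derive phi t) /\ Rabs (Derive phi t) <= M / r /\ continuous (Derive phi) t.
Proof.
  intros Hr (a & Ha & Hs).
  assert (Hterm : forall n, Rabs (a n) * r ^ n <= M).
  { intros n. eapply Rle_trans; [|apply (Ha n)]. destruct n; simpl; [lra|].
    assert (0 <= sum_f_R0 (fun j => Rabs (a j) * r ^ j) n); [|simpl in *; lra].
    apply cond_pos_sum; intros; apply Rmult_le_pos; [apply Rabs_pos|apply pow_le; lra]. }
  assert (Hcv : Rbar_le r (CV_radius a)).
  { apply (proj1 (CV_radius_bounded a)). exists M. intros n.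
    rewrite Rabs_mult, (Rabs_pos_eq (r ^ n)) by (apply pow_le; lra). apply Hterm. }
  assert (Hin : forall x, Rabs x < r -> Rbar_lt (Rabs x) (CV_radius a)).
  { intros x Hx. apply Rbar_lt_le_trans with r; auto. }
  assert (E : forall y, Rabs (y - t) < r -> PSeries a (y - t) = phi y).
  { intros y Hy. unfold PSeries. apply is_series_unique.
    replace (phi y) with (phi (t + (y - t))) by (f_equal; ring). apply Hs; lra. }
  assert (Hloc : forall y, Rabs (y - t) < r -> locally y (fun z => Rabs (z - t) < r)).
  { intros y Hy. assert (Hd : 0 < r - Rabs (y - t)) by lra. exists (mkposreal _ Hd).
    intros z Hz. change (Rabs (z - y) < r - Rabs (y - t)) in Hz.
    replace (z - t) with ((z - y) + (y - t)) by ring.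
    eapply Rle_lt_trans; [apply Rabs_triang|lra]. }
  assert (Hder : forall y, Rabs (y - t) < r -> is_derive phi y (PSeries (PS_derive a) (y - t))).
  { intros y Hy. apply is_derive_ext_loc with (fun z => PSeries a (z - t)).
    - generalize (Hloc y Hy). apply filter_imp. intros z; apply E.
    - replace (PSeries (PS_derive a) (y - t)) with (1 * PSeries (PS_derive a) (y - t)) by ring.
      apply (is_derive_comp (PSeries a) (fun z => z - t)).
      + apply is_derive_PSeries, Hin, Hy.
      + auto_derive; auto; ring. }
  assert (Ht : Rabs (t - t) < r) by (rewrite Rminus_diag, Rabs_R0; exact Hr).
  assert (E1 : Derive phi t = a 1%nat).
  { rewrite (is_derive_unique _ _ _ (Hder t Ht)), Rminus_diag, PSeries_0.
    unfold PS_derive. simpl. ring. }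
  split; [|split].
  - rewrite (is_derive_unique _ _ _ (Hder t Ht)). now apply Hder.
  - rewrite E1. apply Rmult_le_reg_r with r; auto.
    unfold Rdiv; rewrite Rmult_assoc, Rinv_l, Rmult_1_r by lra.
    specialize (Hterm 1%nat). now rewrite pow_1 in Hterm.
  - apply continuous_ext_loc with (fun y => PSeries (PS_derive a) (y - t)).
    + generalize (Hloc t Ht). apply filter_imp. intros y Hy.
      symmetry. apply is_derive_unique, Hder, Hy.
    + apply (continuous_comp (fun y => y - t) (PSeries (PS_derive a))).
      * apply (continuous_minus (V := R_NormedModule)); [apply continuous_id|apply continuous_const].
      * apply continuity_pt_filterlim, PSeries_continuity.
        rewrite CV_radius_derive. apply Hin, Ht.
Qed.

Lemma filterdiff_within (D : R -> Prop) (f : R -> R) (t d : R) : D t ->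
  (forall eps, 0 < eps ->
     locally t (fun y => D y -> Rabs (f y - f t - (y - t) * d) <= eps * Rabs (y - t))) ->
  filterdiff f (within D (locally t)) (fun h => scal h d).
Proof.
  intros HD H. split; [exact (is_linear_scal_l (K := R_AbsRing) (V := R_NormedModule) d)|].
  intros x Hx.
  (* [filterdiff] speaks of every limit of the filter. By separation [t] is the only one, the filter
     being proper since [t] lies in [D]. *)
  assert (x = t).
  { destruct (Req_dec x t) as [|Hne]; auto. exfalso.
    assert (Hd : 0 < Rabs (t - x)) by (apply Rabs_pos_lt; lra).
    assert (Hl : locally x (fun y => Rabs (y - x) < Rabs (t - x))).
    { exists (mkposreal _ Hd). intros y Hy. exact Hy. }
    apply Hx in Hl. unfold within in Hl. apply locally_singleton in Hl.
    specialize (Hl HD). lra. }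
  subst x. intros eps. generalize (H eps (cond_pos eps)). unfold within. apply filter_imp.
  intros y Hy HDy. exact (Hy HDy).
Qed.

Lemma is_derive_C1_point (D : R -> Prop) (f : R -> R) (t : R) :
  is_derive f t (Derive f t) -> continuous (Derive f) t -> D t ->
  filterdiff f (within D (locally t)) (fun h => scal h (Derive f t)) /\
  filterlim (Derive f) (within D (locally t)) (locally (Derive f t)).
Proof.
  intros Hd Hc HD. split.
  - apply filterdiff_within; auto. intros eps Heps.
    destruct Hd as [_ Hd]. specialize (Hd t (fun P HP => HP) (mkposreal eps Heps)).
    revert Hd. apply filter_imp. intros y Hy _. exact Hy.
  - intros P HP. unfold filtermap, within. generalize (Hc P HP). unfold filtermap.
    apply filter_imp. auto.
Qed.

Lemma C1_on_plus (D : R -> Prop) (f g : R -> R) :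
  C1_on D f -> C1_on D g -> C1_on D (fun t => f t + g t).
Proof.
  intros [f' Hf] [g' Hg]. exists (fun t => f' t + g' t). intros t Ht.
  destruct (Hf t Ht) as [H1 H2]. destruct (Hg t Ht) as [H3 H4]. split.
  - eapply filterdiff_ext_lin; [apply (filterdiff_plus_fct _ _ _ _ H1 H3)|].
    intros y. unfold plus, scal; simpl. unfold mult; simpl. ring.
  - apply (filterlim_comp_2 _ _ _ H2 H4 (filterlim_plus (V := R_NormedModule) (f' t) (g' t))).
Qed.

Lemma C1_on_germ (r M T : R) (f : R -> R) : T <= r -> wiener f r M ->
  C1_on (fun t => 0 <= t < T) f.
Proof.
  intros HT H. exists (Derive f). intros t Ht.
  assert (Hr : 0 < r - t) by lra.
  destruct (wiener_derivative f t (r - t) M Hr) as (H1 & _ & H3).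
  - apply wiener_recenter with r; auto. rewrite Rabs_pos_eq; lra.
  - now apply is_derive_C1_point.
Qed.

(* The discs of radius [s t] turn the bound [C t ^ (n + 2)] on [f] into the
   bound [(C / s) t ^ (n + 1)] on its derivative, so [f] extends by [0]. *)
Lemma C1_on_flat (s T C : R) (n : nat) (f : R -> R) : 0 < s -> f 0 = 0 ->
  (forall t, 0 < t < T -> wiener (fun h => f (t + h)) (s * t) (C * t ^ (S (S n)))) ->
  C1_on (fun t => 0 <= t < T) f.
Proof.
  intros Hs H0 HW.
  (* The values of [f] for [t < 0] are uncontrolled, so the one-sided derivative at 0 is prescribed
     instead of taken from [Derive]. *)
  set (f' := fun t => if Rle_dec t 0 then 0 else Derive f t).
  assert (Hsmall : forall t, 0 < t < T -> t <= 1 -> 0 <= C /\ C * t ^ S (S n) <= C * t * t).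
  { intros t Ht Ht1.
    assert (P0 : 0 < t ^ S (S n)) by (apply pow_lt; lra).
    assert (P1 := wiener_ge0 _ _ _ (HW t Ht)).
    assert (HC : 0 <= C) by nra. split; auto. rewrite Rmult_assoc.
    apply Rmult_le_compat_l; auto. simpl. assert (t ^ n <= 1) by (apply pow_le_1; lra).
    assert (0 <= t ^ n) by (apply pow_le; lra).
    replace (t * (t * t ^ n)) with (t * t * t ^ n) by ring. nra. }
  assert (Hder : forall t, 0 < t < T ->
    is_derive f t (Derive f t) /\ Rabs (Derive f t) <= C * t ^ S (S n) / (s * t) /\
    continuous (Derive f) t).
  { intros t Ht. apply wiener_derivative; [nra|now apply HW]. }
  assert (Hval : forall t, 0 < t < T -> Rabs (f t) <= C * t ^ S (S n)).
  { intros t Ht. replace (f t) with (f (t + 0)) by (f_equal; ring).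
    apply (wiener_value (fun h => f (t + h)) (s * t)); [now apply HW|].
    rewrite Rabs_R0; nra. }
  exists f'. intros t Ht. destruct (Req_dec t 0) as [->|Hne].
  - assert (E0 : f' 0 = 0) by (unfold f'; destruct (Rle_dec 0 0); lra).
    rewrite E0. split.
    + apply filterdiff_within; auto. intros eps Heps.
      assert (HC1 := Rabs_pos C).
      assert (Hd : 0 < Rmin 1 (eps / (Rabs C + 1))).
      { apply Rmin_glb_lt; [lra|]. apply Rdiv_lt_0_compat; lra. }
      exists (mkposreal _ Hd). intros y Hy HyD. change (Rabs (y - 0) < Rmin 1 (eps / (Rabs C + 1))) in Hy.
      rewrite Rminus_0_r in *. rewrite H0, Rminus_0_r, Rmult_0_r, Rminus_0_r.
      rewrite (Rabs_pos_eq y) in * by lra.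
      destruct (Req_dec y 0) as [->|Hy0]; [rewrite H0, Rabs_R0; lra|].
      pose proof (Rmin_l 1 (eps / (Rabs C + 1))). pose proof (Rmin_r 1 (eps / (Rabs C + 1))).
      destruct (Hsmall y ltac:(lra) ltac:(lra)) as [HC Hy2].
      eapply Rle_trans; [apply Hval; lra|]. eapply Rle_trans; [exact Hy2|].
      apply Rmult_le_compat_r; [lra|]. rewrite Rabs_pos_eq in * by auto.
      assert (Hy3 : y < eps / (C + 1)) by lra.
      apply Rmult_lt_compat_r with (r := C + 1) in Hy3; [|lra].
      unfold Rdiv in Hy3; rewrite Rmult_assoc, Rinv_l in Hy3 by lra. nra.
    + intros P [eps HP].
      assert (HC1 := Rabs_pos C).
      assert (Hd : 0 < Rmin 1 (eps / (Rabs C / s + 1))).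
      { apply Rmin_glb_lt; [lra|]. apply Rdiv_lt_0_compat; [apply cond_pos|].
        assert (0 <= Rabs C / s) by (apply Rmult_le_pos; auto; left; now apply Rinv_0_lt_compat). lra. }
      exists (mkposreal _ Hd). intros y Hy HyD. apply HP.
      change (Rabs (y - 0) < Rmin 1 (eps / (Rabs C / s + 1))) in Hy.
      change (Rabs (f' y - 0) < eps). rewrite Rminus_0_r in *.
      rewrite (Rabs_pos_eq y) in * by lra.
      unfold f'. destruct (Rle_dec y 0) as [Hy0|Hy0]; [rewrite Rabs_R0; apply cond_pos|].
      pose proof (Rmin_l 1 (eps / (Rabs C / s + 1))). pose proof (Rmin_r 1 (eps / (Rabs C / s + 1))).
      destruct (Hsmall y ltac:(lra) ltac:(lra)) as [HC Hy2].
      destruct (Hder y ltac:(lra)) as (_ & Hb & _).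
      eapply Rle_lt_trans; [exact Hb|].
      assert (Hsy : 0 < / (s * y)) by (apply Rinv_0_lt_compat; nra).
      apply Rle_lt_trans with (C * y * y / (s * y)).
      { apply Rmult_le_compat_r; lra. }
      replace (C * y * y / (s * y)) with (C / s * y) by (field; lra).
      rewrite Rabs_pos_eq in * by auto.
      assert (0 <= C / s) by (apply Rmult_le_pos; auto; left; now apply Rinv_0_lt_compat).
      assert (Hy3 : y < eps / (C / s + 1)) by lra.
      set (k := C / s) in *.
      apply Rmult_lt_compat_r with (r := k + 1) in Hy3; [|lra].
      unfold Rdiv in Hy3; rewrite Rmult_assoc, Rinv_l in Hy3 by lra. lra.
  - assert (Ht0 : 0 < t < T) by lra.
    destruct (Hder t Ht0) as (H1 & _ & H3).
    destruct (is_derive_C1_point (fun t => 0 <= t < T) f t H1 H3 Ht) as [F1 F2].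
    assert (E : f' t = Derive f t) by (unfold f'; destruct (Rle_dec t 0); [lra|auto]).
    rewrite E. split; auto.
    apply filterlim_ext_loc with (Derive f); [|exact F2].
    exists (mkposreal t (proj1 Ht0)). intros y Hy _. change (Rabs (y - t) < t) in Hy.
    apply Rabs_def2 in Hy. unfold f'. destruct (Rle_dec y 0); [lra|auto].
Qed.

(** * The invariant curve *)

Lemma bigO_ordO (p : nat) (phi : R -> R) :
  bigO (locally 0) phi (fun t => t ^ p) -> ordO p phi.
Proof.
  intros [C [eps H]]. apply ordO_of_bound with C.
  exists eps. split; [apply cond_pos|]. intros t Ht.
  rewrite <- (Rabs_pos_eq (t ^ p)) by (apply pow_le; lra). apply H.
  change (Rabs (t - 0) < eps). rewrite Rminus_0_r, Rabs_pos_eq; lra.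
Qed.

Lemma ordO_bigO_within (p : nat) (phi : R -> R) : phi 0 = 0 -> ordO p phi ->
  bigO (within (fun t => 0 <= t) (locally 0)) phi (fun t => t ^ p).
Proof.
  intros H0 (C & HC & eps & He & H). exists C. exists (mkposreal eps He).
  intros t Ht Ht0. change (Rabs (t - 0) < eps) in Ht.
  rewrite Rminus_0_r, Rabs_pos_eq in Ht by auto.
  destruct (Req_dec t 0) as [->|Hne].
  - rewrite H0, Rabs_R0. apply Rmult_le_pos; auto using Rabs_pos.
  - rewrite (Rabs_pos_eq (t ^ p)) by (apply pow_le; lra). apply H; lra.
Qed.

Lemma ordO_near0_lt (p : nat) (phi : R -> R) (e : R) : 0 < e -> ordO (S p) phi ->
  near0 (fun t => Rabs (phi t) < e).
Proof.
  intros He H. apply (ordO_weaken _ 1) in H; [|lia]. destruct H as (C & HC & H).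
  assert (D : 0 < e / (C + 1)) by (apply Rdiv_lt_0_compat; lra).
  generalize (near0_and _ _ (near0_lt _ D) H). apply near0_imp. intros t Ht [h h'].
  rewrite pow_1 in h'. apply Rmult_lt_compat_r with (r := C + 1) in h; [|lra].
  unfold Rdiv in h; rewrite Rmult_assoc, Rinv_l in h by lra. nra.
Qed.

Lemma open_near0 (U : R * R -> Prop) (X Y : R -> R) (p q : nat) : open U -> U (0, 0) ->
  ordO (S p) X -> ordO (S q) Y -> near0 (fun t => U (X t, Y t)).
Proof.
  intros HU H0 HX HY. destruct (HU _ H0) as [eps He].
  generalize (near0_and _ _ (ordO_near0_lt p X eps (cond_pos eps) HX)
    (ordO_near0_lt q Y eps (cond_pos eps) HY)). apply near0_imp.
  intros t _ [h1 h2]. apply He. split.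
  - change (Rabs (X t - 0) < eps). now rewrite Rminus_0_r.
  - change (Rabs (Y t - 0) < eps). now rewrite Rminus_0_r.
Qed.

Lemma K_expansion_leading (s : reduced_case) (k l : nat) (kappa : R) (K : R -> R * R) :
  (2 <= k)%nat -> (2 <= l)%nat -> K_expansion s k l kappa K ->
  leading (case_m s) 1 (fun t => fst (K t)) /\
  leading (case_m s + (case_N s k l - 1)) kappa (fun t => snd (K t)).
Proof.
  intros Hk Hl H. destruct s; cbn [K_expansion] in H; destruct H as [H1 H2];
    apply bigO_ordO in H1; apply bigO_ordO in H2; cbn [case_m case_N]; split.
  - eapply ordO_ext; [|exact H1]. intros; simpl; ring.
  - replace (2 + (k - 1))%nat with (k + 1)%nat by lia. unfold leading.
    replace (S (k + 1)) with (k + 2)%nat by lia. exact H2.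
  - eapply ordO_ext; [|exact H1]. intros; simpl; ring.
  - replace (1 + (l - 1))%nat with l by lia. unfold leading.
    replace (S l) with (l + 1)%nat by lia. exact H2.
  - eapply ordO_ext; [|exact H1]. intros; simpl; ring.
  - replace (1 + (l - 1))%nat with l by lia. unfold leading.
    replace (S l) with (l + 1)%nat by lia. exact H2.
Qed.

(** The exponent [2q + 1] is [2N - 1], and being beyond the resonance, [m + q < n + 1], means
    [n > k] in case 1 and [n > l - 1] in the others. *)
Lemma R_estimate_resonant (s : reduced_case) (k l n : nat) (rho de : R) (Rf Rhat : R -> R) :
  (2 <= k)%nat -> (2 <= l)%nat ->
  (forall t, Rf t = Rhat t + de * t ^ (2 * (case_N s k l - 1) + 1)) ->
  ((case_m s + (case_N s k l - 1) < n + 1)%nat -> de = 0) ->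
  R_estimate s k l n rho Rf Rhat.
Proof.
  intros Hk Hl HR Hde.
  assert (Hbig : forall N p, (N = 2 * p - 1)%nat ->
    (forall t, Rf t = Rhat t + de * t ^ N) ->
    bigO (locally 0) (fun t => Rf t - Rhat t) (fun t => t ^ (2 * p - 1))).
  { intros N p -> HN. exists (Rabs de). apply filter_forall. intros t.
    rewrite HN, <- Rabs_mult. apply Req_le. f_equal. ring. }
  destruct s; simpl in HR, Hde |- *; split;
    try (intros Hn t _; rewrite HR, Hde by lia; ring);
    intros _; eapply Hbig; try exact HR; lia.
Qed.

Theorem theorem2p3
  (U : R * R -> Prop) (HUopen : open U) (HU0 : U (0, 0))
  (F : R * R -> R * R)
  (HF1 : analytic2_on U (fun z => fst (F z)))
  (HF2 : analytic2_on U (fun z => snd (F z)))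
  (c : R) (k l r : nat) (a b : nat -> R)
  (Hred : reduced_form U F c k l r a b)
  (s : reduced_case)
  (Hcase : in_case s k l a b)
  (Hsign : sign_condition s k l a b)
  (rho : R) (Hrho : 0 < rho)
  (Khat : R -> R * R) (Rhat : R -> R)
  (HKhat1 : analytic_on (fun t => - rho < t < rho) (fun t => fst (Khat t)))
  (HKhat2 : analytic_on (fun t => - rho < t < rho) (fun t => snd (Khat t)))
  (HRhat : analytic_on (fun t => - rho < t < rho) Rhat)
  (kappa RN : R)
  (HKexp : K_expansion s k l kappa Khat)
  (HRexp : bigO (locally 0)
             (fun t => Rhat t - (t + RN * t ^ case_N s k l))
             (fun t => t ^ (case_N s k l + 1)))
  (HRN : RN < 0)
  (n : nat) (Hn : (case_n_min s <= n)%nat)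
  (Hinv1 : bigO (locally 0)
             (fun t => fst (F (Khat t)) - fst (Khat (Rhat t)))
             (fun t => t ^ (n + case_N s k l)))
  (Hinv2 : bigO (locally 0)
             (fun t => snd (F (Khat t)) - snd (Khat (Rhat t)))
             (fun t => t ^ (n + 2 * case_N s k l - 1))) :
  exists (rho' : R) (K : R -> R * R) (Rf : R -> R),
    0 < rho' <= rho /\
    C1_on (fun t => 0 <= t < rho') (fun t => fst (K t)) /\
    C1_on (fun t => 0 <= t < rho') (fun t => snd (K t)) /\
    analytic_on (fun t => 0 < t < rho') (fun t => fst (K t)) /\
    analytic_on (fun t => 0 < t < rho') (fun t => snd (K t)) /\
    analytic_on (fun t => - rho' < t < rho') Rf /\
    (forall t, 0 <= t < rho' ->
       U (K t) /\ 0 <= Rf t < rho' /\ F (K t) = K (Rf t)) /\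
    bigO (within (fun t => 0 <= t) (locally 0))
      (fun t => fst (K t) - fst (Khat t)) (fun t => t ^ (n + 1)) /\
    bigO (within (fun t => 0 <= t) (locally 0))
      (fun t => snd (K t) - snd (Khat t)) (fun t => t ^ (n + case_N s k l)) /\
    R_estimate s k l n rho' Rf Rhat.
Proof.
  destruct (reduced_weighted_form U F c k l r a b s HU0 Hred Hcase Hsign)
    as (f & i0 & i1 & A & B & HFf & Hf).
  destruct Hred as (Hc & Hk & Hl & _).
  destruct (K_expansion_leading s k l kappa Khat (proj1 Hk) (proj1 Hl) HKexp) as [L1 L2].
  pose proof (R_estimate_resonant s k l n) as HRest.
  assert (HN : (2 <= case_N s k l)%nat) by (destruct s; simpl; lia).
  assert (Hm : (1 <= case_m s)%nat) by (destruct s; simpl; lia).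
  assert (Hmn : (case_m s < n + 1)%nat) by (destruct s; simpl in *; lia).
  set (m := case_m s) in *. set (q := (case_N s k l - 1)%nat) in *.
  assert (Hq : (1 <= q)%nat) by (unfold q; lia).
  (* Since [N = q + 1], the given errors [n + N] and [n + 2N - 1] are [nu + q] and [nu + 2q] for
     [nu = n + 1]. *)
  assert (HI : approx_invariant m q (n + 1) c RN kappa f
    (fun t => fst (Khat t)) (fun t => snd (Khat t)) Rhat).
  { assert (H00 : - rho < 0 < rho) by lra.
    assert (HU' : near0 (fun t => U (fst (Khat t), snd (Khat t)))).
    { apply open_near0 with (m - 1)%nat (m + q - 1)%nat; auto.
      - replace (S (m - 1)) with m by lia. eapply leading_ordO; exact L1.
      - replace (S (m + q - 1)) with (m + q)%nat by lia. eapply leading_ordO; exact L2. }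
    split; [split; [|split]; apply analytic_at_germ; auto|].
    split; [exact L1|]. split; [exact L2|]. split; [|split].
    - apply bigO_ordO in HRexp. unfold leading.
      replace (case_N s k l + 1)%nat with (S (S q)) in HRexp by (unfold q; lia).
      replace (case_N s k l) with (S q) in HRexp by (unfold q; lia).
      eapply ordO_ext; [|exact HRexp]. intros; simpl; ring.
    - apply bigO_ordO in Hinv1.
      replace (n + 1 + q)%nat with (n + case_N s k l)%nat by (unfold q; lia).
      eapply ordO_ext_near; [|exact Hinv1]. revert HU'. apply near0_imp. intros t _ Ht.
      rewrite (surjective_pairing (Khat t)) at 1. now rewrite (HFf _ _ Ht).
    - apply bigO_ordO in Hinv2.
      replace (n + 1 + 2 * q)%nat with (n + 2 * case_N s k l - 1)%nat by (unfold q; lia).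
      eapply ordO_ext_near; [|exact Hinv2]. revert HU'. apply near0_imp. intros t _ Ht.
      rewrite (surjective_pairing (Khat t)) at 1. now rewrite (HFf _ _ Ht). }
  destruct (invariant_curve_exists m q i0 i1 A B c RN kappa f Hm Hq Hc HRN Hf) as [nu0 Hcurve].
  (* Raising the order by [nu0] brings it above the threshold [nu0], wherever it started. *)
  destruct (approx_invariant_extend m q (n + 1) i0 i1 nu0 A B c RN kappa f _ _ _ Hm Hq Hmn Hc HRN Hf HI)
    as (M1 & M2 & de & HI' & O1 & O2 & Hde).
  set (Q := fun t => Rhat t + de * t ^ (2 * q + 1)) in *.
  destruct (Hcurve (n + 1 + nu0)%nat M1 M2 Q ltac:(lia) ltac:(lia) HI')
    as (sg & T & C & D1 & D2 & Hsg & HT & Z1 & Z2 & HD).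
  assert (Zf : f 0 0 = 0) by apply Hf.
  assert (Hzero : forall K p e, analytic_germ K -> leading p e K -> (1 <= p)%nat -> K 0 = 0).
  { intros K p e HK HL Hp. apply (germ_ordO_zero K (p - 1)); auto.
    replace (S (p - 1)) with p by lia. eapply leading_ordO; exact HL. }
  destruct HI as ((G1 & G2 & G3) & _).
  destruct HI' as ((G1' & G2' & G3') & L1' & L2' & L3' & _).
  assert (X1 := Hzero _ _ _ G1 L1 Hm). assert (X2 := Hzero _ _ _ G2 L2 ltac:(lia)).
  assert (X1' := Hzero _ _ _ G1' L1' Hm). assert (X2' := Hzero _ _ _ G2' L2' ltac:(lia)).
  assert (X3' := Hzero _ _ _ G3' (leading_near_id q RN Q Hq L3') (le_n 1)).
  simpl in X1, X2.
  assert (Hval : forall t phi M, 0 < t -> wiener (fun h => phi (t + h)) (sg * t) M -> Rabs (phi t) <= M).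
  { intros t phi M Ht H. replace (phi t) with (phi (t + 0)) by (f_equal; ring).
    apply (wiener_value (fun h => phi (t + h)) (sg * t)); auto. rewrite Rabs_R0; nra. }
  assert (OD1 : ordO (n + 1 + nu0) D1).
  { apply ordO_of_bound with C. exists T. split; auto. intros t Ht.
    apply Hval; [lra|]. now apply HD. }
  assert (OD2 : ordO (n + 1 + nu0 + q) D2).
  { apply ordO_of_bound with C. exists T. split; auto. intros t Ht.
    apply Hval; [lra|]. now apply HD. }
  assert (HUK : near0 (fun t => U (M1 t + D1 t, M2 t + D2 t))).
  { apply open_near0 with (m - 1)%nat (m + q - 1)%nat; auto; apply ordO_plus.
    - replace (S (m - 1)) with m by lia. eapply leading_ordO; exact L1'.
    - apply ordO_weaken with (n + 1 + nu0)%nat; [lia|exact OD1].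
    - replace (S (m + q - 1)) with (m + q)%nat by lia. eapply leading_ordO; exact L2'.
    - apply ordO_weaken with (n + 1 + nu0 + q)%nat; [lia|exact OD2]. }
  destruct G1' as (r1 & B1 & Hr1 & W1). destruct G2' as (r2 & B2 & Hr2 & W2).
  destruct G3' as (r3 & B3 & Hr3 & W3). destruct HUK as (eU & HeU & HUK).
  (* Any such radius is mapped into itself, because [0 < Q t < t]. *)
  assert (Hrad : exists rho', 0 < rho' /\ rho' <= rho /\ rho' <= T /\ rho' <= eU /\
    rho' <= r1 /\ rho' <= r2 /\ rho' <= r3).
  { exists (Rmin (Rmin (Rmin rho T) (Rmin eU r1)) (Rmin r2 r3)).
    repeat split; repeat apply Rmin_glb_lt; auto;
      unfold Rmin; repeat destruct Rle_dec; lra. }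
  destruct Hrad as (rho' & P0 & P1 & P2 & P3 & P4 & P5 & P6).
  assert (HK1 : forall t, 0 < t < rho' -> analytic_at (fun t => M1 t + D1 t) t).
  { intros t Ht. destruct (HD t ltac:(lra)) as (_ & w1 & _ & w3 & _).
    assert (Hst : 0 < sg * t) by nra.
    apply (wiener_analytic _ t (sg * t) _ Hst (wiener_plus _ _ _ _ _ (Rlt_le _ _ Hst) w1 w3)). }
  assert (HK2 : forall t, 0 < t < rho' -> analytic_at (fun t => M2 t + D2 t) t).
  { intros t Ht. destruct (HD t ltac:(lra)) as (_ & _ & w2 & _ & w4 & _).
    assert (Hst : 0 < sg * t) by nra.
    apply (wiener_analytic _ t (sg * t) _ Hst (wiener_plus _ _ _ _ _ (Rlt_le _ _ Hst) w2 w4)). }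
  exists rho', (fun t => (M1 t + D1 t, M2 t + D2 t)), Q.
  cbn [fst snd].
  split; [lra|]. split; [|split; [|split; [exact HK1|split; [exact HK2|split; [|split; [|split; [|split]]]]]]].
  - apply C1_on_plus; [now apply C1_on_germ with r1 B1|].
    apply (C1_on_flat sg rho' C (n + nu0 - 1)); [lra|auto|].
    intros t Ht. replace (S (S (n + nu0 - 1))) with (n + 1 + nu0)%nat by lia. apply HD; lra.
  - apply C1_on_plus; [now apply C1_on_germ with r2 B2|].
    apply (C1_on_flat sg rho' C (n + nu0 + q - 1)); [lra|auto|].
    intros t Ht. replace (S (S (n + nu0 + q - 1))) with (n + 1 + nu0 + q)%nat by lia. apply HD; lra.
  - intros t Ht. assert (Hs : 0 < r3 - Rabs t).
    { assert (Rabs t < rho') by (apply Rabs_def1; lra). lra. }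
    apply (wiener_analytic Q t (r3 - Rabs t) B3 Hs).
    apply wiener_recenter with r3; auto. lra.
  - intros t Ht. destruct (Req_dec t 0) as [->|Hne].
    + rewrite X1', X2', X3', Z1, Z2, X1', X2', !Rplus_0_r. split; auto. split; [lra|].
      rewrite HFf by auto. rewrite Zf. f_equal; ring.
    + destruct (HD t ltac:(lra)) as (q1 & _ & _ & _ & _ & q2 & q3).
      assert (Hu : U (M1 t + D1 t, M2 t + D2 t)) by (apply HUK; lra).
      split; [exact Hu|]. split; [lra|]. rewrite (HFf _ _ Hu), q2, q3. reflexivity.
  - apply ordO_bigO_within; [rewrite X1, X1', Z1; ring|].
    (* The formal corrections start at order [n + 1]; the analytic one, [D1], is of higher or equal
       order. *)
    apply ordO_ext with (fun t => (M1 t - fst (Khat t)) + D1 t); [intros; ring|].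
    apply ordO_plus; [exact O1|]. apply ordO_weaken with (n + 1 + nu0)%nat; [lia|exact OD1].
  - apply ordO_bigO_within; [rewrite X2, X2', Z2; ring|].
    replace (n + case_N s k l)%nat with (n + 1 + q)%nat by (unfold q; lia).
    apply ordO_ext with (fun t => (M2 t - snd (Khat t)) + D2 t); [intros; ring|].
    apply ordO_plus; [exact O2|]. apply ordO_weaken with (n + 1 + nu0 + q)%nat; [lia|exact OD2].
  - apply HRest with de; try lia; auto.
Qed.
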